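(* Under rerandomization with tiers of factorial effects ($\text{ReFMT}_\text{F}$) with thresholds $a_1,\dots,a_H>0$, and under the regularity conditions (i)–(iii) below, $$\hat{\boldsymbol{\tau}}-\boldsymbol{\tau}\mid\mathcal{T}_F\ \dot\sim\ (\boldsymbol{V}^{\perp}_{\tau\tau})^{1/2}\boldsymbol{\varepsilon}+\sum_{h=1}^H(\boldsymbol{W}^{\parallel}_{\tau\tau}[h])^{1/2}_{LF_h}\boldsymbol{\zeta}_{LF_h,a_h},$$ where $\boldsymbol{\varepsilon}\sim\mathcal{N}(\boldsymbol{0},\boldsymbol{I}_F),\boldsymbol{\zeta}_{LF_1,a_1},\dots,\boldsymbol{\zeta}_{LF_H,a_H}$ are jointly independent.
   Context: Setup ($2^K$ factorial experiment, finite population). $K\ge1$ two-level factors, $Q=2^K$ treatment combinations $q=1,\dots,Q$; combination $q$ sets factor $k$ at $\iota_k(q)\in\{-1,+1\}$, bijectively onto $\{-1,+1\}^K$. $F=Q-1$ factorial effects, one per nonempty $A\subseteq\{1,\dots,K\}$, enumerated $f=1,\dots,F$, with $g_{fq}=\prod_{k\in A}\iota_k(q)$; $\boldsymbol{b}_q=(g_{1q},\dots,g_{Fq})'$. Units $i=1,\dots,n$ have fixed potential outcomes $Y_i(q)$ and covariates $\boldsymbol{x}_i\in\mathbb{R}^L$; $\bar Y(q),\bar{\boldsymbol{x}}$ means; $\boldsymbol{\tau}=2^{-(K-1)}\sum_q\boldsymbol{b}_q\bar Y(q)$. Finite-population (co)variances with divisor $n-1$: $S_{qk}$ between $Y(q),Y(k)$;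 $\boldsymbol{S}_{xx}$ of $\boldsymbol{x}$; $\boldsymbol{S}_{q,x}$ between $Y(q),\boldsymbol{x}$. $Y_i^{\perp}(q)=Y_i(q)-\bar Y(q)-\boldsymbol{S}_{q,x}\boldsymbol{S}_{xx}^{-1}(\boldsymbol{x}_i-\bar{\boldsymbol{x}})$, $\boldsymbol{\tau}_i^{\perp}=2^{-(K-1)}\sum_q\boldsymbol{b}_qY_i^{\perp}(q)$, $S^{\perp}_{qq}$ and $\boldsymbol{S}^{\perp}_{\tau\tau}$ their finite-population variances, $\boldsymbol{V}^{\perp}_{\tau\tau}=2^{-2(K-1)}\sum_qn_q^{-1}\boldsymbol{b}_q\boldsymbol{b}_q'S^{\perp}_{qq}-n^{-1}\boldsymbol{S}^{\perp}_{\tau\tau}$. CRFE: fixed $n_q\ge1$, $\sum n_q=n$; $\boldsymbol{Z}$ uniform over assignments with $n_q$ units in combination $q$; $\hat{\bar Y}(q),\hat{\bar{\boldsymbol{x}}}(q)$ group-$q$ means of observed outcomes $Y_i(Z_i)$ and covariates; $\hat{\boldsymbol{\tau}}=2^{-(K-1)}\sum_q\boldsymbol{b}_q\hat{\bar Y}(q)$. Tiers: partition $\{1,\dots,F\}$ into disjoint nonempty $\mathcal{F}_1,\dots,\mathcal{F}_H$, $F_h=|\mathcal{F}_h|$, $\mathcal{F}_{\overline h}=\bigcup_{l\le h}\mathcal{F}_l$. $\tilde{\boldsymbol{B}}=2^{-2(K-1)}\sum_qn_q^{-1}\boldsymbol{b}_q\boldsymbol{b}_q'$; for index sets $\mathcal{I},\mathcal{J}$,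 $\boldsymbol{b}_q[\mathcal{I}]$ is the subvector and $\tilde{\boldsymbol{B}}[\mathcal{I},\mathcal{J}]$ the submatrix. Define $\boldsymbol{c}_q[1]=\boldsymbol{b}_q[\mathcal{F}_1]$ and for $h\ge2$, $\boldsymbol{c}_q[h]=\boldsymbol{b}_q[\mathcal{F}_h]-\tilde{\boldsymbol{B}}[\mathcal{F}_h,\mathcal{F}_{\overline{h-1}}]\{\tilde{\boldsymbol{B}}[\mathcal{F}_{\overline{h-1}},\mathcal{F}_{\overline{h-1}}]\}^{-1}\boldsymbol{b}_q[\mathcal{F}_{\overline{h-1}}]$. Let $\hat{\boldsymbol{\theta}}_x[h]=2^{-(K-1)}\sum_q\boldsymbol{c}_q[h]\otimes\hat{\bar{\boldsymbol{x}}}(q)$, $\boldsymbol{W}_{\tau x}[h]=2^{-2(K-1)}\sum_qn_q^{-1}(\boldsymbol{b}_q\boldsymbol{c}_q[h]')\otimes\boldsymbol{S}_{q,x}$, $\boldsymbol{W}_{x\tau}[h]=\boldsymbol{W}_{\tau x}[h]'$, $\boldsymbol{W}_{xx}[h]=2^{-2(K-1)}\sum_qn_q^{-1}(\boldsymbol{c}_q[h]\boldsymbol{c}_q[h]')\otimes\boldsymbol{S}_{xx}$, $\boldsymbol{W}^{\parallel}_{\tau\tau}[h]=\boldsymbol{W}_{\tau x}[h]\boldsymbol{W}_{xx}[h]^{-1}\boldsymbol{W}_{x\tau}[h]$, and $M_h=\hat{\boldsymbol{\theta}}_x[h]'\boldsymbol{W}_{xx}[h]^{-1}\hat{\boldsymbol{\theta}}_x[h]$.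 $\text{ReFMT}_\text{F}$ accepts an assignment iff $M_h\le a_h$ for all $h$; $\mathcal{T}_F$ is this event, and the distribution under $\text{ReFMT}_\text{F}$ is the CRFE distribution conditional on $\mathcal{T}_F$. Matrix roots: $\boldsymbol{A}^{1/2}$ symmetric PSD root; $\boldsymbol{A}^{1/2}_p$ any $m\times p$ matrix with $\boldsymbol{A}^{1/2}_p(\boldsymbol{A}^{1/2}_p)'=\boldsymbol{A}$ ($p\ge\mathrm{rank}\,\boldsymbol{A}$). $\boldsymbol{\zeta}_{m,a}\sim\boldsymbol{D}\mid\boldsymbol{D}'\boldsymbol{D}\le a$, $\boldsymbol{D}\sim\mathcal{N}(\boldsymbol{0},\boldsymbol{I}_m)$. Regularity conditions, as $n\to\infty$, for all $q\ne k$: (i) $n_q/n$ has a positive limit; (ii) $S_{qq},S_{qk},\boldsymbol{S}_{xx},\boldsymbol{S}_{q,x}$ have limits, $\boldsymbol{S}_{xx}$ and its limit nonsingular; (iii) $\max_i|Y_i(q)-\bar Y(q)|^2/n\to0$, $\max_i\|\boldsymbol{x}_i-\bar{\boldsymbol{x}}\|_2^2/n\to0$. $\boldsymbol{A}_n\dot\sim\boldsymbol{B}_n$ means $\sqrt n\boldsymbol{A}_n$ and $\sqrt n\boldsymbol{B}_n$ converge weakly to the same distribution. *)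

(* Defs.v *)
From HB Require Import structures.
From mathcomp Require Import all_boot all_order all_algebra.
From mathcomp Require Import all_classical all_reals all_analysis.
From mathcomp Require Import mxtens.
Set Implicit Arguments. Unset Strict Implicit. Unset Printing Implicit Defensive.
Import Order.TTheory GRing.Theory Num.Theory.
Local Open Scope classical_set_scope.
Local Open Scope ring_scope.

Section Generic.
Context {R : realType}.

Definition fpmean n p q (u : 'I_n -> 'M[R]_(p, q)) : 'M[R]_(p, q) :=
  (n%:R)^-1 *: \sum_i u i.
Definition fpcov n p r (u : 'I_n -> 'cV[R]_p) (v : 'I_n -> 'cV[R]_r) : 'M[R]_(p, r) :=
  ((n.-1)%:R)^-1 *: \sum_i ((u i - fpmean u) *m (v i - fpmean v)^T).
Definition sc n (u : 'I_n -> R) : 'I_n -> 'cV[R]_1 := fun i => (u i)%:M.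

Definition subv m (I : {set 'I_m}) (v : 'cV[R]_m) : 'cV[R]_#|I| :=
  \col_i v (enum_val i) 0.
Definition subm m (I J : {set 'I_m}) (A : 'M[R]_m) : 'M[R]_(#|I|, #|J|) :=
  \matrix_(i, j) A (enum_val i) (enum_val j).

(* expectation of g(D), D ~ N(0, I_m), as iterated integrals against the
   standard normal density *)
Fixpoint gaussE (m : nat) : (m.-tuple R -> R) -> R :=
  match m return (m.-tuple R -> R) -> R with
  | 0 => fun g => g [tuple]
  | m'.+1 => fun g =>
      Rintegral lebesgue_measure setT
        (fun s => normal_pdf 0 1 s * gaussE (fun t => g (cons_tuple s t)))
  end.

Definition tcol m (t : m.-tuple R) : 'cV[R]_m := \col_i tnth t i.

End Generic.

Section Factorial.
Context {R : realType}.
Variable K : nat.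
Local Notation Q := (2 ^ K)%N.
Local Notation F := (2 ^ K).-1.
(* iota q k = true  <->  factor k at level +1 in combination q *)
Variable iota : 'I_Q -> {ffun 'I_K -> bool}.
(* eff f = the nonempty subset A of factors defining effect f *)
Variable eff : 'I_F -> {set 'I_K}.

Definition lev (q : 'I_Q) (k : 'I_K) : R := if iota q k then 1 else -1.
Definition bvec (q : 'I_Q) : 'cV[R]_F := \col_f \prod_(k in eff f) lev q k.
Definition c2 : R := ((2 ^ K.-1)%N%:R)^-1.

Variable H : nat.
Variable tier : 'I_F -> 'I_H.
Definition Ftier (h : 'I_H) : {set 'I_F} := [set f | tier f == h].
Definition Fbefore (h : 'I_H) : {set 'I_F} := [set f | (tier f < h)%N].

Variable L : nat.

Variable n : nat.
Variable Y : 'I_n -> 'I_Q -> R.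
Variable x : 'I_n -> 'cV[R]_L.
Variable nq : 'I_Q -> nat.

Definition Ybar q : R := (fpmean (sc (Y^~ q))) 0 0.
Definition xbar : 'cV[R]_L := fpmean x.
Definition Sqk q k : R := (fpcov (sc (Y^~ q)) (sc (Y^~ k))) 0 0.
Definition Sxx : 'M[R]_L := fpcov x x.
Definition Sqx q : 'rV[R]_L := fpcov (sc (Y^~ q)) x.
Definition tau : 'cV[R]_F := c2 *: \sum_q Ybar q *: bvec q.

Definition Yperp i q : R :=
  Y i q - Ybar q - (Sqx q *m invmx Sxx *m (x i - xbar)) 0 0.
Definition tauperp i : 'cV[R]_F := c2 *: \sum_q Yperp i q *: bvec q.
Definition Sperp q : R := (fpcov (sc (Yperp^~ q)) (sc (Yperp^~ q))) 0 0.
Definition Sperp_tt : 'M[R]_F := fpcov tauperp tauperp.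
Definition Vperp : 'M[R]_F :=
  c2 ^+ 2 *: \sum_q ((nq q)%:R^-1 * Sperp q) *: (bvec q *m (bvec q)^T)
  - (n%:R)^-1 *: Sperp_tt.

Definition Btilde : 'M[R]_F :=
  c2 ^+ 2 *: \sum_q (nq q)%:R^-1 *: (bvec q *m (bvec q)^T).

(* c_q[h]; for the first tier Fbefore h is empty and the correction is 0 *)
Definition cvec (h : 'I_H) (q : 'I_Q) : 'cV[R]_#|Ftier h| :=
  subv (Ftier h) (bvec q)
  - subm (Ftier h) (Fbefore h) Btilde
      *m invmx (subm (Fbefore h) (Fbefore h) Btilde)
      *m subv (Fbefore h) (bvec q).

Definition W_tx (h : 'I_H) : 'M[R]_(F, #|Ftier h| * L) :=
  castmx (muln1 F, erefl)
    (c2 ^+ 2 *: \sum_q (nq q)%:R^-1 *: ((bvec q *m (cvec h q)^T) *t Sqx q)).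
Definition W_xx (h : 'I_H) : 'M[R]_(#|Ftier h| * L, #|Ftier h| * L) :=
  c2 ^+ 2 *: \sum_q (nq q)%:R^-1 *: ((cvec h q *m (cvec h q)^T) *t Sxx).
Definition W_par (h : 'I_H) : 'M[R]_F :=
  W_tx h *m invmx (W_xx h) *m (W_tx h)^T.

(* completely randomized assignments: Z i = treatment combination of unit i *)
Definition admissible (Z : {ffun 'I_n -> 'I_Q}) : bool :=
  [forall q, #|[set i | Z i == q]| == nq q].
Definition Yhat (Z : {ffun 'I_n -> 'I_Q}) q : R :=
  (nq q)%:R^-1 * \sum_(i | Z i == q) Y i q.
Definition xhat (Z : {ffun 'I_n -> 'I_Q}) q : 'cV[R]_L :=
  (nq q)%:R^-1 *: \sum_(i | Z i == q) x i.
Definition tauhat (Z : {ffun 'I_n -> 'I_Q}) : 'cV[R]_F :=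
  c2 *: \sum_q Yhat Z q *: bvec q.
Definition theta_x (Z : {ffun 'I_n -> 'I_Q}) (h : 'I_H) : 'cV[R]_(#|Ftier h| * L) :=
  c2 *: \sum_q (cvec h q *t xhat Z q).
Definition Mstat (Z : {ffun 'I_n -> 'I_Q}) (h : 'I_H) : R :=
  ((theta_x Z h)^T *m invmx (W_xx h) *m theta_x Z h) 0 0.
Definition accepted (a : 'I_H -> R) (Z : {ffun 'I_n -> 'I_Q}) : bool :=
  [forall h, Mstat Z h <= a h].

(* E[ g(sqrt n (tauhat - tau)) | T_F ] under the CRFE *)
Definition lhsE (a : 'I_H -> R) (g : 'cV[R]_F -> R) : R :=
  (\sum_(Z | admissible Z && accepted a Z) g (Num.sqrt n%:R *: (tauhat Z - tau)))
  / #|[set Z | admissible Z && accepted a Z]|%:R.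

(* limiting representation: eps ~ N(0,I_F) and independent D_h ~ N(0, I_{F_h L}),
   all packed into one standard normal vector of dimension Tdim;
   zeta_h = D_h conditioned on D_h'D_h <= a_h *)
Definition Tdim : nat := (F + \sum_(h < H) #|Ftier h| * L)%N.
Definition blk_off (h : 'I_H) : nat := (F + \sum_(l < H | (l < h)%N) #|Ftier l| * L)%N.
Definition eps_of (t : Tdim.-tuple R) : 'cV[R]_F := \col_i nth 0 t i.
Definition D_of (t : Tdim.-tuple R) (h : 'I_H) : 'cV[R]_(#|Ftier h| * L) :=
  \col_j nth 0 t (blk_off h + j).
Definition inball (a : 'I_H -> R) (t : Tdim.-tuple R) : R :=
  \prod_h (if ((D_of t h)^T *m D_of t h) 0 0 <= a h then 1 else 0).

(* E[ g(sqrt n (Vr eps + sum_h Wr_h zeta_{h})) ] *)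
Definition rhsE (Vr : 'M[R]_F) (Wr : forall h : 'I_H, 'M[R]_(F, #|Ftier h| * L))
  (a : 'I_H -> R) (g : 'cV[R]_F -> R) : R :=
  gaussE (fun t : Tdim.-tuple R =>
     g (Num.sqrt n%:R *: (Vr *m eps_of t + \sum_h Wr h *m D_of t h)) * inball a t)
  / gaussE (inball a).

End Factorial.

(* Main.v *)
(* The pair formed by sqrt(n) (tauhat - tau) and the covariate contrasts
   sqrt(n) theta_x[h], standardised in each tier, satisfies a joint central limit
   theorem under complete randomization: a linear functional of the pair is a sum
   of a_{i, Z_i}, and its characteristic function is controlled by Stein's method
   with random transpositions.  The c_q[h], scaled by the square roots of 1 / n_q,
   form together with the constant direction an orthogonal basis of R^Q, so that
   the limiting covariance splits into V^perp, independent of all covariate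
   contrasts, and one block W^par[h] for each tier.  In the limit the acceptance
   event is that the standardised Gaussian block of tier h has squared norm at
   most a_h, for every h; the boundary of this event is a null set, hence weak
   convergence passes to the conditional laws.  On the side of the representation,
   the law of a matrix image of (eps, zeta) depends, by rotation invariance inside
   each block, only on V^perp and W^par[h], whatever square roots are chosen, and
   n V^perp and n W^par[h] converge. *)
Require Import Defs.
From HB Require Import structures.
From mathcomp Require Import all_boot all_order all_algebra.
From mathcomp Require Import all_classical all_reals all_analysis.
From mathcomp Require Import measurable_realfun perm mxtens ring lra.
Set Implicit Arguments. Unset Strict Implicit. Unset Printing Implicit Defensive.
Import Order.TTheory GRing.Theory Num.Theory numFieldNormedType.Exports.
Local Open Scope classical_set_scope.
Local Open Scope ring_scope.

(** * Limits and continuity of matrices *)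

Section Limits.
Context {R : realType}.

Lemma cvg_bigsum (T I : Type) (Fl : set_system T) {FF : Filter Fl} (r : seq I)
    (P : pred I) (f : I -> T -> R) (l : I -> R) :
  (forall i, P i -> f i x @[x --> Fl] --> l i) ->
  \sum_(i <- r | P i) f i x @[x --> Fl] --> \sum_(i <- r | P i) l i.
Proof.
move=> fl; elim: r => [|i r IH].
  by under eq_fun do rewrite big_nil; rewrite big_nil; exact: cvg_cst.
under eq_fun do rewrite big_cons; rewrite big_cons; case: ifP => // Pi.
by apply: cvgD => //; exact: fl.
Qed.

Lemma cvg_bigprod (T I : Type) (Fl : set_system T) {FF : Filter Fl} (r : seq I)
    (P : pred I) (f : I -> T -> R) (l : I -> R) :
  (forall i, P i -> f i x @[x --> Fl] --> l i) ->
  \prod_(i <- r | P i) f i x @[x --> Fl] --> \prod_(i <- r | P i) l i.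
Proof.
move=> fl; elim: r => [|i r IH].
  by under eq_fun do rewrite big_nil; rewrite big_nil; exact: cvg_cst.
under eq_fun do rewrite big_cons; rewrite big_cons; case: ifP => // Pi.
by apply: cvgM => //; exact: fl.
Qed.

Lemma mx_cvgP (T : Type) (Fl : set_system T) {FF : Filter Fl} (p q : nat)
    (A : T -> 'M[R]_(p, q)) (B : 'M[R]_(p, q)) :
  A x @[x --> Fl] --> B <-> forall i j, A x i j @[x --> Fl] --> B i j.
Proof.
split=> [AB i j|AB].
  by apply: (cvg_comp A (fun M : 'M[R]_(p, q) => M i j) AB); exact: coord_continuous.
move=> U [P PB PU]; apply: (@filterS _ _ _ [set x | forall i j, P i j (A x i j)]).
  by move=> x Px; apply: PU => i j; exact: Px.
have H i j : Fl [set x | P i j (A x i j)] by exact: (AB i j _ (PB i j)).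
have := @filter_forall _ ('I_p * 'I_q)%type (fun ij x => P ij.1 ij.2 (A x ij.1 ij.2)) Fl FF (fun ij => H ij.1 ij.2).
by apply: filterS => x Px i j; exact: (Px (i, j)).
Qed.

Lemma mx_ball_lt (p q : nat) (A : 'M[R]_(p, q)) (U : set 'M[R]_(p, q)) :
  nbhs A U -> exists2 e : R, 0 < e &
    forall B : 'M[R]_(p, q), (forall i j, `|A i j - B i j| < e) -> U B.
Proof.
move=> /nbhs_ballP[e /= e0 eU]; exists e => // B AB; apply: eU; split => // i j; exact: AB.
Qed.

Lemma continuous_cstf (T : topologicalType) (c : R) : continuous (fun _ : T => c).
Proof. by move=> x; exact: cvg_cst. Qed.

Lemma continuous_addf (T : topologicalType) (f g : T -> R) :
  continuous f -> continuous g -> continuous (fun x => f x + g x).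
Proof. by move=> cf cg x; apply: cvgD; [exact: cf|exact: cg]. Qed.

Lemma continuous_mulf (T : topologicalType) (f g : T -> R) :
  continuous f -> continuous g -> continuous (fun x => f x * g x).
Proof. by move=> cf cg x; apply: cvgM; [exact: cf|exact: cg]. Qed.

Lemma continuous_divf (T : topologicalType) (f g : T -> R) : (forall x, g x != 0) ->
  continuous f -> continuous g -> continuous (fun x => f x / g x).
Proof. by move=> g0 cf cg x; apply: cvgM; [exact: cf|apply: cvgV => //; exact: cg]. Qed.

Lemma continuous_bigsum (T : topologicalType) (I : Type) (r : seq I) (P : pred I)
    (f : I -> T -> R) : (forall i, P i -> continuous (f i)) ->
  continuous (fun x => \sum_(i <- r | P i) f i x).
Proof. by move=> cf x; apply: cvg_bigsum => i Pi; exact: cf. Qed.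

Lemma continuous_compf (T U V : topologicalType) (f : T -> U) (g : U -> V) :
  continuous f -> continuous g -> continuous (fun x => g (f x)).
Proof. by move=> cf cg x; apply: continuous_comp; [exact: cf|exact: cg]. Qed.

Lemma continuous_coord (p q : nat) i j : continuous (fun A : 'M[R]_(p, q) => A i j).
Proof. exact: coord_continuous. Qed.

Lemma continuous_mxP (T : topologicalType) (p q : nat) (f : T -> 'M[R]_(p, q)) :
  (forall i j, continuous (fun x => f x i j)) -> continuous f.
Proof. by move=> cf x; apply/mx_cvgP => i j; exact: cf. Qed.

End Limits.

(** * Combinatorial central limit theorem *)

Section CombinatorialCLT.
Context {R : realType}.
Variables (n : nat) (Q : finType) (nq : Q -> nat).
Local Notation asg := {ffun 'I_n -> Q}.
Implicit Types (Z : asg) (b : 'I_n -> Q -> R) (phi : Q -> R).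

Definition has_sizes Z : bool := [forall q, #|[pred i | Z i == q]| == nq q].
Definition avg (f : asg -> R) : R :=
  (#|has_sizes|%:R)^-1 * \sum_(Z | has_sizes Z) f Z.
Definition swp (i j : 'I_n) Z : asg := [ffun k => Z (tperm i j k)].
Definition lstat b Z : R := \sum_i b i (Z i).
Definition swdiff b (i j : 'I_n) Z : R :=
  b i (Z i) + b j (Z j) - b i (Z j) - b j (Z i).
Definition msq b : R := n%:R^-1 * \sum_i \sum_q (nq q)%:R * b i q ^+ 2.

Lemma swpK i j : involutive (swp i j).
Proof. by move=> Z; apply/ffunP => k; rewrite !ffunE tpermK. Qed.

Lemma has_sizes_swp i j Z : has_sizes (swp i j Z) = has_sizes Z.
Proof.
apply: eq_forallb => q; congr (_ == _).
rewrite -[RHS](fintype.card_image (@perm_inj _ (tperm i j))); apply: eq_card => k.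
rewrite [in LHS]inE/= ffunE; apply/idP/mapP => [h|[l]].
  by exists (tperm i j k); rewrite ?mem_enum ?inE ?tpermK.
by rewrite mem_enum inE => h ->; rewrite tpermK.
Qed.

Lemma avg_swp i j f : avg (fun Z => f (swp i j Z)) = avg f.
Proof.
rewrite /avg; congr (_ * _).
rewrite [RHS](reindex_inj (inv_inj (swpK i j))).
by apply: eq_bigl => Z; rewrite has_sizes_swp.
Qed.

Lemma eq_avg f g : (forall Z, has_sizes Z -> f Z = g Z) -> avg f = avg g.
Proof. by move=> fg; congr (_ * _); apply: eq_bigr => Z; exact: fg. Qed.

Lemma avgD f g : avg (fun Z => f Z + g Z) = avg f + avg g.
Proof. by rewrite /avg big_split mulrDr. Qed.

Lemma avgZ c f : avg (fun Z => c * f Z) = c * avg f.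
Proof. by rewrite /avg -mulr_sumr mulrCA. Qed.

Lemma avgN f : avg (fun Z => - f Z) = - avg f.
Proof. by rewrite /avg sumrN mulrN. Qed.

Lemma avgB f g : avg (fun Z => f Z - g Z) = avg f - avg g.
Proof. by rewrite avgD avgN. Qed.

Lemma avg_sum (I : Type) (r : seq I) (P : pred I) (F : I -> asg -> R) :
  avg (fun Z => \sum_(i <- r | P i) F i Z) = \sum_(i <- r | P i) avg (F i).
Proof. by rewrite /avg exchange_big mulr_sumr. Qed.

Lemma ler_avg f g : (forall Z, has_sizes Z -> f Z <= g Z) -> avg f <= avg g.
Proof.
by move=> fg; rewrite ler_wpM2l ?invr_ge0 ?ler0n//; exact: ler_sum.
Qed.

Lemma ler_norm_avg f : `|avg f| <= avg (fun Z => `|f Z|).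
Proof.
by rewrite normrM ger0_norm ?invr_ge0 ?ler0n// ler_wpM2l ?invr_ge0 ?ler0n//
  ler_norm_sum.
Qed.

Lemma sum_has_sizes Z phi : has_sizes Z ->
  \sum_i phi (Z i) = \sum_q (nq q)%:R * phi q.
Proof.
move=> /forallP hZ; rewrite (partition_big Z predT)//=.
apply: eq_bigr => q _; rewrite (eq_bigr (fun=> phi q)) => [|i /eqP->//].
by rewrite sumr_const -(eqP (hZ q)) mulr_natl.
Qed.

Hypothesis n_gt0 : (0 < n)%N.
Hypothesis ex_sizes : exists Z, has_sizes Z.

Let card_neq0 : #|has_sizes|%:R != 0 :> R.
Proof.
by have [Z hZ] := ex_sizes; rewrite pnatr_eq0 -lt0n; apply/card_gt0P; exists Z.
Qed.

Let nR_neq0 : n%:R != 0 :> R. Proof. by rewrite pnatr_eq0 -lt0n. Qed.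
Let nR_gt0 : 0 < n%:R :> R. Proof. by rewrite ltr0n. Qed.

Lemma avg_cst c : avg (fun=> c) = c.
Proof.
rewrite /avg sumr_const (_ : #|_| = #|has_sizes|)//.
by rewrite -[c *+ _]mulr_natl mulrA mulVf ?mul1r.
Qed.

Lemma avg_coord phi i : avg (fun Z => phi (Z i)) = n%:R^-1 * \sum_q (nq q)%:R * phi q.
Proof.
rewrite -[X in _ * X]avg_cst.
rewrite [in RHS](@eq_avg _ (fun Z => \sum_j phi (Z j))); last first.
  by move=> Z hZ; rewrite sum_has_sizes.
rewrite avg_sum (eq_bigr (fun=> avg (fun Z => phi (Z i)))).
  by rewrite sumr_const card_ord -[X in _ = _ * X]mulr_natl mulrA mulVf ?mul1r.
move=> j _; rewrite -(avg_swp i j); apply: eq_avg => Z _.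
by rewrite ffunE tpermR.
Qed.

Lemma avg_lstat b : avg (lstat b) = n%:R^-1 * \sum_i \sum_q (nq q)%:R * b i q.
Proof.
rewrite /lstat avg_sum mulr_sumr; apply: eq_bigr => i _.
exact: (avg_coord (b i)).
Qed.

Lemma avg_sqr_lstat b : avg (lstat (fun i q => b i q ^+ 2)) = msq b.
Proof. exact: avg_lstat. Qed.

Lemma msq_ge0 b : 0 <= msq b.
Proof.
rewrite mulr_ge0 ?invr_ge0 ?ler0n// sumr_ge0// => i _; rewrite sumr_ge0// => q _.
by rewrite mulr_ge0 ?ler0n ?sqr_ge0.
Qed.

Lemma lstat_swp b i j Z : lstat b (swp i j Z) = lstat b Z - swdiff b i j Z.
Proof.
rewrite /lstat /swdiff; have [->|ij] := eqVneq i j.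
  rewrite (eq_bigr (fun k => b k (Z k))); first ring.
  by move=> k _; rewrite ffunE tperm1 perm1.
rewrite (bigD1 i)//= (bigD1 j) 1?eq_sym//= [in RHS](bigD1 i)//= [in RHS](bigD1 j) 1?eq_sym//=.
rewrite !ffunE tpermL tpermR.
rewrite (eq_bigr (fun k => b k (Z k))); first ring.
by move=> k /andP[ki kj]; rewrite ffunE tpermD// eq_sym.
Qed.

Lemma swdiff_swp b i j Z : swdiff b i j (swp i j Z) = - swdiff b i j Z.
Proof. by rewrite /swdiff !ffunE tpermL tpermR; ring. Qed.

Lemma sum_swdiff b Z : has_sizes Z ->
  \sum_i \sum_j swdiff b i j Z =
  2 * n%:R * lstat b Z - 2 * \sum_i \sum_q (nq q)%:R * b i q.
Proof.
move=> hZ; pose T := \sum_i \sum_j b i (Z j).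
have TE : T = \sum_i \sum_q (nq q)%:R * b i q.
  by apply: eq_bigr => i _; rewrite (sum_has_sizes (b i)).
rewrite -TE; transitivity (\sum_i \sum_(j : 'I_n) b i (Z i) + \sum_(i : 'I_n) \sum_j b j (Z j)
   - T - \sum_i \sum_j b j (Z i)).
  rewrite /T -!sumrN -!big_split; apply: eq_bigr => i _ /=.
  by rewrite -!sumrN -!big_split; apply: eq_bigr => j _.
rewrite [X in _ - _ - X]exchange_big -/T /=.
rewrite [X in _ + X - _ - _]exchange_big /=.
rewrite (eq_bigr (fun i => n%:R * b i (Z i))); last first.
  by move=> i _; rewrite sumr_const card_ord mulr_natl.
by rewrite -mulr_sumr -/(lstat b Z); ring.
Qed.

(* Exchangeability of the pair formed by an assignment and its random
   transposition replaces the usual Stein equation. *)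
Lemma avg_lstat_exchange b (f : R -> R) :
  \sum_i \sum_q (nq q)%:R * b i q = 0 ->
  4 * n%:R * avg (fun Z => lstat b Z * f (lstat b Z)) =
  \sum_i \sum_j avg (fun Z =>
    swdiff b i j Z * (f (lstat b Z) - f (lstat b Z - swdiff b i j Z))).
Proof.
move=> b0.
have H i j : avg (fun Z =>
    swdiff b i j Z * (f (lstat b Z) - f (lstat b Z - swdiff b i j Z))) =
    2 * avg (fun Z => swdiff b i j Z * f (lstat b Z)).
  rewrite (_ : 2 * _ = avg (fun Z => swdiff b i j Z * f (lstat b Z)) +
     avg (fun Z => swdiff b i j Z * f (lstat b Z))); last by ring.
  rewrite -[X in _ + X](avg_swp i j) -avgD; apply: eq_avg => Z _.
  by rewrite swdiff_swp lstat_swp; ring.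
under [RHS]eq_bigr do under eq_bigr do rewrite H.
under [RHS]eq_bigr do rewrite -mulr_sumr -avg_sum.
rewrite -mulr_sumr -avg_sum -!avgZ; apply: eq_avg => Z hZ.
under [in RHS]eq_bigr do rewrite -mulr_suml.
by rewrite -mulr_suml sum_swdiff// b0; ring.
Qed.

Lemma sum_avg_swdiff_sqr b :
  \sum_i \sum_j avg (fun Z => swdiff b i j Z ^+ 2) <= 16 * n%:R * msq b.
Proof.
pose D i j Z := b i (Z i) ^+ 2 + b j (Z j) ^+ 2 + b i (Z j) ^+ 2 + b j (Z i) ^+ 2.
pose B := \sum_i \sum_q (nq q)%:R * b i q ^+ 2.
have BE : B = n%:R * msq b by rewrite /msq mulrA mulfV ?mul1r.
apply: (@le_trans _ _ (\sum_i \sum_j avg (fun Z => 4 * D i j Z))).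
  apply: ler_sum => i _; apply: ler_sum => j _; apply: ler_avg => Z _.
  rewrite /swdiff /D.
  move: (b i (Z i)) (b j (Z j)) (b i (Z j)) (b j (Z i)) => x y z t.
  rewrite -subr_ge0 (_ : _ - _ = (x - y) ^+ 2 + (x + z) ^+ 2 + (x + t) ^+ 2
    + (y + z) ^+ 2 + (y + t) ^+ 2 + (z - t) ^+ 2); last by ring.
  by rewrite !addr_ge0 ?sqr_ge0.
under eq_bigr do rewrite -avg_sum.
rewrite -avg_sum.
rewrite (@eq_avg _ (fun Z => 8 * n%:R * lstat (fun i q => b i q ^+ 2) Z + 8 * B)).
  by rewrite avgD avgZ avg_cst avg_sqr_lstat BE -subr_ge0 le_eqVlt; apply/orP; left; apply/eqP; ring.
move=> Z hZ.
have HB : \sum_i \sum_j b i (Z j) ^+ 2 = B.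
  by apply: eq_bigr => i _; rewrite (sum_has_sizes (fun q => b i q ^+ 2)).
transitivity (4 * (\sum_i \sum_(j : 'I_n) b i (Z i) ^+ 2 + \sum_(i : 'I_n) \sum_j b j (Z j) ^+ 2
   + B + \sum_i \sum_j b j (Z i) ^+ 2)).
  rewrite -HB -!big_split mulr_sumr; apply: eq_bigr => i _ /=.
  by rewrite -!big_split mulr_sumr; apply: eq_bigr => j _.
rewrite [X in _ + _ + _ + X]exchange_big [X in _ + X + _ + _]exchange_big /= HB.
rewrite (eq_bigr (fun i => n%:R * b i (Z i) ^+ 2)); last first.
  by move=> i _; rewrite sumr_const card_ord mulr_natl.
by rewrite -mulr_sumr -/(lstat (fun i q => b i q ^+ 2) Z); ring.
Qed.

Lemma avg_lstat_sqr0 b : \sum_i \sum_q (nq q)%:R * b i q = 0 ->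
  4 * n%:R * avg (fun Z => lstat b Z ^+ 2) =
  \sum_i \sum_j avg (fun Z => swdiff b i j Z ^+ 2).
Proof.
move=> /(avg_lstat_exchange id) /=.
rewrite (_ : avg (fun Z => lstat b Z * _) = avg (fun Z => lstat b Z ^+ 2)) // => ->.
by apply: eq_bigr => i _; apply: eq_bigr => j _; apply: eq_avg => Z _; ring.
Qed.

Lemma avg_lstat_sqr_le0 b : \sum_i \sum_q (nq q)%:R * b i q = 0 ->
  avg (fun Z => lstat b Z ^+ 2) <= 4 * msq b.
Proof.
move=> b0; rewrite -(@ler_pM2l _ (4 * n%:R)) ?mulr_gt0// avg_lstat_sqr0//.
by rewrite (le_trans (sum_avg_swdiff_sqr b))// -subr_ge0 le_eqVlt; apply/orP; left; apply/eqP; ring.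
Qed.

Lemma avg_lstat_var b : avg (fun Z => (lstat b Z - avg (lstat b)) ^+ 2) <= 4 * msq b.
Proof.
pose c := n%:R^-1 * avg (lstat b); pose b' i q := b i q - c.
have bE Z : has_sizes Z -> lstat b' Z = lstat b Z - avg (lstat b).
  move=> hZ; rewrite /lstat big_split/= sumr_const card_ord -mulr_natl /c.
  by rewrite mulrN mulrA mulfV ?mul1r.
have ab' : avg (lstat b') = 0.
  by rewrite (eq_avg bE) avgB avg_cst subrr.
have b'0 : \sum_i \sum_q (nq q)%:R * b' i q = 0.
  by move: ab'; rewrite avg_lstat => /eqP; rewrite mulf_eq0 invr_eq0 (negbTE nR_neq0) => /eqP.
rewrite (@eq_avg _ (fun Z => lstat b' Z ^+ 2)) => [|Z hZ]; last by rewrite bE.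
rewrite (le_trans (avg_lstat_sqr_le0 b'0))// ler_pM2l//.
rewrite -!avg_sqr_lstat.
have -> : avg (lstat (fun i q => b' i q ^+ 2)) =
          avg (fun Z => lstat (fun i q => b i q ^+ 2) Z - 2 * c * lstat b Z + n%:R * c ^+ 2).
  apply: eq_avg => Z _; rewrite /lstat mulr_sumr -sumrN -big_split/=.
  rewrite (_ : n%:R * c ^+ 2 = \sum_(i < n) c ^+ 2); last first.
    by rewrite sumr_const card_ord mulr_natl.
  rewrite -big_split/=.
  by apply: eq_bigr => i _; rewrite /b'; ring.
rewrite avgD avgB avgZ avg_cst.
have -> : avg (lstat b) = n%:R * c by rewrite /c mulrA mulfV ?mul1r.
rewrite -subr_ge0 (_ : _ - _ = n%:R * c ^+ 2); last by ring.
by rewrite mulr_ge0 ?sqr_ge0 ?ltW.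
Qed.

Section DoublyCentred.
Variables (a : 'I_n -> Q -> R) (dlt : R).
Hypothesis row0 : forall i, \sum_q (nq q)%:R * a i q = 0.
Hypothesis col0 : forall q, \sum_i a i q = 0.
Hypothesis dlt_gt0 : 0 < dlt.
Hypothesis a_le : forall i q, `|a i q| <= dlt.

Let sum0 : \sum_i \sum_q (nq q)%:R * a i q = 0.
Proof. by rewrite big1. Qed.

Let T q r Z : R := \sum_(i | Z i == q) a i r.

Let sumnq : \sum_q (nq q)%:R = n%:R :> R.
Proof.
have [Z hZ] := ex_sizes; have := sum_has_sizes (fun=> 1) hZ.
rewrite sumr_const card_ord => ->.
by apply: eq_bigr => q _; rewrite mulr1.
Qed.

Let asqr_le i q : a i q ^+ 2 <= dlt ^+ 2.
Proof. by rewrite -[a i q ^+ 2]real_normK ?num_real// ler_sqr ?nnegrE// ltW. Qed.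

Let T_lstat q r Z : T q r Z = lstat (fun i p => if p == q then a i r else 0) Z.
Proof. by rewrite /T big_mkcond. Qed.

Let avg_T_sqr : \sum_q \sum_r avg (fun Z => T q r Z ^+ 2) <=
  4 * (n%:R * #|Q|%:R * dlt ^+ 2).
Proof.
apply: (@le_trans _ _ (\sum_q \sum_r 4 * (n%:R^-1 * \sum_i (nq q)%:R * a i r ^+ 2))).
  apply: ler_sum => q _; apply: ler_sum => r _.
  have E (f : 'I_n -> R) : \sum_i \sum_p (nq p)%:R * (if p == q then f i else 0) =
      (nq q)%:R * \sum_i f i.
    rewrite mulr_sumr; apply: eq_bigr => i _; rewrite (bigD1 q)//= eqxx big1 ?addr0//.
    by move=> p /negbTE ->; rewrite mulr0.
  under eq_avg do rewrite T_lstat.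
  apply: (le_trans (avg_lstat_sqr_le0 _)); first by rewrite E col0 mulr0.
  rewrite /msq (_ : \sum_i \sum_p _ = \sum_i \sum_p (nq p)%:R * (if p == q then a i r ^+ 2 else 0)).
    by rewrite E mulr_sumr.
  apply: eq_bigr => i _; apply: eq_bigr => p _.
  by case: ifP => _ //; rewrite expr0n.
under eq_bigr do rewrite -mulr_sumr -mulr_sumr.
rewrite -mulr_sumr -mulr_sumr ler_pM2l//.
under eq_bigr do under eq_bigr do rewrite -mulr_sumr.
under eq_bigr do rewrite -mulr_sumr.
rewrite -mulr_suml sumnq mulrA mulVf// mul1r exchange_big/=.
rewrite -mulrA mulr_natl -[X in _ *+ X](card_ord n) -sumr_const; apply: ler_sum => i _.
rewrite mulr_natl -sumr_const; exact: ler_sum.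
Qed.

Let msq_le : msq a <= n%:R * dlt ^+ 2.
Proof.
rewrite (_ : n%:R * _ = n%:R^-1 * \sum_(i < n) n%:R * dlt ^+ 2); last first.
  by rewrite sumr_const card_ord -[X in _ = _ * X]mulr_natl mulKf.
rewrite ler_pM2l ?invr_gt0//; apply: ler_sum => i _.
rewrite -sumnq mulr_suml; apply: ler_sum => q _.
by rewrite ler_wpM2l ?ler0n.
Qed.

Let V Z : R := (4 * n%:R)^-1 * \sum_i \sum_j swdiff a i j Z ^+ 2.

Let VE Z : has_sizes Z -> V Z = 2^-1 * lstat (fun i q => a i q ^+ 2) Z
  + 2^-1 * msq a + (2 * n%:R)^-1 * (lstat a Z ^+ 2 + \sum_q \sum_r T q r Z * T r q Z).
Proof.
move=> hZ; rewrite /V.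
pose U := \sum_i \sum_q (nq q)%:R * a i q ^+ 2.
have UE : U = n%:R * msq a by rewrite /msq mulrA mulfV ?mul1r.
have X1 : \sum_i \sum_j a i (Z j) ^+ 2 = U.
  by apply: eq_bigr => i _; rewrite (sum_has_sizes (fun q => a i q ^+ 2)).
have X2 : \sum_i \sum_(j : 'I_n) a i (Z i) ^+ 2 = n%:R * lstat (fun i q => a i q ^+ 2) Z.
  by rewrite mulr_sumr; apply: eq_bigr => i _; rewrite sumr_const card_ord mulr_natl.
have X3 : \sum_i \sum_j a i (Z i) * a j (Z j) = lstat a Z ^+ 2.
  by rewrite expr2 mulr_suml; apply: eq_bigr => i _; rewrite mulr_sumr.
have X4 : \sum_i \sum_j a i (Z i) * a i (Z j) = 0.
  apply: big1 => i _; rewrite -mulr_sumr (sum_has_sizes (a i))// row0 mulr0//.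
have X5 : \sum_i \sum_j a i (Z i) * a j (Z i) = 0.
  by apply: big1 => i _; rewrite -mulr_sumr col0 mulr0.
have X6 : \sum_i \sum_j a i (Z j) * a j (Z i) = \sum_q \sum_r T q r Z * T r q Z.
  rewrite (partition_big Z predT)//=; apply: eq_bigr => q _.
  transitivity (\sum_(i | Z i == q) \sum_r \sum_(j | Z j == r) a i r * a j q).
    apply: eq_bigr => i /eqP Zi; rewrite (partition_big Z predT)//=.
    by apply: eq_bigr => r _; apply: eq_bigr => j /eqP ->; rewrite Zi.
  rewrite exchange_big/=; apply: eq_bigr => r _; rewrite /T mulr_suml.
  by apply: eq_bigr => i _; rewrite mulr_sumr.
have -> : \sum_i \sum_j swdiff a i j Z ^+ 2 =
   \sum_i \sum_(j : 'I_n) a i (Z i) ^+ 2 + \sum_(i : 'I_n) \sum_j a j (Z j) ^+ 2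
   + \sum_i \sum_j a i (Z j) ^+ 2 + \sum_i \sum_j a j (Z i) ^+ 2
   + 2 * (\sum_i \sum_j a i (Z i) * a j (Z j))
   - 2 * (\sum_i \sum_j a i (Z i) * a i (Z j))
   - 2 * (\sum_i \sum_j a i (Z i) * a j (Z i))
   - 2 * (\sum_i \sum_j a j (Z j) * a i (Z j))
   - 2 * (\sum_i \sum_j a j (Z j) * a j (Z i))
   + 2 * (\sum_i \sum_j a i (Z j) * a j (Z i)).
  rewrite !mulr_sumr -!sumrN -!big_split; apply: eq_bigr => i _ /=.
  rewrite !mulr_sumr -!sumrN -!big_split; apply: eq_bigr => j _ /=.
  by rewrite /swdiff; ring.
have X1' : \sum_i \sum_j a j (Z i) ^+ 2 = U by rewrite exchange_big.
have X2' : \sum_(i : 'I_n) \sum_j a j (Z j) ^+ 2 = n%:R * lstat (fun i q => a i q ^+ 2) Z.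
  by rewrite exchange_big.
have X4' : \sum_i \sum_j a j (Z j) * a j (Z i) = 0 by rewrite exchange_big.
have X5' : \sum_i \sum_j a j (Z j) * a i (Z j) = 0 by rewrite exchange_big.
by rewrite X1 X2 X3 X4 X5 X6 X1' X2' X4' X5' UE; field.
Qed.

Let avg_V_dist : avg (fun Z => `|V Z - msq a|) <=
  dlt * msq a + dlt / 4 + 2 * dlt ^+ 2 + 2 * #|Q|%:R * dlt ^+ 2.
Proof.
pose a2 i q := a i q ^+ 2.
apply: (@le_trans _ _ (avg (fun Z => 4^-1 * (dlt^-1 * (lstat a2 Z - msq a) ^+ 2 + dlt)
   + (2 * n%:R)^-1 * (lstat a Z ^+ 2 + \sum_q \sum_r T q r Z ^+ 2)))).
  apply: ler_avg => Z hZ; rewrite VE//.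
  set X := lstat _ Z - _; set W := \sum_q \sum_r _; set W2 := \sum_q \sum_r _.
  rewrite (_ : _ - _ = 2^-1 * X + (2 * n%:R)^-1 * (lstat a Z ^+ 2 + W)); last by rewrite /X /a2; field.
  rewrite (le_trans (ler_normD _ _))// lerD//.
    rewrite normrM ger0_norm ?invr_ge0// -(@ler_pM2l _ (4 * dlt)) ?mulr_gt0//.
    rewrite [leRHS](_ : _ = X ^+ 2 + dlt ^+ 2); last by field; rewrite lt0r_neq0.
    rewrite [leLHS](_ : _ = 2 * (dlt * `|X|)); last by field.
    rewrite -[X ^+ 2]real_normK ?num_real//.
    by have := sqr_ge0 (`|X| - dlt); nra.
  rewrite normrM ger0_norm ?invr_ge0 ?mulr_ge0 ?ler0n// ler_wpM2l ?invr_ge0 ?mulr_ge0 ?ler0n//.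
  rewrite (le_trans (ler_normD _ _))// ger0_norm ?sqr_ge0// lerD2l.
  apply: (@le_trans _ _ (\sum_q \sum_r 2^-1 * (T q r Z ^+ 2 + T r q Z ^+ 2))).
    rewrite (le_trans (ler_norm_sum _ _ _))//; apply: ler_sum => q _.
    rewrite (le_trans (ler_norm_sum _ _ _))//; apply: ler_sum => r _.
    move: (T q r Z) (T r q Z) => x y; rewrite ler_norml.
    have := sqr_ge0 (x - y); have := sqr_ge0 (x + y); rewrite !expr2.
    by move=> ? ?; apply/andP; split; nra.
  under eq_bigr do rewrite -mulr_sumr big_split.
  rewrite -mulr_sumr big_split/= [X in _ * (_ + X)]exchange_big/= -/W2.
  by rewrite le_eqVlt; apply/orP; left; apply/eqP; field.
rewrite avgD !avgZ !avgD avgZ avg_cst.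
have h1 : avg (fun Z => (lstat a2 Z - msq a) ^+ 2) <= 4 * (dlt ^+ 2 * msq a).
  rewrite -avg_sqr_lstat (le_trans (avg_lstat_var _))// avg_sqr_lstat ler_pM2l//.
  rewrite /msq mulrCA ler_pM2l ?invr_gt0// mulr_sumr; apply: ler_sum => i _.
  rewrite mulr_sumr; apply: ler_sum => q _.
  by rewrite [leRHS]mulrCA ler_wpM2l ?ler0n// /a2 [leLHS]expr2 ler_wpM2r ?sqr_ge0.
have h2 : avg (fun Z => lstat a Z ^+ 2) <= 4 * (n%:R * dlt ^+ 2).
  by rewrite (le_trans (avg_lstat_sqr_le0 sum0))// ler_pM2l.
have h3 : avg (fun Z => \sum_q \sum_r T q r Z ^+ 2) <= 4 * (n%:R * #|Q|%:R * dlt ^+ 2).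
  rewrite avg_sum; apply: le_trans avg_T_sqr.
  by apply: ler_sum => q _; rewrite avg_sum.
rewrite -addrA lerD//.
  apply: (@le_trans _ _ (4^-1 * (dlt^-1 * (4 * (dlt ^+ 2 * msq a)) + dlt))).
    by rewrite ler_pM2l ?invr_gt0// lerD2r ler_pM2l ?invr_gt0.
  by rewrite le_eqVlt; apply/orP; left; apply/eqP; field; rewrite lt0r_neq0.
apply: (@le_trans _ _ ((2 * n%:R)^-1 * (4 * (n%:R * dlt ^+ 2) + 4 * (n%:R * #|Q|%:R * dlt ^+ 2)))).
  by rewrite ler_pM2l ?invr_gt0 ?mulr_gt0// lerD.
by rewrite le_eqVlt; apply/orP; left; apply/eqP; field.
Qed.

Definition stein_err (s d : R) : R :=
  17 * d * s + d / 4 + 2 * d ^+ 2 + 2 * #|Q|%:R * d ^+ 2.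

Lemma stein_bound (f f' : R -> R) : (forall x, `|f' x| <= 1) ->
  (forall x d, `|f x - f (x - d) - f' x * d| <= d ^+ 2) ->
  `|avg (fun Z => lstat a Z * f (lstat a Z)) - msq a * avg (fun Z => f' (lstat a Z))|
  <= stein_err (msq a) dlt.
Proof.
move=> f'1 ftaylor; pose S := lstat a.
have E1 : avg (fun Z => S Z * f (S Z)) - avg (fun Z => f' (S Z) * V Z) =
   avg (fun Z => (4 * n%:R)^-1 * \sum_i \sum_j swdiff a i j Z *
     (f (S Z) - f (S Z - swdiff a i j Z) - f' (S Z) * swdiff a i j Z)).
  have -> : avg (fun Z => S Z * f (S Z)) = (4 * n%:R)^-1 *
      (4 * n%:R * avg (fun Z => S Z * f (S Z))) by field.
  rewrite (avg_lstat_exchange f sum0); under eq_bigr do rewrite -avg_sum.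
  rewrite -avg_sum -avgZ -avgB; apply: eq_avg => Z _.
  rewrite /V mulrCA -mulrBr; congr (_ * _); rewrite mulr_sumr -sumrB; apply: eq_bigr => i _.
  by rewrite mulr_sumr -sumrB; apply: eq_bigr => j _; rewrite /S; ring.
have D1 i j Z : `|swdiff a i j Z| <= 4 * dlt.
  rewrite /swdiff; rewrite (le_trans (ler_normB _ _))// (_ : 4 * dlt = dlt + dlt + dlt + dlt); last by ring.
  by rewrite lerD// (le_trans (ler_normB _ _))// lerD// (le_trans (ler_normD _ _))// lerD.
have B1 : `|avg (fun Z => S Z * f (S Z)) - avg (fun Z => f' (S Z) * V Z)| <=
    16 * dlt * msq a.
  rewrite E1 (le_trans (ler_norm_avg _))//.
  apply: (@le_trans _ _ (avg (fun Z => (4 * n%:R)^-1 * (4 * dlt * \sum_i \sum_j swdiff a i j Z ^+ 2)))).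
    apply: ler_avg => Z _.
    rewrite normrM ger0_norm ?invr_ge0 ?mulr_ge0 ?ler0n// ler_wpM2l ?invr_ge0 ?mulr_ge0 ?ler0n//.
    rewrite mulr_sumr (le_trans (ler_norm_sum _ _ _))//; apply: ler_sum => i _.
    rewrite mulr_sumr (le_trans (ler_norm_sum _ _ _))//; apply: ler_sum => j _.
    by rewrite normrM ler_pM.
  rewrite !avgZ avg_sum; under eq_bigr do rewrite avg_sum.
  rewrite -avg_lstat_sqr0//.
  rewrite [leLHS](_ : _ = 4 * dlt * avg (fun Z => S Z ^+ 2)); last by rewrite /S; field.
  rewrite [leRHS](_ : _ = 4 * dlt * (4 * msq a)); last by ring.
  by rewrite ler_pM2l ?mulr_gt0//; exact: avg_lstat_sqr_le0.
have B2 : `|avg (fun Z => f' (S Z) * V Z) - msq a * avg (fun Z => f' (S Z))| <=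
    dlt * msq a + dlt / 4 + 2 * dlt ^+ 2 + 2 * #|Q|%:R * dlt ^+ 2.
  rewrite -avgZ -avgB (le_trans (ler_norm_avg _))// (le_trans _ avg_V_dist)//.
  apply: ler_avg => Z _; rewrite [X in `|X|](_ : _ = f' (S Z) * (V Z - msq a)); last by ring.
  by rewrite normrM ler_piMl.
rewrite (_ : _ - _ = (avg (fun Z => S Z * f (S Z)) - avg (fun Z => f' (S Z) * V Z)) +
  (avg (fun Z => f' (S Z) * V Z) - msq a * avg (fun Z => f' (S Z)))); last by rewrite /S; ring.
rewrite (le_trans (ler_normD _ _))// (le_trans (lerD B1 B2))//.
by rewrite /stein_err le_eqVlt; apply/orP; left; apply/eqP; ring.
Qed.

End DoublyCentred.
End CombinatorialCLT.

Section MeanValue.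
Context {R : realType}.
Implicit Types f g : R -> R.

Lemma mvt_global f g : (forall x : R, is_derive x 1 f (g x)) ->
  forall x y, exists z, `|z - x| <= `|y - x| /\ f y - f x = g z * (y - x).
Proof.
move=> fg.
have cf : continuous f.
  by move=> x; apply: differentiable_continuous; apply/derivable1_diffP; have [] := fg x.
suff H x y : x < y -> exists z, [/\ x <= z, z <= y & f y - f x = g z * (y - x)].
  move=> x y; have [xy|yx|->] := ltgtP x y.
  - have [z [xz zy ->]] := H _ _ xy; exists z; split => //.
    by rewrite !ger0_norm ?subr_ge0 ?lerD2r// ltW.
  - have [z [yz zx e]] := H _ _ yx; exists z; split.
      by rewrite distrC (distrC y) !ger0_norm ?subr_ge0 ?lerD2l ?lerN2// ltW.
    by rewrite -opprB e; ring.
  - by exists y; rewrite !subrr mulr0.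
move=> xy; have [z /andP[xz zy] e] := @MVT R f g x y xy (fun z _ => fg z)
  (continuous_subspaceT cf).
by exists z; split=> //; move: xz zy; rewrite !bnd_simp => /ltW ? /ltW.
Qed.

Lemma cos_lip (x y : R) : `|cos x - cos y| <= `|x - y|.
Proof.
have [z [_ ->]] := mvt_global (@is_derive_cos R) y x.
by rewrite normrM ler_piMl// normrN ler_norml sin_geN1 sin_le1.
Qed.

Lemma sin_taylor (x d : R) : `|sin x - sin (x - d) - cos x * d| <= d ^+ 2.
Proof.
have [z [zx e]] := mvt_global (@is_derive_sin R) x (x - d).
have -> : sin x - sin (x - d) - cos x * d = (cos z - cos x) * d.
  by rewrite -[sin x - _]opprB e; ring.
rewrite normrM -[d ^+ 2]real_normK ?num_real// expr2 ler_wpM2r//.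
rewrite (le_trans (cos_lip _ _))// (le_trans zx)//.
by rewrite addrC addKr normrN.
Qed.

Lemma is_derive_bigsum (I : Type) (r : seq I) (P : pred I) (F : I -> R -> R)
    (dF : I -> R) (x : R) :
  (forall i, P i -> is_derive x 1 (F i) (dF i)) ->
  is_derive x 1 (fun y => \sum_(i <- r | P i) F i y) (\sum_(i <- r | P i) dF i).
Proof.
move=> FdF; elim: r => [|i r IH].
  under [X in is_derive _ _ X]eq_fun do rewrite big_nil.
  by rewrite big_nil; exact: is_derive_cst.
under [X in is_derive _ _ X]eq_fun do rewrite big_cons.
rewrite big_cons; case: ifP => // Pi.
by apply: is_deriveD; exact: FdF.
Qed.

Lemma is_derive_affine (k c x : R) : is_derive x 1 (fun y : R => y * k + c) k.
Proof.
apply: is_derive_eq; rewrite /GRing.scale/=; ring.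
Qed.

End MeanValue.

Section CharacteristicFunction.
Context {R : realType}.
Variables (n : nat) (Q : finType) (nq : Q -> nat) (a : 'I_n -> Q -> R) (dlt c : R).
Hypothesis n_gt0 : (0 < n)%N.
Hypothesis ex_sizes : exists Z : {ffun 'I_n -> Q}, has_sizes nq Z.
Hypothesis row0 : forall i, \sum_q (nq q)%:R * a i q = 0.
Hypothesis col0 : forall q, \sum_i a i q = 0.
Hypothesis dlt_gt0 : 0 < dlt.
Hypothesis a_le : forall i q, `|a i q| <= dlt.

Let phi (s : R) : R := avg nq (fun Z => cos (s * lstat a Z + c)).
Let dphi (s : R) : R := - avg nq (fun Z => lstat a Z * sin (s * lstat a Z + c)).

Let is_derive_phi (s : R) : is_derive s 1 phi (dphi s).
Proof.
rewrite /dphi /phi /avg -mulrN -sumrN.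
have H : is_derive s 1 (fun s : R => \sum_(Z | has_sizes nq Z) cos (s * lstat a Z + c))
    (\sum_(Z | has_sizes nq Z) - (lstat a Z * sin (s * lstat a Z + c))).
  apply: is_derive_bigsum => Z _.
  have := is_derive1_comp (is_derive_cos _) (is_derive_affine (lstat a Z) c s).
  by rewrite mulNr mulrC.
exact: (is_deriveZ (#|has_sizes nq|%:R^-1) H).
Qed.

Lemma cos_clt_bound :
  `|avg nq (fun Z => cos (lstat a Z + c)) - cos c * expR (- (msq nq a / 2))|
  <= expR (msq nq a / 2) * stein_err Q (msq nq a) dlt.
Proof.
set v := msq nq a.
have v_ge0 : 0 <= v by exact: msq_ge0.
pose G s : R := phi s * expR (v / 2 * s ^+ 2).
pose g s : R := (dphi s + v * s * phi s) * expR (v / 2 * s ^+ 2).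
have Gg (s : R) : is_derive s 1 G (g s).
  have H : is_derive s 1 (fun s => expR (v / 2 * s ^+ 2)) (v * s * expR (v / 2 * s ^+ 2)).
    by apply: is_derive_eq; rewrite /GRing.scale/=; field.
  apply: is_derive_eq; first exact: (is_deriveM (is_derive_phi s) H).
  by rewrite /g /GRing.scale/=; ring.
have [z [z1 GE]] := mvt_global Gg 0 1.
rewrite !subr0 normr1 in z1.
have err : `|dphi z + v * z * phi z| <= stein_err Q v dlt.
  have := @stein_bound R n Q nq n_gt0 ex_sizes a dlt row0 col0 dlt_gt0 a_le
    (fun x => sin (z * x + c)) (fun x => z * cos (z * x + c)).
  rewrite avgZ -normrN opprB -/v (_ : _ - _ = dphi z + v * z * phi z); last by rewrite /dphi /phi; ring.
  apply.
    by move=> x; rewrite normrM mulr_ile1// ler_norml cos_geN1 cos_le1.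
  move=> x d; have := sin_taylor (z * x + c) (z * d).
  rewrite (_ : z * x + c - z * d = z * (x - d) + c); last by ring.
  rewrite (_ : cos _ * (z * d) = z * cos (z * x + c) * d); last by ring.
  move=> /le_trans; apply; rewrite exprMn ler_piMl ?sqr_ge0//.
  by rewrite -[z ^+ 2]real_normK ?num_real// exprn_ile1.
have phi0 : phi 0 = cos c.
  by rewrite /phi; under eq_avg do rewrite mul0r add0r; exact: avg_cst.
have phi1 : phi 1 = avg nq (fun Z => cos (lstat a Z + c)).
  by rewrite /phi; under eq_avg do rewrite mul1r.
rewrite -phi1.
have -> : phi 1 - cos c * expR (- (v / 2)) = expR (- (v / 2)) * (G 1 - G 0).
  rewrite /G phi0 expr1n expr0n/= mulr0 expR0 !mulr1 mulrBr mulrCA -expRD.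
  by rewrite addNr expR0 mulr1 [cos c * _]mulrC.
rewrite GE subr0 mulr1 normrM (ger0_norm (expR_ge0 _)) /g normrM (ger0_norm (expR_ge0 _)).
rewrite mulrCA mulrC -expRD ler_pM ?expR_ge0// ler_expR.
have : z ^+ 2 <= 1 by rewrite -[z ^+ 2]real_normK ?num_real// exprn_ile1.
by nra.
Qed.

End CharacteristicFunction.

(** * Weak convergence from trigonometric polynomials *)

Section BernoulliWeights.
Context {R : realType} (m N : nat) (p : 'I_m -> R).
Hypothesis p01 : forall j, 0 <= p j <= 1.
Local Notation U := ('I_m * 'I_N)%type.
Local Notation Omega := {ffun U -> bool}.

Definition bern_weight (w : Omega) : R := \prod_u (if w u then p u.1 else 1 - p u.1).
Definition bern_mean (w : Omega) (j : 'I_m) : R := N%:R^-1 * \sum_(i < N) (w (j, i))%:R.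

Lemma sum_bern_prod (g : U -> bool -> R) :
  \sum_(w : Omega) bern_weight w * \prod_u g u (w u) =
  \prod_u (p u.1 * g u true + (1 - p u.1) * g u false).
Proof.
transitivity (\sum_(w : Omega) \prod_u ((if w u then p u.1 else 1 - p u.1) * g u (w u))).
  by apply: eq_bigr => w _; rewrite big_split.
rewrite -(bigA_distr_bigA (fun u (b : bool) => (if b then p u.1 else 1 - p u.1) * g u b)).
by apply: eq_bigr => u _; rewrite big_bool.
Qed.

Lemma bern_weight_ge0 w : 0 <= bern_weight w.
Proof.
apply: prodr_ge0 => u _; have /andP[? ?] := p01 u.1.
by case: ifP; rewrite ?subr_ge0.
Qed.

Lemma sum_bern_weight : \sum_(w : Omega) bern_weight w = 1.
Proof.
have := sum_bern_prod (fun _ _ => 1).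
rewrite (eq_bigr bern_weight) => [->|w _]; last by rewrite big1 ?mulr1.
by rewrite big1// => u _; rewrite !mulr1 addrC subrK.
Qed.

Lemma bern_cov (u v : U) :
  \sum_(w : Omega) bern_weight w * (((w u)%:R - p u.1) * ((w v)%:R - p v.1)) =
  if u == v then p u.1 * (1 - p u.1) else 0.
Proof.
pose g (x : U) (b : bool) : R :=
  (if x == u then b%:R - p u.1 else 1) * (if x == v then b%:R - p v.1 else 1).
transitivity (\sum_(w : Omega) bern_weight w * \prod_x g x (w x)).
  apply: eq_bigr => w _; congr (_ * _).
  rewrite big_split/= (bigD1 u)//= eqxx big1 => [|x /negbTE->//].
  rewrite (bigD1 v)//= eqxx big1 => [|x /negbTE->//].
  by rewrite !mulr1.
rewrite sum_bern_prod (bigD1 u)//= /g eqxx; case: ifP => [/eqP<-|uv].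
  rewrite big1 ?mulr1 => [|x /negbTE->]; first by rewrite /=; ring.
  by rewrite !mulr1; ring.
rewrite !mulr1 (_ : p u.1 * _ + _ = 0) ?mul0r//.
by rewrite mulr1n mulr0n; ring.
Qed.

Lemma bern_var j : (0 < N)%N ->
  \sum_(w : Omega) bern_weight w * (bern_mean w j - p j) ^+ 2 <= N%:R^-1.
Proof.
move=> N0; have NR : N%:R != 0 :> R by rewrite pnatr_eq0 -lt0n.
have E w : (bern_mean w j - p j) ^+ 2 =
    N%:R^-1 ^+ 2 * \sum_(i < N) \sum_(l < N) ((w (j, i))%:R - p j) * ((w (j, l))%:R - p j).
  have -> : bern_mean w j - p j = N%:R^-1 * \sum_(i < N) ((w (j, i))%:R - p j).
    rewrite /bern_mean big_split/= sumr_const card_ord mulrDr.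
    by rewrite -[- p j *+ N]mulr_natl mulKf.
  rewrite exprMn; congr (_ * _); rewrite expr2 mulr_suml.
  by apply: eq_bigr => i _; rewrite mulr_sumr.
under eq_bigr do rewrite E mulrCA.
rewrite -mulr_sumr.
under eq_bigr do rewrite mulr_sumr.
under eq_bigr do under eq_bigr do rewrite mulr_sumr.
rewrite exchange_big/=; under eq_bigr do rewrite exchange_big/=.
under eq_bigr => i _ do under eq_bigr => l _ do rewrite (bern_cov (j, i) (j, l))/=.
rewrite (eq_bigr (fun=> p j * (1 - p j))) => [|i _]; last first.
  rewrite (bigD1 i)//= eqxx big1 ?addr0// => l li.
  by rewrite xpair_eqE eqxx/= eq_sym (negbTE li).
rewrite sumr_const card_ord -[X in _ * X]mulr_natl expr2 -mulrA mulKf//.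
by rewrite ler_piMr ?invr_ge0 ?ler0n//; have /andP[] := p01 j; nra.
Qed.

End BernoulliWeights.

Section BoundedContinuous.
Context {R : realType} (m : nat).
Local Notation V := 'cV[R]_m.
Implicit Types f g : V -> R.

Definition bcont f := continuous f /\ exists M : R, forall v, `|f v| <= M.

Lemma bcont_cst (c : R) : bcont (fun=> c).
Proof. by split; [exact: continuous_cstf|exists `|c|]. Qed.

Lemma bcontD f g : bcont f -> bcont g -> bcont (fun v => f v + g v).
Proof.
move=> [cf [M fM]] [cg [M' gM']]; split.
  exact: continuous_addf.
by exists (M + M') => v; rewrite (le_trans (ler_normD _ _))// lerD.
Qed.

Lemma bcontM f g : bcont f -> bcont g -> bcont (fun v => f v * g v).
Proof.
move=> [cf [M fM]] [cg [M' gM']]; split.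
  exact: continuous_mulf.
by exists (M * M') => v; rewrite normrM ler_pM.
Qed.

Lemma bcontZ (c : R) f : bcont f -> bcont (fun v => c * f v).
Proof. by move=> cf; exact: (bcontM (bcont_cst c) cf). Qed.

Lemma bcontN f : bcont f -> bcont (fun v => - f v).
Proof.
move=> cf; rewrite (_ : (fun v => - f v) = (fun v => (-1) * f v)); first exact: bcontZ.
by apply/funext => v; rewrite mulN1r.
Qed.

Lemma bcont_sum (I : Type) (r : seq I) (P : pred I) (F : I -> V -> R) :
  (forall i, P i -> bcont (F i)) -> bcont (fun v => \sum_(i <- r | P i) F i v).
Proof.
move=> FP; elim: r => [|i r IH].
  by rewrite (_ : (fun v => _) = (fun=> 0)); [exact: bcont_cst|apply/funext => v; rewrite big_nil].
rewrite (_ : (fun v => _) = (fun v => (if P i then F i v else 0) + \sum_(j <- r | P j) F j v)).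
  by apply: bcontD => //; case Pi : (P i); [exact: FP|exact: bcont_cst].
by apply/funext => v; rewrite big_cons; case: ifP => //; rewrite add0r.
Qed.

Lemma bcont_prod (I : Type) (r : seq I) (P : pred I) (F : I -> V -> R) :
  (forall i, P i -> bcont (F i)) -> bcont (fun v => \prod_(i <- r | P i) F i v).
Proof.
move=> FP; elim: r => [|i r IH].
  by rewrite (_ : (fun v => _) = (fun=> 1)); [exact: bcont_cst|apply/funext => v; rewrite big_nil].
rewrite (_ : (fun v => _) = (fun v => (if P i then F i v else 1) * \prod_(j <- r | P j) F j v)).
  by apply: bcontM => //; case Pi : (P i); [exact: FP|exact: bcont_cst].
by apply/funext => v; rewrite big_cons; case: ifP => //; rewrite mul1r.
Qed.

Definition dotv (t x : V) : R := \sum_j t j 0 * x j 0.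

Lemma dotv_continuous t : continuous (dotv t).
Proof.
apply: continuous_bigsum => j _.
by apply: continuous_mulf; [exact: continuous_cstf|exact: continuous_coord].
Qed.

Definition cosdot (t : V) (c : R) (x : V) : R := cos (dotv t x + c).

Lemma bcont_cosdot t c : bcont (cosdot t c).
Proof.
split; last by exists 1 => v; rewrite ler_norml cos_geN1 cos_le1.
apply: (continuous_compf (f := fun x => dotv t x + c)); last exact: continuous_cos.
by apply: continuous_addf; [exact: dotv_continuous|exact: continuous_cstf].
Qed.

Inductive trigpoly : (V -> R) -> Prop :=
| trig_cos (a : R) t c : trigpoly (fun x => a * cosdot t c x)
| trig_add f g : trigpoly f -> trigpoly g -> trigpoly (fun x => f x + g x).

Lemma bcont_trigpoly f : trigpoly f -> bcont f.
Proof.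
by elim=> [a t c|f' g' _ ? _ ?]; [exact/bcontZ/bcont_cosdot|exact: bcontD].
Qed.

Lemma trigpoly_cst a : trigpoly (fun=> a).
Proof.
rewrite (_ : (fun=> a) = (fun x => a * cosdot 0 0 x)); first exact: trig_cos.
apply/funext => x; rewrite /cosdot /dotv big1 ?add0r ?cos0 ?mulr1// => j _.
by rewrite mxE mul0r.
Qed.

Lemma trigpolyZ a f : trigpoly f -> trigpoly (fun x => a * f x).
Proof.
elim=> [b t c|f1 f2 _ h1 _ h2].
  rewrite (_ : (fun x => _) = (fun x => (a * b) * cosdot t c x)); first exact: trig_cos.
  by apply/funext => x; rewrite mulrA.
rewrite (_ : (fun x => _) = (fun x => a * f1 x + a * f2 x)); first exact: trig_add.
by apply/funext => x; rewrite mulrDr.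
Qed.

Lemma cosM (x y : R) : cos x * cos y = 2^-1 * cos (x + y) + 2^-1 * cos (x - y).
Proof. by rewrite cosD cosB; field. Qed.

Lemma trigpolyM f g : trigpoly f -> trigpoly g -> trigpoly (fun x => f x * g x).
Proof.
move=> tf tg; elim: tf => [a t c|f1 f2 _ h1 _ h2]; last first.
  rewrite (_ : (fun x => _) = (fun x => f1 x * g x + f2 x * g x)); first exact: trig_add.
  by apply/funext => x; rewrite mulrDl.
elim: tg => [b s d|g1 g2 _ h1 _ h2]; last first.
  rewrite (_ : (fun x => _) = (fun x => a * cosdot t c x * g1 x + a * cosdot t c x * g2 x)).
    exact: trig_add.
  by apply/funext => x; rewrite mulrDr.
rewrite (_ : (fun x => _) = (fun x => (a * b / 2) * cosdot (t + s) (c + d) x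
   + (a * b / 2) * cosdot (t - s) (c - d) x)).
  by apply: trig_add; exact: trig_cos.
apply/funext => x; rewrite /cosdot.
have -> : dotv (t + s) x + (c + d) = (dotv t x + c) + (dotv s x + d).
  rewrite addrACA; congr (_ + _); rewrite /dotv -big_split; apply: eq_bigr => j _.
  by rewrite mxE mulrDl.
have -> : dotv (t - s) x + (c - d) = (dotv t x + c) - (dotv s x + d).
  rewrite opprD addrACA; congr (_ + _); rewrite /dotv -sumrN -big_split; apply: eq_bigr => j _.
  by rewrite !mxE mulrDl mulNr.
by rewrite mulrACA cosM; field.
Qed.

Lemma trigpoly_sum (I : Type) (r : seq I) (F : I -> V -> R) :
  (forall i, trigpoly (F i)) -> trigpoly (fun v => \sum_(i <- r) F i v).
Proof.
move=> FP; elim: r => [|i r IH].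
  by rewrite (_ : (fun v => _) = (fun=> 0)); [exact: trigpoly_cst|apply/funext => v; rewrite big_nil].
rewrite (_ : (fun v => _) = (fun v => F i v + \sum_(j <- r) F j v)); first exact: trig_add.
by apply/funext => v; rewrite big_cons.
Qed.

Lemma trigpoly_prod (I : Type) (r : seq I) (F : I -> V -> R) :
  (forall i, trigpoly (F i)) -> trigpoly (fun v => \prod_(i <- r) F i v).
Proof.
move=> FP; elim: r => [|i r IH].
  by rewrite (_ : (fun v => _) = (fun=> 1)); [exact: trigpoly_cst|apply/funext => v; rewrite big_nil].
rewrite (_ : (fun v => _) = (fun v => F i v * \prod_(j <- r) F j v)); first exact: trigpolyM.
by apply/funext => v; rewrite big_cons.
Qed.

Lemma trigpoly_sin (M : R) (j : 'I_m) : trigpoly (fun v => sin (v j 0 / M)).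
Proof.
rewrite (_ : (fun v => _) = (fun v => 1 * cosdot (M^-1 *: delta_mx j 0) (- (pi / 2)) v)).
  exact: trig_cos.
apply/funext => v; rewrite mul1r /cosdot.
have -> : dotv (M^-1 *: delta_mx j 0) v = v j 0 / M.
  rewrite /dotv (bigD1 j)//= big1 ?addr0 => [|i ij].
    by rewrite !mxE !eqxx mulr1 mulrC.
  by rewrite !mxE (negbTE ij) mulr0 mul0r.
by rewrite cosB cos_pihalf sin_pihalf mulr0 add0r mulr1.
Qed.

Lemma cube_compact (M : R) : compact [set v : V | forall j, `|v j 0| <= M].
Proof.
have H := @rV_compact R m (fun=> `[- M, M]%classic) (fun=> @segment_compact R (- M) M).
have tc : continuous (trmx : 'rV[R]_m -> V).
  apply: continuous_mxP => i j; under eq_fun do rewrite mxE.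
  exact: continuous_coord.
rewrite (_ : [set v : V | _] = trmx @` [set v : 'rV[R]_m | forall i, `[- M, M]%classic (v ord0 i)]).
  by apply: continuous_compact => //; exact: continuous_subspaceT.
apply/seteqP; split => v /=.
  move=> vM; exists v^T; last by rewrite trmxK.
  by move=> i; rewrite /= in_itv/= mxE -ler_norml.
by move=> [u uM <-] j; rewrite mxE ler_norml; have := uM j; rewrite /= in_itv.
Qed.

(* On a cube, [G] is a continuous function of the coordinates
   [(1 + sin (x_j / M)) / 2] in [0, 1], and its Bernstein polynomial in those
   coordinates is a trigonometric polynomial bounded by [sup |G|] everywhere. *)
Lemma trigpoly_approx (G : V -> R) (C M e : R) : continuous G ->
  (forall v, `|G v| <= C) -> 0 < M -> 0 < e ->
  exists2 T, trigpoly T & (forall v : V, `|T v| <= C) /\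
    (forall v : V, (forall j, `|v j 0| <= M) -> `|G v - T v| <= e).
Proof.
move=> cG GC M0 e0.
have C0 : 0 <= C by exact: le_trans (GC 0).
pose D := 2 * M.
have D0 : 0 < D by rewrite mulr_gt0.
pose pp (v : V) (j : 'I_m) : R := (1 + sin (v j 0 / D)) / 2.
pose back (r : 'I_m -> R) : V := \col_j (D * asin (2 * r j - 1)).
have pp01 v j : 0 <= pp v j <= 1.
  rewrite /pp; have := sin_geN1 (v j 0 / D); have := sin_le1 (v j 0 / D).
  by move: (sin _) => s *; apply/andP; split; lra.
have ppE v j : 2 * pp v j - 1 = sin (v j 0 / D) by rewrite /pp; field.
have vD (v : V) j : (forall j, `|v j 0| <= M) -> `|v j 0 / D| <= 2^-1.
  move=> vM; rewrite normrM normfV (gtr0_norm D0) ler_pdivrMr// /D mulrA mulVf ?mul1r//.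
have backK (v : V) : (forall j, `|v j 0| <= M) -> back (pp v) = v.
  move=> vM; apply/colP => j; rewrite mxE ppE.
  rewrite sinK; first by rewrite mulrC divfK ?gt_eqF.
  rewrite in_itv/= -ler_norml.
  by rewrite (le_trans (vD v j vM))//; have := pi_ge2 R; lra.
have cpp j : continuous (fun v : V => pp v j).
  apply: continuous_mulf; last exact: continuous_cstf.
  apply: continuous_addf; first exact: continuous_cstf.
  apply: (continuous_compf (f := fun v : V => v j 0 / D)); last exact: continuous_sin.
  by apply: continuous_mulf; [exact: continuous_coord|exact: continuous_cstf].
have loc (v : V) : (forall j, `|v j 0| <= M) -> exists2 d : R, 0 < d & forall r,
    (forall j, `|pp v j - r j| < d) -> `|G v - G (back r)| <= e / 4.
  move=> vM.
  have cb : back (fun j => (w : V) j 0) @[w --> nbhs (\col_j pp v j : V)] --> v.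
    apply/mx_cvgP => j k; rewrite ord1 /back.
    under eq_fun do rewrite mxE.
    have -> : v j 0 = D * asin (2 * pp v j - 1) by rewrite -[in LHS](backK v vM) mxE.
    apply: cvgM; first exact: cvg_cst.
    have cc : 2 * (w : V) j 0 - 1 @[w --> nbhs (\col_j pp v j : V)] --> 2 * pp v j - 1.
      apply: cvgB; last exact: cvg_cst.
      apply: cvgM; first exact: cvg_cst.
      have -> : pp v j = (\col_j pp v j : V) j 0 by rewrite mxE.
      exact: coord_continuous.
    apply: (cvg_comp _ (@asin R) cc).
    apply: continuous_asin; rewrite ppE.
    have cg0 : 0 < cos (v j 0 / D).
      apply: cos_gt0_pihalf; have := pi_ge2 R.
      by have := vD v j vM; rewrite ler_norml => /andP[? ?] ?; apply/andP; split; lra.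
    have := cos2Dsin2 (v j 0 / D); nra.
  have : nbhs v [set w | `|G v - G w| <= e / 4].
    have /cvgrPdist_le/(_ (e / 4)) := cG v; apply; lra.
  move=> /cb/mx_ball_lt[d d0 dP]; exists d => // r rP.
  have := dP (\col_j r j); rewrite /= (_ : (fun j => _) = r).
    by apply => i j; rewrite !mxE; exact: rP.
  by apply/funext => j; rewrite mxE.
have [eta eta0 etaP] : exists2 eta : R, 0 < eta & forall v : V, (forall j, `|v j 0| <= M) ->
    forall r, (forall j, `|pp v j - r j| < eta) -> `|G v - G (back r)| <= e / 2.
  have /compact_near_coveringP/(_ R (nbhs (0:R)^'+)
    (fun eta (v : V) => forall r, (forall j, `|pp v j - r j| < eta) -> `|G v - G (back r)| <= e / 2)) :=
    @cube_compact M.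
  case=> [v vM|eta /= eta0 etaP].
    have [d d0 dP] := loc v vM.
    exists ([set w | (forall j, `|pp v j - pp w j| < d / 2) /\ `|G v - G w| <= e / 4],
            [set eta | eta < d / 2]).
      split => /=; last by apply: nbhs_right_lt; rewrite divr_gt0.
      apply: filterI.
        apply: (@filter_forall _ _ (fun j w => `|pp v j - pp w j| < d / 2) (nbhs v)) => j.
        have /cvgrPdist_lt/(_ (d / 2)) := cpp j v; apply; lra.
      have /cvgrPdist_le/(_ (e / 4)) := cG v; apply; lra.
    move=> [w eta] /= [[wd Gw] etad] r rP.
    have : `|G v - G (back r)| <= e / 4.
      apply: dP => j; rewrite (_ : _ - _ = (pp v j - pp w j) + (pp w j - r j)); last by ring.
      by rewrite (le_lt_trans (ler_normD _ _))//; have := wd j; have := rP j; lra.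
    move=> Gr; rewrite (_ : _ - _ = - (G v - G w) + (G v - G (back r))); last by ring.
    by rewrite (le_trans (ler_normD _ _))// normrN; lra.
  exists (eta / 2); first by rewrite divr_gt0.
  move=> v vM; apply: etaP => //=; last by rewrite divr_gt0.
  rewrite sub0r normrN gtr0_norm ?divr_gt0//; lra.
pose A := 2 * C * m%:R / eta ^+ 2.
have A0 : 0 <= A by rewrite !mulr_ge0 ?invr_ge0 ?sqr_ge0 ?ler0n.
have [N N0 NP] : exists2 N, (0 < N)%N & A / N%:R <= e / 2.
  pose N := (Num.bound (A / (e / 2))).+1; exists N => //.
  have e20 : 0 < e / 2 by lra.
  rewrite ler_pdivrMr ?ltr0n// mulrC -ler_pdivrMr//.
  have := archi_boundP (divr_ge0 A0 (ltW e20)).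
  by move=> /ltW/le_trans; apply; rewrite ler_nat /N.
pose T (v : V) := \sum_(w : {ffun 'I_m * 'I_N -> bool}) bern_weight (pp v) w * G (back (bern_mean w)).
exists T.
  apply: trigpoly_sum => w.
  rewrite (_ : (fun v => _) = (fun v => G (back (bern_mean w)) * bern_weight (pp v) w)); last first.
    by apply/funext => v; rewrite mulrC.
  apply: trigpolyZ; apply: trigpoly_prod => u.
  have tp : trigpoly (fun v => pp v u.1).
    rewrite (_ : (fun v => _) = (fun v : V => 2^-1 + 2^-1 * sin (v u.1 0 / D))); last first.
      by apply/funext => v; rewrite /pp; field.
    by apply: trig_add; [exact: trigpoly_cst|exact/trigpolyZ/trigpoly_sin].
  case: (w u) => //.
  rewrite (_ : (fun v => _) = (fun v => 1 + (-1) * pp v u.1)); last first.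
    by apply/funext => v; ring.
  by apply: trig_add; [exact: trigpoly_cst|exact: trigpolyZ].
have W0 v w := @bern_weight_ge0 R m N (pp v) (pp01 v) w.
have W1 v := @sum_bern_weight R m N (pp v).
split=> [v|v vM].
  rewrite (le_trans (ler_norm_sum _ _ _))// -[leRHS]mul1r -(W1 v) mulr_suml.
  by apply: ler_sum => w _; rewrite normrM (ger0_norm (W0 _ _)) ler_wpM2l.
have -> : G v - T v = \sum_(w : {ffun 'I_m * 'I_N -> bool}) bern_weight (pp v) w * (G v - G (back (bern_mean w))).
  rewrite -[G v in LHS]mul1r -(W1 v) mulr_suml /T -sumrB.
  by apply: eq_bigr => w _; rewrite mulrBr.
apply: (@le_trans _ _ (\sum_(w : {ffun 'I_m * 'I_N -> bool}) bern_weight (pp v) w *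
   (e / 2 + 2 * C / eta ^+ 2 * \sum_j (bern_mean w j - pp v j) ^+ 2))).
  rewrite (le_trans (ler_norm_sum _ _ _))//; apply: ler_sum => w _.
  rewrite normrM (ger0_norm (W0 _ _)) ler_wpM2l//.
  have S0 : 0 <= \sum_j (bern_mean w j - pp v j) ^+ 2 by apply: sumr_ge0 => j _; exact: sqr_ge0.
  have C20 : 0 <= 2 * C / eta ^+ 2 by rewrite !mulr_ge0 ?invr_ge0 ?sqr_ge0.
  have [all|] := boolP [forall j, `|pp v j - bern_mean w j| < eta].
    apply: (@le_trans _ _ (e / 2)); last by rewrite lerDl mulr_ge0.
    by apply: etaP => // j; exact: (forallP all).
  rewrite negb_forall => /existsP[j]; rewrite -leNgt => jeta.
  apply: (@le_trans _ _ (2 * C)).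
    by rewrite (le_trans (ler_normB _ _))// mulr_natl mulr2n lerD.
  apply: (@le_trans _ _ (2 * C / eta ^+ 2 * \sum_j (bern_mean w j - pp v j) ^+ 2)); last by rewrite lerDr; lra.
  rewrite mulrAC ler_pdivlMr ?exprn_gt0// ler_wpM2l ?mulr_ge0//.
  rewrite (bigD1 j)//= -[leLHS]addr0 lerD//; last by apply: sumr_ge0 => k _; exact: sqr_ge0.
  by rewrite -[leRHS]real_normK ?num_real// distrC ler_sqr ?nnegrE// ltW.
pose K := 2 * C / eta ^+ 2.
have -> : \sum_(w : {ffun 'I_m * 'I_N -> bool}) bern_weight (pp v) w *
   (e / 2 + K * \sum_j (bern_mean w j - pp v j) ^+ 2) =
   e / 2 + K * \sum_j \sum_(w : {ffun 'I_m * 'I_N -> bool})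
     bern_weight (pp v) w * (bern_mean w j - pp v j) ^+ 2.
  rewrite exchange_big/= mulr_sumr -[e / 2 in RHS]mul1r -(W1 v) mulr_suml -big_split/=.
  by apply: eq_bigr => w _; rewrite -mulr_sumr; ring.
rewrite [leRHS](_ : e = e / 2 + e / 2); last by field.
rewrite lerD2l (le_trans _ NP)//.
apply: (@le_trans _ _ (2 * C / eta ^+ 2 * \sum_(j < m) N%:R^-1)).
  rewrite ler_wpM2l ?mulr_ge0 ?invr_ge0 ?sqr_ge0//; apply: ler_sum => j _.
  exact: bern_var.
rewrite sumr_const card_ord -[_ *+ m]mulr_natl /A le_eqVlt; apply/orP; left; apply/eqP; ring.
Qed.

End BoundedContinuous.

Section Levy.
Context {R : realType} (m : nat).
Local Notation V := 'cV[R]_m.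
Implicit Types (E : (V -> R) -> R) (f g : V -> R).

Record expectation E : Prop := Expectation {
  expect1 : E (fun=> 1) = 1;
  expectD : forall f g, bcont f -> bcont g -> E (fun v => f v + g v) = E f + E g;
  expectZ : forall c f, bcont f -> E (fun v => c * f v) = c * E f;
  ler_expect : forall f g, bcont f -> bcont g -> (forall v, f v <= g v) -> E f <= E g }.

Lemma expect_cst E c : expectation E -> E (fun=> c) = c.
Proof.
move=> eE; rewrite (_ : (fun=> c) = (fun=> c * 1)).
  by rewrite (expectZ eE)// ?(expect1 eE) ?mulr1//; exact: bcont_cst.
by apply/funext => v; rewrite mulr1.
Qed.

Definition escape (M : R) (v : V) : R := \sum_j v j 0 ^+ 2 / (M ^+ 2 + v j 0 ^+ 2).

Let den_gt0 (M x : R) : 0 < M -> 0 < M ^+ 2 + x ^+ 2.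
Proof. by move=> M0; rewrite ltr_wpDr ?sqr_ge0// exprn_gt0. Qed.

Lemma bcont_escape (M : R) : 0 < M -> bcont (escape M).
Proof.
move=> M0; apply: bcont_sum => j _; split; last first.
  exists 1 => v; rewrite ger0_norm ?divr_ge0 ?sqr_ge0 ?(ltW (den_gt0 _ M0))//.
  by rewrite ler_pdivrMr ?den_gt0// mul1r lerDr sqr_ge0.
have csq : continuous (fun v : V => v j 0 ^+ 2).
  by apply: continuous_mulf; exact: continuous_coord.
apply: continuous_divf => //; first by move=> v; rewrite gt_eqF ?den_gt0.
by apply: continuous_addf => //; exact: continuous_cstf.
Qed.

Lemma escape_ge0 (M : R) (v : V) : 0 < M -> 0 <= escape M v.
Proof.
by move=> M0; apply: sumr_ge0 => j _; rewrite divr_ge0 ?sqr_ge0 ?(ltW (den_gt0 _ M0)).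
Qed.

Lemma escape_ge (M : R) (v : V) : 0 < M -> ~ (forall j, `|v j 0| <= M) -> 2^-1 <= escape M v.
Proof.
move=> M0 /existsNP[j /negP]; rewrite -ltNge => Mj.
rewrite /escape (bigD1 j)//= -[leLHS]addr0 lerD//.
  rewrite ler_pdivlMr ?den_gt0//.
  have : M ^+ 2 <= v j 0 ^+ 2.
    by rewrite -[leRHS]real_normK ?num_real// ler_sqr ?nnegrE ?(ltW Mj)// ltW.
  by lra.
by apply: sumr_ge0 => i _; rewrite divr_ge0 ?sqr_ge0 ?(ltW (den_gt0 _ M0)).
Qed.

Lemma escape_le (M : R) (v : V) : 0 < M -> escape M v <= (M ^+ 2)^-1 * \sum_j v j 0 ^+ 2.
Proof.
move=> M0; rewrite mulr_sumr; apply: ler_sum => j _; rewrite mulrC ler_wpM2r ?sqr_ge0//.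
by rewrite lef_pV2 ?posrE ?den_gt0 ?exprn_gt0// lerDl sqr_ge0.
Qed.

Lemma expect_near E f T (C M e : R) : expectation E -> bcont f -> bcont T ->
  0 <= C -> 0 < M -> 0 <= e ->
  (forall v, `|f v| <= C) -> (forall v, `|T v| <= C) ->
  (forall v : V, (forall j, `|v j 0| <= M) -> `|f v - T v| <= e) ->
  `|E f - E T| <= e + 4 * C * E (escape M).
Proof.
move=> eE cf cT C0 M0 e0 fC TC fT.
have ce := bcont_escape M0.
have cD : bcont (fun v => e + 4 * C * escape M v).
  by apply: bcontD; [exact: bcont_cst|exact: bcontZ].
have ED : E (fun v => e + 4 * C * escape M v) = e + 4 * C * E (escape M).
  rewrite (expectD eE) ?(expectZ eE) ?(expect_cst _ eE)//; first exact: bcont_cst.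
  exact: bcontZ.
have H v : `|f v - T v| <= e + 4 * C * escape M v.
  have [vM|vM] := pselect (forall j, `|v j 0| <= M).
    rewrite (le_trans (fT v vM))// lerDl !mulr_ge0//; exact: escape_ge0.
  have z2 := escape_ge M0 vM.
  rewrite (le_trans (ler_normB _ _))// (le_trans (lerD (fC v) (TC v)))//.
  by move: (escape M v) z2 => z z2; nra.
have h1 : E f <= E T + (e + 4 * C * E (escape M)).
  rewrite -ED -(expectD eE)//; apply: (ler_expect eE) => //; first exact: bcontD.
  by move=> v; have := H v; rewrite ler_norml => /andP[_]; lra.
have h2 : E T <= E f + (e + 4 * C * E (escape M)).
  rewrite -ED -(expectD eE)//; apply: (ler_expect eE) => //; first exact: bcontD.
  by move=> v; have := H v; rewrite ler_norml => /andP[]; lra.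
by rewrite ler_norml; apply/andP; split; lra.
Qed.

Theorem levy_continuity (E_ : nat -> (V -> R) -> R) E :
  (forall k, expectation (E_ k)) -> expectation E ->
  (forall e : R, 0 < e -> exists2 M : R, 0 < M &
     (\forall k \near \oo, E_ k (escape M) <= e) /\ E (escape M) <= e) ->
  (forall t c, E_ k (cosdot t c) @[k --> \oo] --> E (cosdot t c)) ->
  forall G, bcont G -> E_ k G @[k --> \oo] --> E G.
Proof.
move=> eE_ eE tight cvgcos G cG.
have cvgT T : trigpoly T -> E_ k T @[k --> \oo] --> E T.
  elim=> [a t c|f g tf hf tg hg].
    rewrite (expectZ eE) ?(funext (fun k => expectZ (eE_ k) a (bcont_cosdot t c)));
      last exact: bcont_cosdot.
    by apply: cvgM => //; exact: cvg_cst.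
  rewrite (expectD eE) ?(funext (fun k => expectD (eE_ k) (bcont_trigpoly tf) (bcont_trigpoly tg)));
    try exact: bcont_trigpoly.
  exact: cvgD.
have [cG' [C GC]] := cG.
have C0 : 0 <= C by exact: le_trans (GC 0).
apply/cvgrPdist_le => e e0.
pose e1 := e / (8 * (4 * C + 1)).
have d0 : 0 < 8 * (4 * C + 1) by lra.
have e10 : 0 < e1 by rewrite divr_gt0.
have [M M0 [tM_ tM]] := tight _ e10.
have e80 : 0 < e / 8 by lra.
have [T tT [TC TG]] := trigpoly_approx cG' GC M0 e80.
have cT := bcont_trigpoly tT.
have e4 : 4 * C * e1 <= e / 8.
  rewrite /e1 mulrA ler_pdivrMr//.
  by rewrite (_ : e / 8 * _ = (4 * C + 1) * e); [nra|field].
have near1 E' : expectation E' -> E' (escape M) <= e1 -> `|E' G - E' T| <= e / 4.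
  move=> eE' h; have := expect_near eE' cG cT C0 M0 (ltW e80) GC TC TG.
  have : 4 * C * E' (escape M) <= 4 * C * e1 by rewrite ler_wpM2l// mulr_ge0.
  by lra.
have e40 : 0 < e / 4 by lra.
have /cvgrPdist_le/(_ _ e40) := cvgT T tT.
move: tM_; apply: filterS2 => k tk Tk.
have := near1 _ eE tM; have := near1 _ (eE_ k) tk.
move: Tk; rewrite !ler_norml => /andP[? ?] /andP[? ?] /andP[? ?].
by apply/andP; split; lra.
Qed.

End Levy.

(** * Gaussian vectors *)

Section BoundedMeasurable.
Context {R : realType}.

Definition bmeas (d : measure_display) (T : measurableType d) (f : T -> R) : Prop :=
  measurable_fun setT f /\ exists M : R, forall t, `|f t| <= M.

Variables (d : measure_display) (T : measurableType d).
Implicit Types (f g : T -> R) (P : probability T R).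

Lemma cvg_norm_le (u : nat -> R) (l M : R) : (forall k, `|u k| <= M) ->
  u k @[k --> \oo] --> l -> `|l| <= M.
Proof.
move=> uM /cvgrPdist_le ul; apply/ler_addgt0Pr => e e0.
have [k _ /(_ k (leqnn k)) h] := ul e e0.
rewrite (_ : l = (l - u k) + u k); last by ring.
by rewrite (le_trans (ler_normD _ _))// addrC lerD.
Qed.

Lemma bmeas_cst c : bmeas (fun _ : T => c).
Proof. by split; [exact: measurable_cst|exists `|c|]. Qed.

Lemma bmeasD f g : bmeas f -> bmeas g -> bmeas (fun t => f t + g t).
Proof.
move=> [mf [M fM]] [mg [M' gM']]; split; first exact: measurable_funD.
by exists (M + M') => t; rewrite (le_trans (ler_normD _ _))// lerD.
Qed.

Lemma bmeasM f g : bmeas f -> bmeas g -> bmeas (fun t => f t * g t).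
Proof.
move=> [mf [M fM]] [mg [M' gM']]; split; first exact: measurable_funM.
by exists (M * M') => t; rewrite normrM ler_pM.
Qed.

Lemma bmeas_prod (I : Type) (r : seq I) (Q : pred I) (F : I -> T -> R) :
  (forall i, Q i -> bmeas (F i)) -> bmeas (fun v => \prod_(i <- r | Q i) F i v).
Proof.
move=> FP; elim: r => [|i r IH].
  by rewrite (_ : (fun v => _) = (fun=> 1)); [exact: bmeas_cst|apply/funext => v; rewrite big_nil].
rewrite (_ : (fun v => _) = (fun v => (if Q i then F i v else 1) * \prod_(j <- r | Q j) F j v)).
  by apply: bmeasM => //; case Qi : (Q i); [exact: FP|exact: bmeas_cst].
by apply/funext => v; rewrite big_cons; case: ifP => //; rewrite mul1r.
Qed.

Lemma bmeas_integrable P f : bmeas f -> P.-integrable setT (EFin \o f).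
Proof.
move=> [mf [M fM]]; apply: (@le_integrable _ _ _ P setT measurableT _ (cst M%:E)).
- exact/measurable_EFinP.
- by move=> t _; rewrite /= lee_fin (le_trans (fM t))// ler_norm.
- exact: finite_measure_integrable_cst.
Qed.

Lemma bmeas_RintegralD P f g : bmeas f -> bmeas g ->
  \int[P]_t (f t + g t) = \int[P]_t f t + \int[P]_t g t.
Proof. by move=> bf bg; rewrite RintegralD//; exact: bmeas_integrable. Qed.

Lemma bmeas_RintegralZ P c f : bmeas f -> \int[P]_t (c * f t) = c * \int[P]_t f t.
Proof. by move=> bf; rewrite RintegralZl//; exact: bmeas_integrable. Qed.

Lemma bmeas_ler_Rintegral P f g : bmeas f -> bmeas g -> (forall t, f t <= g t) ->
  \int[P]_t f t <= \int[P]_t g t.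
Proof. by move=> bf bg fg; apply: le_Rintegral => //; exact: bmeas_integrable. Qed.

Lemma bmeas_Rintegral_cst P c : \int[P]_t c = c.
Proof. by rewrite Rintegral_cst// [X in fine X]probability_setT mulr1. Qed.

Lemma bounded_cvg_Rintegral P (f_ : nat -> T -> R) f (M : R) :
  (forall k, measurable_fun setT (f_ k)) -> (forall k t, `|f_ k t| <= M) ->
  (forall t, f_ k t @[k --> \oo] --> f t) ->
  \int[P]_t f_ k t @[k --> \oo] --> \int[P]_t f t.
Proof.
move=> mf fM ff; apply: fine_cvg.
have mf' : measurable_fun setT f.
  exact: (measurable_fun_cvg mf (fun t _ => ff t)).
have fM' t : `|f t| <= M.
  exact: (cvg_norm_le (fun k => fM k t) (ff t)).
rewrite fineK; last first.
  by apply: integrable_fin_num => //; apply: bmeas_integrable; split => //; exists M.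
apply: (@dominated_cvg _ _ _ P _ measurableT _ _ (cst M%:E)) => //.
- by move=> k; exact/measurable_EFinP.
- by move=> t _; apply: cvg_EFin; [exact: nearW|exact: ff].
- exact: finite_measure_integrable_cst.
- by move=> k t _; rewrite /= lee_fin.
Qed.

End BoundedMeasurable.

Section StandardNormal.
Context {R : realType}.
Local Notation leb := (@lebesgue_measure R).
Local Notation w := (@normal_pdf R 0 1).
Let k : R := normal_peak 1.
Let g2 (s : R) : R := expR (- (s ^+ 2 / 4)).

Let k_gt0 : 0 < k. Proof. by apply: normal_peak_gt0; exact: oner_neq0. Qed.

Let wE s : w s = k * expR (- (s ^+ 2 / 2)).
Proof.
rewrite normal_pdfE ?oner_neq0// /normal_fun subr0 expr1n; congr (_ * expR _).
by rewrite mulNr.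
Qed.

Let int_g2 : leb.-integrable setT (EFin \o (fun s => k * g2 s)).
Proof.
have s0 : Num.sqrt 2 != 0 :> R by rewrite gt_eqF// sqrtr_gt0.
have := @integrableZl _ _ _ leb setT measurableT (normal_peak (Num.sqrt 2) : R)^-1 _ (integrable_normal_pdf 0 (Num.sqrt 2)).
move=> /(@integrableZl _ _ _ leb setT measurableT k).
apply: eq_integrable => // s _ /=; rewrite -!EFinM; congr EFin; congr (k * _).
rewrite normal_pdfE// mulKf ?gt_eqF ?normal_peak_gt0//.
rewrite /normal_fun /g2 subr0 sqr_sqrtr//; congr expR.
by rewrite mulNr -mulr_natr; congr (- (_ / _)); ring.
Qed.

Let expR_abs s : `|s| * expR (- (s ^+ 2 / 2)) <= g2 s.
Proof.
rewrite /g2 (_ : s ^+ 2 / 2 = s ^+ 2 / 4 + s ^+ 2 / 4); last by field.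
rewrite opprD expRD mulrA ler_piMl ?expR_ge0// expRN ler_pdivrMr ?expR_gt0// mul1r.
apply: le_trans (expR_ge1Dx _).
have := sqr_ge0 (`|s| / 2 - 1); rewrite -[s ^+ 2]real_normK ?num_real//; nra.
Qed.

Let expR_le s : expR (- (s ^+ 2 / 2)) <= g2 s.
Proof. by rewrite ler_expR; have := sqr_ge0 s; nra. Qed.

Let w_ge0 s : 0 <= w s. Proof. exact: normal_pdf_ge0. Qed.

Let wabs s : `|s| * w s <= k * g2 s.
Proof. by rewrite wE mulrCA ler_pM2l. Qed.

Let w_le s : w s <= k * g2 s.
Proof. by rewrite wE ler_pM2l. Qed.

Let mw : measurable_fun setT w. Proof. exact: measurable_normal_pdf. Qed.

Let integrable_w (f : R -> R) (c1 c2 : R) : 0 <= c1 -> 0 <= c2 ->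
  measurable_fun setT f -> (forall s, `|f s| <= c1 + c2 * `|s|) ->
  leb.-integrable setT (EFin \o (fun s => w s * f s)).
Proof.
move=> c10 c20 mf fle.
apply: (@le_integrable _ _ _ leb setT measurableT _ (EFin \o (fun s => (c1 + c2) * (k * g2 s)))).
- by apply/measurable_EFinP; exact: measurable_funM.
- move=> s _ /=; rewrite lee_fin normrM (ger0_norm (w_ge0 s)).
  apply: (le_trans _ (ler_norm _)).
  rewrite (le_trans (ler_wpM2l (w_ge0 s) (fle s)))// mulrDr mulrDl lerD//.
    by rewrite mulrC ler_wpM2l.
  by rewrite mulrCA ler_wpM2l// mulrC.
- have := @integrableZl _ _ _ leb setT measurableT (c1 + c2) _ int_g2.
  by apply: eq_integrable => // s _ /=; rewrite -EFinM.
Qed.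

Let msin (u c : R) : measurable_fun setT (fun s : R => sin (u * s + c)).
Proof.
apply: measurableT_comp; first by apply: continuous_measurable_fun; exact: continuous_sin.
by apply: measurable_funD => //; exact: measurable_funM.
Qed.

Let mcos (u c : R) : measurable_fun setT (fun s : R => cos (u * s + c)).
Proof.
apply: measurableT_comp; first by apply: continuous_measurable_fun; exact: continuous_cos.
by apply: measurable_funD => //; exact: measurable_funM.
Qed.

Let sin1 (x : R) : `|sin x| <= 1. Proof. by rewrite ler_norml sin_geN1 sin_le1. Qed.
Let cos1 (x : R) : `|cos x| <= 1. Proof. by rewrite ler_norml cos_geN1 cos_le1. Qed.

Let is_derive_w (s : R) : is_derive s 1 w (- s * w s).
Proof.
rewrite (_ : w = (fun s => k * expR (- (s ^+ 2 / 2)))); last exact/funext.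
by apply: is_derive_eq; rewrite /GRing.scale/=; field.
Qed.

Let dh (u c s : R) : R := w s * (u * cos (u * s + c) - s * sin (u * s + c)).

Let is_derive_h (u c s : R) : is_derive s 1 (fun s => w s * sin (u * s + c)) (dh u c s).
Proof.
have H : is_derive s 1 (fun s => sin (u * s + c)) (u * cos (u * s + c)).
  by apply: is_derive_eq; rewrite /GRing.scale/=; ring.
apply: is_derive_eq; first exact: (is_deriveM (is_derive_w s) H).
by rewrite /dh /GRing.scale/=; ring.
Qed.

Let int_dh (u c : R) : leb.-integrable setT (EFin \o dh u c).
Proof.
apply: (@integrable_w _ `|u| 1) => //.
  by apply: measurable_funB; apply: measurable_funM.
move=> s; rewrite (le_trans (ler_normB _ _))// !normrM lerD//.
  by rewrite ler_piMr.
by rewrite mulrC ler_wpM2r.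
Qed.

Let continuous_dh (u c : R) : continuous (dh u c).
Proof.
have cl : continuous (fun s : R => u * s + c).
  apply: continuous_addf; last exact: continuous_cstf.
  by apply: continuous_mulf; [exact: continuous_cstf|move=> x; exact: cvg_id].
apply: continuous_mulf; first exact: continuous_normal_pdf.
apply: continuous_addf.
  apply: continuous_mulf; first exact: continuous_cstf.
  exact: (continuous_compf cl (@continuous_cos R)).
move=> s; apply: cvgN; apply: (@continuous_mulf _ _ id (fun s => sin (u * s + c))).
  by move=> x; exact: cvg_id.
exact: (continuous_compf cl (@continuous_sin R)).
Qed.

Let Rintegral_dh (u c : R) : \int[leb]_s dh u c s = 0.
Proof.
pose I n : set R := `[- n.+1%:R, n.+1%:R]%classic.
have ch : continuous (fun s => w s * sin (u * s + c)).
  by move=> s; apply: differentiable_continuous; apply/derivable1_diffP; have [] := is_derive_h u c s.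
have ftc n : (\int[leb]_(s in I n) (dh u c s)%:E =
    (w n.+1%:R * sin (u * n.+1%:R + c) - w (- n.+1%:R) * sin (u * - n.+1%:R + c))%:E)%E.
  rewrite (@continuous_FTC2 _ (dh u c) (fun s => w s * sin (u * s + c)))//.
  - by rewrite gtrN.
  - by apply: continuous_subspaceT; exact: continuous_dh.
  - split.
    + by move=> s _; have [] := is_derive_h u c s.
    + by apply: cvg_at_right_filter; exact: ch.
    + by apply: cvg_at_left_filter; exact: ch.
  - by move=> s _; rewrite derive1E; have [_ ->] := is_derive_h u c s.
have c1 : (\int[leb]_(s in I n) (dh u c s)%:E)%E @[n --> \oo] --> (\int[leb]_s (dh u c s)%:E)%E.
  under eq_fun do rewrite integral_mkcond.
  apply: (@dominated_cvg _ _ _ leb _ measurableT _ _ (abse \o (EFin \o dh u c))) => //.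
  - move=> n; have mI : measurable (I n) by exact: measurable_itv.
    apply: (measurable_restrictT (EFin \o dh u c) mI).1.
    by apply: measurable_funTS; exact: (measurable_int leb (int_dh u c)).
  - move=> s _; apply: cvg_near_cst.
    have : \forall n \near \oo, `|s| <= n%:R by exact: nbhs_infty_ger.
    apply: filterS => n sn; rewrite patchE mem_set// /I/= in_itv/= -ler_norml.
    by rewrite (le_trans sn)// ler_nat.
  - exact: integrable_abse.
  - by move=> n s _; rewrite patchE; case: ifP => //= _; rewrite normr0 lee_fin.
have c2 : (\int[leb]_(s in I n) (dh u c s)%:E)%E @[n --> \oo] --> 0%:E.
  under eq_fun do rewrite ftc.
  apply: cvg_EFin; first exact: nearW.
  apply/cvgrPdist_le => e e0.
  have : \forall n \near \oo, 8 * k / e <= n%:R by exact: nbhs_infty_ger.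
  apply: filterS => n ne; rewrite /= sub0r normrN.
  have n1 : 1 <= n.+1%:R :> R by rewrite ler1n.
  have wn (s : R) x : `|s| = n.+1%:R -> `|w s * sin x| <= e / 2.
    move=> sn; rewrite normrM (ger0_norm (w_ge0 s)).
    apply: (@le_trans _ _ (w s)); first by rewrite ler_piMr.
    have := wabs s; rewrite sn => h.
    have : g2 s <= 4 / n.+1%:R.
      rewrite /g2 expRN -[leRHS]invrK lef_pV2 ?posrE ?expR_gt0 ?invr_gt0 ?divr_gt0//.
      rewrite invf_div; apply: le_trans (expR_ge1Dx _).
      by rewrite -[s ^+ 2]real_normK ?num_real// sn; nra.
    move=> g4.
    have h1 : n.+1%:R * w s <= 4 * k.
      rewrite (le_trans h)// mulrC; apply: ler_wpM2r; first exact: ltW.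
      by rewrite (le_trans g4)// ler_pdivrMr; nra.
    have h2 : 8 * k <= e * n.+1%:R.
      rewrite -ler_pdivrMl// mulrC (le_trans ne)// ler_nat//.
    rewrite -(@ler_pM2l _ n.+1%:R) ?ltr0n//; nra.
  rewrite (le_trans (ler_normB _ _))// (_ : e = e / 2 + e / 2); last by field.
  by apply: lerD; apply: wn; rewrite ?normrN ger0_norm.
have := cvg_unique _ c1 c2.
by rewrite /Rintegral => ->.
Qed.

Lemma normal_cos (u c : R) : \int[leb]_s (w s * cos (u * s + c)) = cos c * expR (- (u ^+ 2 / 2)).
Proof.
pose F u := \int[leb]_s (w s * cos (u * s + c)).
have icos u' : leb.-integrable setT (EFin \o (fun s => w s * cos (u' * s + c))).
  by apply: (@integrable_w _ 1 0) => // s; rewrite mul0r addr0.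
have isin u' : leb.-integrable setT (EFin \o (fun s => w s * (s * sin (u' * s + c)))).
  apply: (@integrable_w _ 0 1) => //; first exact: measurable_funM.
  by move=> s; rewrite add0r mul1r normrM ler_piMr.
have dF (x : R) : is_derive x 1 F (- x * F x).
  pose f (x s : R) := w s * cos (x * s + c).
  have df (y s : R) : is_derive y 1 (f^~ s) (- (w s * (s * sin (y * s + c)))).
    by rewrite /f; apply: is_derive_eq; rewrite /GRing.scale/=; ring.
  have d1E (y s : R) : partial1of2 f y s = - (w s * (s * sin (y * s + c))).
    by rewrite partial1of2E; have [_ ->] := df y s.
  have Ix : `]x - 1, x + 1[%classic x.
    by rewrite /= in_itv/=; apply/andP; split; lra.
  have Gub y s : `]x - 1, x + 1[%classic y -> [set: R] s -> `|partial1of2 f y s| <= k * g2 s.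
    move=> _ _; rewrite d1E normrN mulrCA !normrM (ger0_norm (w_ge0 s)).
    by rewrite (le_trans _ (wabs s))// ler_wpM2l// ler_piMr.
  have G0 s : 0 <= k * g2 s by rewrite mulr_ge0 ?expR_ge0 ?ltW.
  have intf y : `]x - 1, x + 1[%classic y -> leb.-integrable setT (EFin \o f y) by move=> _; exact: icos.
  have derf y s : `]x - 1, x + 1[%classic y -> [set: R] s -> derivable (f^~ s) y 1.
    by move=> _ _; have [] := df y s.
  have := differentiation_under_integral measurableT Ix intf derf G0 int_g2 Gub.
  have := derivable_under_integral measurableT Ix intf derf G0 int_g2 Gub.
  rewrite -/F => DF FE; apply: DeriveDef => //.
  rewrite -derive1E FE.
  under eq_Rintegral do rewrite d1E.
  have := Rintegral_dh x c.
  have -> : \int[leb]_s dh x c s = \int[leb]_s (x * (w s * cos (x * s + c)) - w s * (s * sin (x * s + c))).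
    by apply: eq_Rintegral => s _; rewrite /dh; ring.
  rewrite RintegralB//; last first.
    have := @integrableZl _ _ _ leb setT measurableT x _ (icos x).
    by apply: eq_integrable => // s _ /=; rewrite -EFinM.
  rewrite RintegralZl// => /eqP; rewrite subr_eq0 => /eqP E.
  under eq_Rintegral do rewrite -mulN1r.
  by rewrite RintegralZl// -E mulN1r mulNr.
pose G x := F x * expR (x ^+ 2 / 2).
have dG (x : R) : is_derive x 1 G 0.
  have H : is_derive x 1 (fun x => expR (x ^+ 2 / 2)) (x * expR (x ^+ 2 / 2)).
    by apply: is_derive_eq; rewrite /GRing.scale/=; field.
  apply: (is_derive_eq (is_deriveM (dF x) H)).
  by rewrite /GRing.scale/=; ring.
have [z [_]] := mvt_global dG 0 u.
rewrite mul0r => /eqP; rewrite subr_eq0 => /eqP.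
rewrite /G expr0n/= mul0r expR0 mulr1 => Fu.
have F0 : F 0 = cos c.
  rewrite /F; under eq_Rintegral do rewrite mul0r add0r.
  rewrite RintegralZr//; last exact: integrable_normal_pdf.
  by rewrite /Rintegral integral_normal_pdf mul1r.
rewrite -F0 -Fu -mulrA -expRD subrr expR0 mulr1//.
Qed.

Lemma integrable_normal_bounded (f : R -> R) (M : R) : measurable_fun setT f ->
  (forall s, `|f s| <= M) -> leb.-integrable setT (EFin \o (fun s => w s * f s)).
Proof.
move=> mf fM; apply: (@integrable_w _ M 0) => //.
  exact: le_trans (fM 0).
by move=> s; rewrite mul0r addr0.
Qed.

End StandardNormal.

Section GaussianExpectation.
Context {R : realType}.
Local Notation leb := (@lebesgue_measure R).
Local Notation w := (@normal_pdf R 0 1).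

Lemma Rintegral_normal_prob (f : R -> R) : bmeas f ->
  \int[normal_prob 0 1]_s f s = \int[leb]_s (w s * f s).
Proof.
move=> bf; have [mf [M fM]] := bf.
have dom := @normal_prob_dominates R 0 1.
have intf : (normal_prob (0:R) 1).-integrable setT (EFin \o f) by exact: bmeas_integrable.
have mw : measurable_fun setT (fun s => (w s)%:E).
  by apply/measurable_EFinP; exact: measurable_normal_pdf.
rewrite /Rintegral; congr fine.
rewrite -(Radon_Nikodym_change_of_variables dom)//=.
under [RHS]eq_integral do rewrite EFinM muleC.
apply: ae_eq_integral => //.
- by apply: emeasurable_funM => //; exact/measurable_EFinP.
- by apply: emeasurable_funM => //; exact/measurable_EFinP.
apply: ae_eqe_mul2l; rewrite Radon_NikodymE.
case: cid => h [/= _ inth hE]; apply: integral_ae_eq => //.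
by move=> E _ mE; rewrite -hE.
Qed.

Lemma gaussE_measure m : exists P : probability (m.-tuple R) R,
  forall f : m.-tuple R -> R, bmeas f -> gaussE f = \int[P]_t f t.
Proof.
elim: m => [|m [P IH]].
  exists (dirac [tuple]) => f [mf _] /=.
  by rewrite /Rintegral integral_dirac ?diracT ?mul1e//; exact/measurable_EFinP.
pose C (st : measurableTypeR R * m.-tuple R) : m.+1.-tuple R := cons_tuple st.1 st.2.
have mC : measurable_fun setT C by exact: measurable_cons.
pose X : {mfun (measurableTypeR R * m.-tuple R)%type >-> m.+1.-tuple R} := mfun_Sub (mem_set mC).
pose N : probability (measurableTypeR R) R := normal_prob 0 1.
exists (distribution (N \x P)%E X) => f bf.
have [mf [M fM]] := bf.
have bfC : bmeas (f \o C).
  by split; [exact: measurableT_comp|exists M => t; exact: fM].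
have intC := bmeas_integrable (N \x P)%E bfC.
rewrite [RHS]/Rintegral integral_distribution//; last exact/measurable_EFinP.
rewrite -integral12_prod_meas1//.
have bs s : bmeas (fun t => f (C (s, t))).
  split; last by exists M => t; exact: fM.
  by apply: (measurableT_comp mf); apply: (@measurable_cons _ _ _ _ (fun=> s) _ id).
have fE s : fubini_F P ((EFin \o f) \o X) s = (\int[P]_t f (C (s, t)))%:E.
  rewrite /fubini_F /Rintegral fineK//.
  by apply: integrable_fin_num => //; exact: (bmeas_integrable P (bs s)).
have bF : bmeas (fun s => \int[P]_t f (C (s, t))).
  split.
    have := @measurable_fubini_F _ _ _ _ _ N P _ intC.
    rewrite (_ : fubini_F _ _ = EFin \o (fun s => \int[P]_t f (C (s, t)))); last first.
      by apply/funext => s; exact: fE.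
    by move/measurable_EFinP.
  exists M => s; rewrite (le_trans (le_normr_Rintegral _ _))//.
    exact: (bmeas_integrable P (bs s)).
  rewrite -[leRHS](@bmeas_Rintegral_cst _ _ _ P).
  apply: bmeas_ler_Rintegral => //; last exact: bmeas_cst.
  split; last by exists M => t; rewrite normr_id.
  by apply: measurableT_comp => //; have [] := bs s.
under eq_integral do rewrite fE.
rewrite -[RHS]/(\int[N]_s (\int[P]_t f (C (s, t)))) Rintegral_normal_prob//=.
by apply: eq_Rintegral => s _; rewrite (IH _ (bs s)).
Qed.

Definition gaussP m : probability (m.-tuple R) R := sval (cid (gaussE_measure m)).

Lemma gaussEE m (f : m.-tuple R -> R) : bmeas f -> gaussE f = \int[gaussP m]_t f t.
Proof. by move=> bf; rewrite /gaussP; case: cid => P /= ->. Qed.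

Section Properties.
Variable m : nat.
Implicit Types f g : m.-tuple R -> R.

Lemma gaussE_cst c : gaussE (fun _ : m.-tuple R => c) = c.
Proof. by rewrite gaussEE ?bmeas_Rintegral_cst//; exact: bmeas_cst. Qed.

Lemma gaussED f g : bmeas f -> bmeas g ->
  gaussE (fun t => f t + g t) = gaussE f + gaussE g.
Proof. by move=> bf bg; rewrite !gaussEE ?bmeas_RintegralD//; exact: bmeasD. Qed.

Lemma gaussEZ c f : bmeas f -> gaussE (fun t => c * f t) = c * gaussE f.
Proof.
by move=> bf; rewrite !gaussEE ?bmeas_RintegralZ//; apply: bmeasM => //; exact: bmeas_cst.
Qed.

Lemma ler_gaussE f g : bmeas f -> bmeas g -> (forall t, f t <= g t) ->
  gaussE f <= gaussE g.
Proof. by move=> bf bg fg; rewrite !gaussEE//; exact: bmeas_ler_Rintegral. Qed.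

Lemma gaussE_cvg (f_ : nat -> m.-tuple R -> R) f (M : R) :
  (forall k, measurable_fun setT (f_ k)) -> (forall k t, `|f_ k t| <= M) ->
  (forall t, f_ k t @[k --> \oo] --> f t) ->
  gaussE (f_ k) @[k --> \oo] --> gaussE f.
Proof.
move=> mf fM ff.
have bf k : bmeas (f_ k) by split => //; exists M.
have bf' : bmeas f.
  split; first exact: (measurable_fun_cvg mf (fun t _ => ff t)).
  by exists M => t; exact: (cvg_norm_le (fun k => fM k t) (ff t)).
rewrite gaussEE//; under eq_fun do rewrite gaussEE//.
exact: (bounded_cvg_Rintegral mf fM ff).
Qed.

End Properties.

Lemma gaussE_cos m (u : 'I_m -> R) c :
  gaussE (fun t : m.-tuple R => cos (\sum_j u j * tnth t j + c)) =
  cos c * expR (- ((\sum_j u j ^+ 2) / 2)).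
Proof.
elim: m => [|m IH] in u c *.
  by rewrite /= !big_ord0 add0r mul0r oppr0 expR0 mulr1.
rewrite /= [in RHS]big_ord_recl.
have E (s : R) : gaussE (fun t : m.-tuple R => cos (\sum_j u j * tnth (cons_tuple s t) j + c)) =
   cos (u ord0 * s + c) * expR (- ((\sum_j u (lift ord0 j) ^+ 2) / 2)).
  rewrite -(IH (fun j => u (lift ord0 j))); congr gaussE; apply/funext => t.
  rewrite big_ord_recl tnth0 -addrA addrCA; congr (cos (_ + _)).
  by apply: eq_bigr => j _; rewrite tnthS.
under eq_Rintegral do rewrite E mulrA.
rewrite RintegralZr//.
  rewrite normal_cos -mulrA -expRD; congr (_ * expR _).
  by rewrite mulrDl opprD.
apply: (@integrable_normal_bounded _ _ 1); last by move=> s; rewrite ler_norml cos_geN1 cos_le1.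
apply: measurableT_comp; first by apply: continuous_measurable_fun; exact: continuous_cos.
by apply: measurable_funD => //; exact: measurable_funM.
Qed.

Lemma gaussE_sphere m (b : 'I_m -> bool) (a : R) : (exists i, b i) ->
  gaussE (fun t : m.-tuple R => (\sum_i (b i)%:R * tnth t i ^+ 2 == a)%:R) = 0.
Proof.
elim: m => [|m IH] in b a *; first by case=> -[].
move=> exb /=.
have E s (t : m.-tuple R) : \sum_i (b i)%:R * tnth (cons_tuple s t) i ^+ 2 =
    (b ord0)%:R * s ^+ 2 + \sum_i (b (lift ord0 i))%:R * tnth t i ^+ 2.
  by rewrite big_ord_recl tnth0; congr (_ + _); apply: eq_bigr => i _; rewrite tnthS.
have [ex|nex] := pselect (exists i, b (lift ord0 i)).
  rewrite (@eq_Rintegral _ _ _ _ _ (fun=> 0)) => [|s _]; first by rewrite Rintegral_cst// mul0r.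
  rewrite (_ : (fun t => _) = (fun t : m.-tuple R =>
    (\sum_i (b (lift ord0 i))%:R * tnth t i ^+ 2 == a - (b ord0)%:R * s ^+ 2)%:R)).
    by rewrite (IH (fun i => b (lift ord0 i)))// mulr0.
  apply/funext => t; rewrite E; congr ((nat_of_bool _)%:R).
  by rewrite [RHS]eq_sym subr_eq [RHS]eq_sym addrC.
have b0 : b ord0.
  have [i bi] := exb; case: (unliftP ord0 i) bi => [j ->|->//] bj.
  by exfalso; apply: nex; exists j.
pose A : set R := [set Num.sqrt a] `|` [set - Num.sqrt a].
have mA : measurable A by apply: measurableU; exact: measurable_set1.
have A0 : leb A = 0%E.
  by apply: countable_lebesgue_measure0; apply: finite_set_countable; exact: finite_set2.
rewrite /Rintegral.
rewrite (_ : (\int[leb]_s _)%E = (\int[leb]_(s in A) (w s * (s ^+ 2 == a)%:R)%:E)%E).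
  rewrite null_set_integral//; apply: measurable_funTS; apply/measurable_EFinP.
  apply: measurable_funM; first exact: measurable_normal_pdf.
  have -> : (fun s : R => (s ^+ 2 == a)%:R) = \1_[set s : R | s ^+ 2 == a] :> (R -> R).
    by apply/funext => s; rewrite indicE; congr ((nat_of_bool _)%:R); apply/idP/idP; rewrite inE.
  apply: measurable_indic.
  have := @measurable_funX _ _ _ setT (@idfun R) 2 (@measurable_id _ _ _) measurableT [set a] (measurable_set1 a).
  rewrite setTI => mS; rewrite (_ : [set s : R | _] = (fun x => idfun x ^+ 2) @^-1` [set a])//.
  by apply/seteqP; split => s /= /eqP.
rewrite [RHS]integral_mkcond; apply: eq_integral => s _; rewrite patchE.
have -> : gaussE (fun t : m.-tuple R => (\sum_i (b i)%:R * tnth (cons_tuple s t) i ^+ 2 == a)%:R) =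
   (s ^+ 2 == a)%:R :> R.
  rewrite -[RHS](gaussE_cst m); congr gaussE; apply/funext => t.
  rewrite E b0 mul1r big1 ?addr0// => i _.
  by rewrite (_ : b _ = false) ?mul0r//; apply/negP => bi; apply: nex; exists i.
case: ifPn => // sA; congr EFin.
suff /negbTE-> : s ^+ 2 != a by rewrite mulr0.
apply: contra sA => /eqP sa; rewrite inE /A/= -sa sqrtr_sqr.
by have [s0|s0] := leP 0 s; [left; rewrite ger0_norm|right; rewrite ltr0_norm ?opprK].
Qed.

Lemma gaussE_box_gt0 m (e : R) : 0 < e ->
  0 < gaussE (fun t : m.-tuple R => \prod_i (`|tnth t i| <= e)%R%:R).
Proof.
move=> e0; elim: m => [|m IH]; first by rewrite /= big_ord0.
rewrite /=; set c := gaussE _ in IH.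
have E (s : R) : gaussE (fun t : m.-tuple R => \prod_i (`|tnth (cons_tuple s t) i| <= e)%R%:R) =
   c * (`|s| <= e)%R%:R.
  have bc : bmeas (fun t : m.-tuple R => \prod_i (`|tnth t i| <= e)%R%:R : R).
    apply: bmeas_prod => i _; split; last first.
      by exists 1 => t; case: (`|tnth t i| <= e)%R; rewrite ?normr1 ?normr0.
    have -> : (fun t : m.-tuple R => (`|tnth t i| <= e)%R%:R) = \1_([set x : R | `|x| <= e]) \o (fun t : m.-tuple R => tnth t i) :> (_ -> R).
      by apply/funext => t /=; rewrite indicE; congr ((nat_of_bool _)%:R); apply/idP/idP; rewrite inE.
    apply: measurableT_comp; last exact: measurable_tnth.
    apply: measurable_indic; rewrite (_ : [set x : R | _] = `[- e, e]%classic); first exact: measurable_itv.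
    by apply/seteqP; split => x /=; rewrite in_itv/= ler_norml.
  rewrite mulrC -gaussEZ//; congr gaussE; apply/funext => t.
  rewrite big_ord_recl tnth0; congr (_ * _).
  by apply: eq_bigr => i _; rewrite tnthS.
under eq_Rintegral do rewrite E.
have indE (s : R) : (`|s| <= e)%R%:R = \1_(`[- e, e]%classic) s :> R.
  by rewrite indicE; congr ((nat_of_bool _)%:R); apply/idP/idP; rewrite inE/= in_itv/= ler_norml.
have we0 : 0 < w e.
  by rewrite normal_pdfE ?oner_neq0// mulr_gt0 ?expR_gt0 ?normal_peak_gt0 ?oner_neq0.
have int1 : leb.-integrable setT (EFin \o (fun s => w e * c * (`|s| <= e)%R%:R)).
  have := @integrableZl _ _ _ leb setT measurableT (w e * c) _
    (@integrable_indic_itv R (- e) e true false).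
  apply: eq_integrable => // s _ /=; rewrite -EFinM indE//.
have int2 : leb.-integrable setT (EFin \o (fun s => w s * (c * (`|s| <= e)%R%:R))).
  apply: (@integrable_normal_bounded _ _ `|c|).
    apply: measurable_funM => //.
    under eq_fun do rewrite indE; exact: measurable_indic.
  by move=> s; rewrite normrM ler_piMr//; case: (`|s| <= e)%R; rewrite ?normr1 ?normr0.
apply: (@lt_le_trans _ _ (\int[leb]_s (w e * c * (`|s| <= e)%R%:R))).
  under eq_Rintegral do rewrite indE.
  rewrite RintegralZl//.
    rewrite /Rintegral integral_indic//= setIT lebesgue_measure_itv/= lte_fin gtrN//=.
    by rewrite opprK !mulr_gt0// addr_gt0.
  exact: (@integrable_indic_itv R (- e) e true false).
apply: le_Rintegral => // s _.
rewrite -mulrA; have [se|_] := boolP (`|s| <= e); last by rewrite !mulr0.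
rewrite !mulr1 ler_wpM2r ?(ltW IH)//.
rewrite !normal_pdfE ?oner_neq0// ler_pM2l ?normal_peak_gt0 ?oner_neq0// ler_expR.
rewrite !subr0 expr1n !mulNr lerN2 ler_pM2r ?invr_gt0// -[s ^+ 2]real_normK ?num_real//.
by rewrite ler_sqr ?nnegrE ?(ltW e0).
Qed.

End GaussianExpectation.

Section GaussianVectors.
Context {R : realType}.

Lemma bmeas_comp (d : measure_display) (T : measurableType d) p (X : T -> 'cV[R]_p)
    (f : 'cV[R]_p -> R) :
  (forall j, measurable_fun setT (fun t => X t j 0)) -> bcont f -> bmeas (fun t => f (X t)).
Proof.
move=> mX [cf [M fM]]; split; last by exists M => t; exact: fM.
have mdot u : measurable_fun setT (fun t => dotv u (X t)).
  by apply: measurable_sum => j; exact: measurable_funM.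
have mtrig T' : trigpoly T' -> measurable_fun setT (fun t => T' (X t)).
  elim=> [a u c|f1 f2 _ h1 _ h2]; last exact: measurable_funD.
  apply: measurable_funM => //; apply: measurableT_comp.
    by apply: continuous_measurable_fun; exact: continuous_cos.
  by apply: measurable_funD.
have ex k : exists T', trigpoly T' /\
    forall v : 'cV[R]_p, (forall j, `|v j 0| <= k.+1%:R) -> `|f v - T' v| <= k.+1%:R^-1.
  have k0 : 0 < k.+1%:R :> R by rewrite ltr0n.
  have ki0 : 0 < k.+1%:R^-1 :> R by rewrite invr_gt0.
  by have [T' ? [_ ?]] := trigpoly_approx cf fM k0 ki0; exists T'.
have [Ts TsP] := choice ex.
apply: (measurable_fun_cvg (h := fun k t => Ts k (X t))).
  by move=> k; apply: mtrig; have [] := TsP k.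
move=> t _; apply/cvgrPdist_le => e e0.
have n1 : \forall k \near \oo, e^-1 <= k%:R by exact: nbhs_infty_ger.
have n2 : \forall k \near \oo, \sum_j `|X t j 0| <= k%:R by exact: nbhs_infty_ger.
move: n1 n2; apply: filterS2 => k k1 k2.
have [_ /(_ (X t)) h] := TsP k.
apply: (le_trans (h _)).
  move=> j; apply: (@le_trans _ _ k%:R); last by rewrite ler_nat.
  by rewrite (le_trans _ k2)// (bigD1 j)//= lerDl sumr_ge0.
rewrite -[leRHS]invrK lef_pV2 ?posrE ?invr_gt0 ?ltr0n//.
by rewrite (le_trans k1)// ler_nat.
Qed.

Variable m : nat.
Implicit Types (u w x : 'cV[R]_m).

Lemma measurable_tcol j : measurable_fun setT (fun t : m.-tuple R => tcol t j 0).
Proof. by under eq_fun do rewrite mxE; exact: measurable_tnth. Qed.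

Lemma continuous_mulmxl p (A : 'M[R]_(p, m)) : continuous (fun x : 'cV[R]_m => A *m x).
Proof.
apply: continuous_mxP => i j; under eq_fun do rewrite mxE.
apply: continuous_bigsum => k _; apply: continuous_mulf; first exact: continuous_cstf.
exact: continuous_coord.
Qed.

Lemma bcont_mulmx p (A : 'M[R]_(p, m)) (f : 'cV[R]_p -> R) : bcont f ->
  bcont (fun x => f (A *m x)).
Proof.
move=> [cf [M fM]]; split; last by exists M => x; exact: fM.
exact: (continuous_compf (@continuous_mulmxl p A) cf).
Qed.

Lemma bmeas_tcol (f : 'cV[R]_m -> R) : bcont f -> bmeas (fun t : m.-tuple R => f (tcol t)).
Proof. by apply: bmeas_comp => j; exact: measurable_tcol. Qed.

Lemma gaussE_cosdot u c :
  gaussE (fun t : m.-tuple R => cosdot u c (tcol t)) =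
  cos c * expR (- ((\sum_j u j 0 ^+ 2) / 2)).
Proof.
rewrite -(gaussE_cos (fun j => u j 0)); congr gaussE; apply/funext => t.
by congr (cos (_ + _)); apply: eq_bigr => j _; rewrite mxE.
Qed.

Lemma dotv_mulmx p (A : 'M[R]_(p, m)) (s : 'cV[R]_p) x : dotv s (A *m x) = dotv (A^T *m s) x.
Proof.
rewrite /dotv; under eq_bigr do rewrite mxE mulr_sumr.
rewrite exchange_big/=; apply: eq_bigr => j _; rewrite mxE mulr_suml.
by apply: eq_bigr => i _; rewrite mxE mulrCA mulrA.
Qed.

Lemma cosdot_mulmx p (A : 'M[R]_(p, m)) (s : 'cV[R]_p) c x :
  cosdot s c (A *m x) = cosdot (A^T *m s) c x.
Proof. by rewrite /cosdot dotv_mulmx. Qed.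

Lemma gauss_escape p (C e : R) : 0 <= C -> 0 < e -> exists2 M : R, 0 < M &
  forall A : 'M[R]_(p, m), (forall i j, `|A i j| <= C) ->
  gaussE (fun t : m.-tuple R => escape M (A *m tcol t)) <= e.
Proof.
move=> C0 e0.
pose S (x : 'cV[R]_m) : R := C ^+ 2 * (\sum_j `|x j 0|) ^+ 2.
have S0 x : 0 <= S x by rewrite mulr_ge0 ?sqr_ge0.
pose h (k : nat) x : R := p%:R * (S x / (k.+1%:R ^+ 2 + S x)).
have den k x : 0 < k.+1%:R ^+ 2 + S x by rewrite ltr_wpDr// exprn_gt0.
have h01 k x : 0 <= h k x <= p%:R.
  rewrite /h mulr_ge0 ?ler0n ?divr_ge0 ?(ltW (den _ _))//=.
  by rewrite ler_piMr ?ler0n// ler_pdivrMr// mul1r lerDr sqr_ge0.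
have cS : continuous S.
  apply: continuous_mulf; first exact: continuous_cstf.
  have c1 : continuous (fun x : 'cV[R]_m => \sum_j `|x j 0|).
    apply: continuous_bigsum => j _.
    exact: (continuous_compf (@continuous_coord _ _ _ j 0) (@norm_continuous _ _)).
  exact: (continuous_mulf c1 c1).
have bh k : bcont (h k).
  split; last by exists p%:R => x; have /andP[? ?] := h01 k x; rewrite ger0_norm.
  apply: continuous_mulf; first exact: continuous_cstf.
  apply: continuous_divf => //; first by move=> x; rewrite gt_eqF.
  by apply: continuous_addf => //; exact: continuous_cstf.
have : gaussE (fun t : m.-tuple R => h k (tcol t)) @[k --> \oo] --> gaussE (fun _ : m.-tuple R => 0 : R).
  apply: (@gaussE_cvg _ _ _ _ p%:R).
  - by move=> k; have [] := bmeas_tcol (bh k).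
  - by move=> k t; have /andP[? ?] := h01 k (tcol t); rewrite ger0_norm.
  - move=> t; apply/cvgrPdist_le => d d0.
    have : \forall k \near \oo, p%:R * S (tcol t) / d <= k%:R by exact: nbhs_infty_ger.
    apply: filterS => k; rewrite ler_pdivrMr// => kd.
    have /andP[? ?] := h01 k (tcol t); rewrite sub0r normrN ger0_norm// /h.
    rewrite mulrA ler_pdivrMr// (le_trans kd)// mulrC ler_pM2l//.
    rewrite (@le_trans _ _ (k.+1%:R ^+ 2)) ?lerDl//.
    by rewrite -natrX ler_nat expnS expn1 (leq_trans (leqnSn k))// leq_pmulr.
rewrite gaussE_cst => /cvgrPdist_le/(_ _ e0)[k _ /(_ k (leqnn k))].
rewrite sub0r normrN => hk; exists k.+1%:R => // A AC.
rewrite (le_trans _ (le_trans (ler_norm _) hk))//; apply: ler_gaussE.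
- apply: (bmeas_tcol (f := fun x => escape k.+1%:R (A *m x))).
  by apply: bcont_mulmx; exact: bcont_escape.
- exact: bmeas_tcol.
move=> t; rewrite /escape.
rewrite (_ : h k _ = \sum_(i < p) S (tcol t) / (k.+1%:R ^+ 2 + S (tcol t))); last first.
  by rewrite sumr_const card_ord /h mulr_natl.
apply: ler_sum => i _; set y := (A *m tcol t) i 0.
have yS : y ^+ 2 <= S (tcol t).
  rewrite /S -exprMn -[y ^+ 2]real_normK ?num_real// ler_sqr ?nnegrE ?mulr_ge0 ?sumr_ge0//.
  rewrite /y mxE (le_trans (ler_norm_sum _ _ _))// mulr_sumr; apply: ler_sum => j _.
  by rewrite normrM ler_wpM2r.
have den' : 0 < k.+1%:R ^+ 2 + y ^+ 2 :> R by rewrite ltr_wpDr ?sqr_ge0// exprn_gt0.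
rewrite ler_pdivrMr// mulrAC ler_pdivlMr//.
have := sqr_ge0 y; have := S0 (tcol t); have : 0 < k.+1%:R ^+ 2 :> R by rewrite exprn_gt0.
by move: (S _) (y ^+ 2) (k.+1%:R ^+ 2) yS => z1 z2 z3; nra.
Qed.

Lemma expectation_gauss p (A : 'M[R]_(p, m)) (ib : m.-tuple R -> R) :
  bmeas ib -> (forall t, 0 <= ib t) -> 0 < gaussE ib ->
  expectation (fun f : 'cV[R]_p -> R => gaussE (fun t => f (A *m tcol t) * ib t) / gaussE ib).
Proof.
move=> bib ib0 gib.
have bA f : bcont f -> bmeas (fun t : m.-tuple R => f (A *m tcol t) * ib t).
  by move=> cf; apply: bmeasM => //; apply: (bmeas_tcol (f := fun x => f (A *m x))); exact: bcont_mulmx.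
split=> [|f g cf cg|c f cf|f g cf cg fg].
- rewrite (_ : (fun t => _) = ib); first by rewrite mulfV ?gt_eqF.
  by apply/funext => t; rewrite mul1r.
- rewrite -mulrDl; congr (_ / _); rewrite -gaussED; [|exact: bA..].
  by congr gaussE; apply/funext => t; rewrite mulrDl.
- rewrite mulrA; congr (_ / _); rewrite -gaussEZ; last exact: bA.
  by congr gaussE; apply/funext => t; rewrite mulrA.
- rewrite ler_pM2r ?invr_gt0//; apply: ler_gaussE; [exact: bA..|].
  by move=> t; rewrite ler_wpM2r.
Qed.

Lemma gauss_rotation (A : 'M[R]_m) (f : 'cV[R]_m -> R) :
  (forall u, \sum_j (A^T *m u) j 0 ^+ 2 = \sum_j u j 0 ^+ 2) -> bcont f ->
  gaussE (fun t : m.-tuple R => f (A *m tcol t)) = gaussE (fun t : m.-tuple R => f (tcol t)).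
Proof.
move=> iso cf.
pose Ex (B : 'M[R]_m) (f : 'cV[R]_m -> R) := gaussE (fun t : m.-tuple R => f (B *m tcol t) * 1) / gaussE (fun _ : m.-tuple R => 1 : R).
have ExE B g : Ex B g = gaussE (fun t => g (B *m tcol t)).
  by rewrite /Ex gaussE_cst divr1; congr gaussE; apply/funext => t; rewrite mulr1.
have eE B : expectation (Ex B).
  by apply: expectation_gauss => //; [exact: bmeas_cst|rewrite gaussE_cst].
have : Ex A f @[k --> \oo] --> Ex 1%:M f.
  apply: (levy_continuity (E_ := fun k : nat => Ex A)) => //.
    move=> e e0; pose C := \sum_i \sum_j (`|A i j| + 1).
    have C0 : 0 <= C by apply: sumr_ge0 => i _; apply: sumr_ge0 => j _; exact: addr_ge0.
    have [M M0 MP] := gauss_escape m C0 e0; exists M => //; split.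
      apply: nearW => k; rewrite ExE; apply: MP => i j.
      rewrite /C (bigD1 i)//= (bigD1 j)//= -addrA -addrA lerDl addr_ge0// addr_ge0//.
        by apply: sumr_ge0 => *; exact: addr_ge0.
      by apply: sumr_ge0 => *; apply: sumr_ge0 => *; exact: addr_ge0.
    rewrite ExE; apply: MP => i j; rewrite mxE.
    rewrite /C (bigD1 i)//= (bigD1 j)//=.
    have h1 : 0 <= \sum_(j0 < m | j0 != j) (`|A i j0| + 1) by apply: sumr_ge0 => *; exact: addr_ge0.
    have h2 : 0 <= \sum_(i0 < m | i0 != i) \sum_j0 (`|A i0 j0| + 1).
      by apply: sumr_ge0 => *; apply: sumr_ge0 => *; exact: addr_ge0.
    have : 0 <= `|A i j| by [].
    have : `|(i == j)%:R| <= 1 :> R by case: (i == j); rewrite ?normr1 ?normr0.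
    by move: h1 h2; set X := bigop _ _ _; set Y := bigop _ _ _; lra.
  move=> t c; rewrite !ExE.
  have -> : (fun t1 : m.-tuple R => cosdot t c (1%:M *m tcol t1)) = (fun t1 => cosdot t c (tcol t1)).
    by apply/funext => t1; rewrite mul1mx.
  have -> : (fun t1 : m.-tuple R => cosdot t c (A *m tcol t1)) = (fun t1 => cosdot (A^T *m t) c (tcol t1)).
    by apply/funext => t1; rewrite cosdot_mulmx.
  rewrite !gaussE_cosdot iso; exact: cvg_cst.
move=> /cvg_lim h; have := h (@Rhausdorff R); rewrite lim_cst//.
by rewrite !ExE => ->; congr gaussE; apply/funext => t; rewrite mul1mx.
Qed.

End GaussianVectors.

Section Step.
Context {R : realType}.

Definition pospart (x : R) : R := (x + `|x|) / 2.

Lemma pospart_ge0 x : 0 <= pospart x.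
Proof. by rewrite /pospart; have := lerNnormlW (lexx `|x|); lra. Qed.

Lemma pospart_le0 x : x <= 0 -> pospart x = 0.
Proof. by move=> x0; rewrite /pospart ler0_norm// subrr mul0r. Qed.

Lemma pospart_gt0 x : 0 < x -> pospart x = x.
Proof. by move=> x0; rewrite /pospart gtr0_norm//; field. Qed.

Definition step (k : nat) (x : R) : R := expR (- (k%:R * pospart x)).

Lemma step_continuous k : continuous (step k).
Proof.
apply: (continuous_compf (f := fun x => - (k%:R * pospart x))); last exact: continuous_expR.
move=> x; apply: cvgN; apply: cvgM; first exact: cvg_cst.
apply: cvgM; last exact: cvg_cst.
by apply: cvgD; [exact: cvg_id|apply: cvg_norm; exact: cvg_id].
Qed.

Lemma step_ge0 k x : 0 <= step k x. Proof. exact: expR_ge0. Qed.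

Lemma step_le1 k x : step k x <= 1.
Proof. by rewrite /step -[leRHS]expR0 ler_expR oppr_le0 mulr_ge0 ?ler0n ?pospart_ge0. Qed.

Lemma step1 k x : x <= 0 -> step k x = 1.
Proof. by move=> x0; rewrite /step pospart_le0// mulr0 oppr0 expR0. Qed.

Lemma step_le_inv k x : 0 < x -> step k x <= (1 + k%:R * x)^-1.
Proof.
move=> x0; rewrite /step pospart_gt0// expRN lef_pV2 ?posrE ?expR_gt0 ?expR_ge1Dx//.
by rewrite ltr_wpDr// mulr_ge0 ?ler0n ?ltW.
Qed.

Lemma step_cvg0 (x : nat -> R) (d : R) : 0 < d -> (\forall k \near \oo, d <= x k) ->
  step k (x k) @[k --> \oo] --> 0.
Proof.
move=> d0 xd; apply/cvgrPdist_le => e e0.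
have n1 : \forall k \near \oo, e^-1 / d <= k%:R by exact: nbhs_infty_ger.
move: xd n1; apply: filterS2 => k dk; rewrite ler_pdivrMr// => kd.
rewrite sub0r normrN ger0_norm ?step_ge0//.
have x0 := lt_le_trans d0 dk.
rewrite (le_trans (step_le_inv k x0))// -[leRHS]invrK lef_pV2 ?posrE ?invr_gt0//.
  have : k%:R * d <= k%:R * x k by rewrite ler_wpM2l ?ler0n.
  by lra.
by rewrite ltr_wpDr// mulr_ge0 ?ler0n ?ltW.
Qed.

Lemma step_cvg_ind (a y : R) : step k (y - a) @[k --> \oo] --> ((y <= a)%R%:R : R).
Proof.
have [ya|ay] := leP y a.
  under eq_fun do rewrite step1 ?subr_le0//; exact: cvg_cst.
apply: (@step_cvg0 _ (y - a)); first by rewrite subr_gt0.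
exact: nearW.
Qed.

End Step.

Section Blocks.
Context {R : realType} (m : nat) (B : finType) (beta : 'I_m -> B).
Implicit Types (u w x z : 'cV[R]_m) (b : B).

Definition bnorm b x : R := \sum_(i | beta i == b) x i 0 ^+ 2.

Let bdot b x z : R := \sum_(i | beta i == b) x i 0 * z i 0.

Lemma bnorm_ge0 b x : 0 <= bnorm b x.
Proof. by apply: sumr_ge0 => i _; exact: sqr_ge0. Qed.

Lemma bnorm_continuous b : continuous (bnorm b).
Proof. by apply: continuous_bigsum => i _; apply: continuous_mulf; exact: continuous_coord. Qed.

Lemma sum_bnorm x : \sum_i x i 0 ^+ 2 = \sum_b bnorm b x.
Proof. by rewrite (partition_big beta predT). Qed.

Let refl z : 'M[R]_m := \matrix_(i, j) ((i == j)%:R -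
  (if beta j == beta i then 2 * z i 0 * z j 0 / bnorm (beta i) z else 0)).

Let reflE z x i : (refl z *m x) i 0 =
  x i 0 - 2 * z i 0 * bdot (beta i) z x / bnorm (beta i) z.
Proof.
rewrite mxE; under eq_bigr do rewrite mxE mulrBl.
rewrite sumrB; congr (_ - _).
  by rewrite (bigD1 i)//= eqxx mul1r big1 ?addr0// => j /negbTE; rewrite eq_sym => ->; rewrite mul0r.
rewrite /bdot [in RHS]big_mkcond mulr_sumr mulr_suml; apply: eq_bigr => j _.
by case: ifP => _; rewrite ?mulr0 ?mul0r//; ring.
Qed.

Let refl_tr z : (refl z)^T = refl z.
Proof.
apply/matrixP => i j; rewrite !mxE [j == i]eq_sym [beta i == _]eq_sym; congr (_ - _).
by case: eqP => // ->; ring.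
Qed.

Let bnorm_refl z x b : bnorm b (refl z *m x) = bnorm b x.
Proof.
have -> : bnorm b (refl z *m x) =
   bnorm b x - 4 * (bdot b z x / bnorm b z) * bdot b z x
   + 4 * (bdot b z x / bnorm b z) ^+ 2 * bnorm b z.
  rewrite {1 2 5}/bnorm {2}/bdot !mulr_sumr -sumrN -!big_split/=.
  by apply: eq_bigr => i /eqP bi; rewrite reflE bi; ring.
have [n0|n0] := eqVneq (bnorm b z) 0; first by rewrite n0 invr0 !mulr0 mul0r; ring.
by field.
Qed.

Let refl_swap u w : (forall b, bnorm b u = bnorm b w) -> refl (u - w) *m u = w.
Proof.
move=> uw; apply/colP => i; rewrite reflE; set b := beta i; set z := u - w.
have nz : bnorm b z = 2 * bdot b z u.
  have E1 : bnorm b z = bnorm b u + bnorm b w - 2 * bdot b u w.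
    rewrite /bnorm /bdot mulr_sumr -sumrN -!big_split/=.
    by apply: eq_bigr => j _; rewrite !mxE; ring.
  have E2 : bdot b z u = bnorm b u - bdot b u w.
    rewrite /bnorm /bdot -sumrB; apply: eq_bigr => j _; rewrite !mxE; ring.
  by rewrite E1 E2 -uw; ring.
have [n0|n0] := eqVneq (bnorm b z) 0.
  have /psumr_eq0P : bnorm b z = 0 by [].
  move=> /(_ (fun j _ => sqr_ge0 _) i (eqxx _))/eqP.
  by rewrite sqrf_eq0 !mxE subr_eq0 => /eqP ->; rewrite subrr mulr0 !mul0r subr0.
have d0 : bdot b z u != 0 by move: n0; rewrite nz mulf_eq0 negb_or => /andP[].
by rewrite nz !mxE; field.
Qed.

Variables (P : pred B) (a : B -> R).

Definition bball x : R := \prod_(b | P b) (bnorm b x <= a b)%R%:R.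
Let sball k x : R := \prod_(b | P b) step k (bnorm b x - a b).

Lemma bball01 x : 0 <= bball x <= 1.
Proof.
have h b : 0 <= ((bnorm b x <= a b)%R%:R : R) <= 1.
  by case: (bnorm b x <= a b)%R; rewrite ?lexx ?ler01.
by apply/andP; split; [apply: prodr_ge0 => b _; have /andP[] := h b|apply: prodr_ile1].
Qed.

Let bcont_step k (f : 'cV[R]_m -> R) : continuous f -> bcont (fun x => step k (f x)).
Proof.
move=> cf; split; last by exists 1 => x; rewrite ger0_norm ?step_ge0 ?step_le1.
exact: (continuous_compf cf (@step_continuous R k)).
Qed.

Let bcont_sball k : bcont (sball k).
Proof.
apply: bcont_prod => b _; apply: (@bcont_step k (fun x => bnorm b x - a b)).
by apply: continuous_addf; [exact: bnorm_continuous|exact: continuous_cstf].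
Qed.

Let sball_cvg x : sball k x @[k --> \oo] --> bball x.
Proof. by apply: cvg_bigprod => b _; exact: step_cvg_ind. Qed.

Let sball_le1 k x : `|sball k x| <= 1.
Proof.
rewrite normr_prod; apply: prodr_ile1 => b _.
by rewrite normr_ge0 ger0_norm ?step_ge0 ?step_le1.
Qed.

Lemma bmeas_bball : bmeas (fun t : m.-tuple R => bball (tcol t)).
Proof.
split; last by exists 1 => t; have /andP[? ?] := bball01 (tcol t); rewrite ger0_norm.
apply: (measurable_fun_cvg (h := fun k t => sball k (tcol t))).
  by move=> k; have [] := bmeas_tcol (bcont_sball k).
by move=> t _; exact: sball_cvg.
Qed.

Lemma gaussE_sball_cvg (f : 'cV[R]_m -> R) : bcont f ->
  gaussE (fun t : m.-tuple R => f (tcol t) * sball k (tcol t)) @[k --> \oo] -->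
  gaussE (fun t : m.-tuple R => f (tcol t) * bball (tcol t)).
Proof.
move=> cf; have [_ [M fM]] := cf.
apply: (@gaussE_cvg _ _ _ _ M).
- move=> k; have [] // := bmeas_tcol (bcontM cf (bcont_sball k)).
- by move=> k t; rewrite normrM -[leRHS]mulr1 ler_pM.
- by move=> t; apply: cvgM; [exact: cvg_cst|exact: sball_cvg].
Qed.

Lemma gauss_char_blocks u w c : (forall b, bnorm b u = bnorm b w) ->
  gaussE (fun t : m.-tuple R => cosdot u c (tcol t) * bball (tcol t)) =
  gaussE (fun t : m.-tuple R => cosdot w c (tcol t) * bball (tcol t)).
Proof.
move=> uw; pose O := refl (u - w).
have E k : gaussE (fun t : m.-tuple R => cosdot u c (tcol t) * sball k (tcol t)) =
           gaussE (fun t : m.-tuple R => cosdot w c (tcol t) * sball k (tcol t)).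
  have cf := bcontM (bcont_cosdot u c) (bcont_sball k).
  rewrite -(gauss_rotation (A := O) _ cf) => [|s].
    congr gaussE; apply/funext => t; rewrite cosdot_mulmx refl_tr refl_swap//.
    by congr (_ * _); apply: eq_bigr => b _; rewrite bnorm_refl.
  by rewrite !sum_bnorm; apply: eq_bigr => b _; rewrite refl_tr bnorm_refl.
have cu := gaussE_sball_cvg (bcont_cosdot u c).
have cw := gaussE_sball_cvg (bcont_cosdot w c).
rewrite (funext E) in cu.
by have := cvg_unique _ cu cw; apply.
Qed.

Let rep i : 'I_m := odflt i [pick j | beta j == beta i].
Let can u : 'cV[R]_m := \col_i (if rep i == i then Num.sqrt (bnorm (beta i) u) else 0).

Let bnorm_can b u : bnorm b (can u) = bnorm b u.
Proof.
case: (pickP [pred j | beta j == b]) => [j0 /= bj0|nob]; last first.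
  by rewrite /bnorm !big_pred0.
pose r := rep j0.
have repE i : beta i == b -> rep i = r.
  move=> /eqP bi; rewrite /r /rep bi (eqP bj0).
  by case: pickP => [//|/(_ j0)]; rewrite /= bj0.
have br : beta r == b.
  rewrite /r /rep; case: pickP => [j /eqP ->|/(_ j0)]//; by rewrite /= eqxx.
have rr : rep r = r by exact: repE.
rewrite {1}/bnorm (bigD1 r)//= mxE rr eqxx (eqP br) sqr_sqrtr ?bnorm_ge0//.
rewrite big1 ?addr0// => i /andP[bi ir]; rewrite mxE repE// eq_sym (negbTE ir).
by rewrite expr0n.
Qed.

Lemma gauss_char_cvg (u_ : nat -> 'cV[R]_m) u c :
  (forall b, bnorm b (u_ k) @[k --> \oo] --> bnorm b u) ->
  gaussE (fun t : m.-tuple R => cosdot (u_ k) c (tcol t) * bball (tcol t)) @[k --> \oo] -->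
  gaussE (fun t : m.-tuple R => cosdot u c (tcol t) * bball (tcol t)).
Proof.
move=> uu; rewrite -(gauss_char_blocks (u := can u)); last by move=> b; exact: bnorm_can.
under eq_fun => k do
  rewrite -(@gauss_char_blocks (can (u_ k)) (u_ k) c (fun b => bnorm_can b (u_ k))).
apply: (@gaussE_cvg _ _ _ _ 1).
- move=> k; apply: measurable_funM; last by have [] := bmeas_bball.
  by have [] := bmeas_tcol (bcont_cosdot (can (u_ k)) c).
- move=> k t; rewrite normrM -[leRHS]mulr1 ler_pM//.
    by rewrite ler_norml cos_geN1 cos_le1.
  by have /andP[? ?] := bball01 (tcol t); rewrite ger0_norm.
move=> t; apply: cvgM; last exact: cvg_cst.
rewrite /cosdot.
have h : dotv (can (u_ k)) (tcol t) + c @[k --> \oo] --> dotv (can u) (tcol t) + c.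
  apply: cvgD; last exact: cvg_cst.
  apply: cvg_bigsum => i _; apply: cvgM; last exact: cvg_cst.
  rewrite mxE; under eq_fun do rewrite mxE.
  case: ifP => _; last exact: cvg_cst.
  exact: (cvg_comp _ _ (uu (beta i)) (@sqrt_continuous R _)).
exact: (cvg_comp _ _ h (@continuous_cos R _)).
Qed.

Hypothesis bball_gt0 : 0 < gaussE (fun t : m.-tuple R => bball (tcol t)).

Theorem gauss_image_cvg p (A_ : nat -> 'M[R]_(p, m)) (A : 'M[R]_(p, m)) (g : 'cV[R]_p -> R) :
  (forall v b, bnorm b ((A_ k)^T *m v) @[k --> \oo] --> bnorm b (A^T *m v)) -> bcont g ->
  gaussE (fun t => g (A_ k *m tcol t) * bball (tcol t)) / gaussE (fun t : m.-tuple R => bball (tcol t))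
  @[k --> \oo] -->
  gaussE (fun t => g (A *m tcol t) * bball (tcol t)) / gaussE (fun t : m.-tuple R => bball (tcol t)).
Proof.
move=> AA cg; pose Z := gaussE (fun t : m.-tuple R => bball (tcol t)).
have Z0 : 0 < Z by []; rewrite -/Z.
pose Ex (M : 'M[R]_(p, m)) (f : 'cV[R]_p -> R) := gaussE (fun t => f (M *m tcol t) * bball (tcol t)) / Z.
have eE M : expectation (Ex M).
  apply: expectation_gauss => //; first exact: bmeas_bball.
  by move=> t; have /andP[] := bball01 (tcol t).
apply: (levy_continuity (E_ := fun k => Ex (A_ k)) (E := Ex A)) => //; last first.
  move=> s c; rewrite /Ex; apply: cvgM; last exact: cvg_cst.
  have E M : gaussE (fun t => cosdot s c (M *m tcol t) * bball (tcol t)) =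
             gaussE (fun t => cosdot (M^T *m s) c (tcol t) * bball (tcol t)).
    by congr gaussE; apply/funext => t; rewrite cosdot_mulmx.
  by rewrite E; under eq_fun do rewrite E; exact: gauss_char_cvg.
move=> e e0.
pose N0 (M : 'M[R]_(p, m)) : R := \sum_j \sum_b bnorm b (M^T *m delta_mx j 0).
pose C := N0 A + 2.
have N0_ge0 M : 0 <= N0 M by apply: sumr_ge0 => j _; apply: sumr_ge0 => b _; exact: bnorm_ge0.
have entry M : N0 M <= N0 A + 1 -> forall i j, `|M i j| <= C.
  move=> NM i j; have : M i j ^+ 2 <= N0 M.
    rewrite /N0 (bigD1 i)//= -sum_bnorm (bigD1 j)//= -colE !mxE -addrA lerDl addr_ge0//.
      by apply: sumr_ge0 => *; exact: sqr_ge0.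
    by apply: sumr_ge0 => *; apply: sumr_ge0 => *; exact: bnorm_ge0.
  rewrite -[M i j ^+ 2]real_normK ?num_real// => h.
  have := normr_ge0 (M i j); have := N0_ge0 A; rewrite /C; move: (`|M i j|) h => y h ? ?.
  by rewrite leNgt; apply/negP => hy; nra.
have C0 : 0 <= C by rewrite /C; have := N0_ge0 A; lra.
have eZ : 0 < e * Z by rewrite mulr_gt0.
have [M M0 MP] := gauss_escape m p C0 eZ; exists M => //.
have H (A' : 'M[R]_(p, m)) : N0 A' <= N0 A + 1 -> Ex A' (escape M) <= e.
  move=> /entry/MP h; rewrite /Ex ler_pdivrMr// (le_trans _ h)//.
  have ce : bcont (fun x => escape M (A' *m x)) by apply: bcont_mulmx; exact: bcont_escape.
  apply: ler_gaussE; last 1 first.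
  - move=> t; have /andP[? ?] := bball01 (tcol t).
    by rewrite ler_piMr// escape_ge0.
  - by apply: bmeasM; [exact: (bmeas_tcol ce)|exact: bmeas_bball].
  - exact: (bmeas_tcol ce).
split; last by apply: H; rewrite lerDl.
have : N0 (A_ k) @[k --> \oo] --> N0 A.
  by apply: cvg_bigsum => j _; apply: cvg_bigsum => b _; exact: AA.
move=> /cvgrPdist_le/(_ 1 ltr01); apply: filterS => k hk; apply: H.
by move: hk; rewrite ler_norml => /andP[? ?]; lra.
Qed.

End Blocks.

(** * Orthogonalised contrasts of the tiers *)

Section SelectionMatrices.
Context {R : realType} (m : nat).
Implicit Types I J : {set 'I_m}.

Definition selmx I : 'M[R]_(#|I|, m) := \matrix_(i, f) (enum_val i == f)%:R.

Lemma selmxE I p (A : 'M[R]_(m, p)) i j : (selmx I *m A) i j = A (enum_val i) j.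
Proof.
rewrite mxE (bigD1 (enum_val i))//= mxE eqxx mul1r big1 ?addr0// => f fi.
by rewrite mxE eq_sym (negbTE fi) mul0r.
Qed.

Lemma mul_selmx_trE I p (A : 'M[R]_(p, m)) i j : (A *m (selmx I)^T) i j = A i (enum_val j).
Proof. by rewrite -[A]trmxK -trmx_mul mxE selmxE !mxE. Qed.

Lemma subvE I (v : 'cV[R]_m) : subv I v = selmx I *m v.
Proof. by apply/colP => i; rewrite selmxE mxE. Qed.

Lemma submE I J (A : 'M[R]_m) : subm I J A = selmx I *m A *m (selmx J)^T.
Proof. by apply/matrixP => i j; rewrite mul_selmx_trE selmxE mxE. Qed.

Lemma selmx_id I : selmx I *m (selmx I)^T = 1%:M.
Proof.
apply/matrixP => i j; rewrite mul_selmx_trE !mxE; congr ((nat_of_bool _)%:R).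
exact: (inj_eq enum_val_inj).
Qed.

Lemma selmx_disjoint I J : (forall f, f \in I -> f \notin J) -> selmx I *m (selmx J)^T = 0.
Proof.
move=> dIJ; apply/matrixP => i j; rewrite mul_selmx_trE !mxE.
case: eqP => // e; have := dIJ _ (enum_valP i).
by rewrite e enum_valP.
Qed.

Lemma selmx_sub I J : I \subset J -> selmx I *m (selmx J)^T *m selmx J = selmx I.
Proof.
move=> /fintype.subsetP IJ; apply/matrixP => i f.
have iJ := IJ _ (enum_valP i).
rewrite mxE (bigD1 (enum_rank_in iJ (enum_val i)))//= big1 ?addr0.
  by rewrite mul_selmx_trE !mxE enum_rankK_in// eqxx mul1r.
move=> j ji; rewrite mul_selmx_trE mxE; case: eqP; rewrite ?mul0r// => e.
by case/eqP: ji; rewrite -[LHS](enum_valK_in iJ) -e.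
Qed.

Lemma mul_selmx_tr0 I p (A : 'M[R]_(p, m)) :
  (forall i f, f \in I -> A i f = 0) -> A *m (selmx I)^T = 0.
Proof.
by move=> A0; apply/matrixP => i j; rewrite mul_selmx_trE A0 ?enum_valP// mxE.
Qed.

Lemma mul_selmx_tr0E I p (A : 'M[R]_(p, m)) : A *m (selmx I)^T = 0 ->
  forall i f, f \in I -> A i f = 0.
Proof.
move=> A0 i f fI; have := mul_selmx_trE A i (enum_rank_in fI f).
by rewrite A0 mxE enum_rankK_in.
Qed.

End SelectionMatrices.

Lemma col_formE (R : realType) p Q (A : 'M[R]_(p, Q)) (N : 'M[R]_p) q r :
  (A^T *m N *m A) q r = ((col q A)^T *m N *m col r A) 0 0.
Proof.
rewrite !mxE; apply: eq_bigr => i _; rewrite !mxE; congr (_ * _).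
by apply: eq_bigr => j _; rewrite !mxE.
Qed.

Section WeightedGram.
Context {R : realType} (Q : nat) (wt : 'I_Q -> R).
Hypothesis wt_gt0 : forall q, 0 < wt q.

Definition wdiag : 'M[R]_Q := diag_mx (\row_q wt q).

Lemma wdiag_tr : wdiag^T = wdiag. Proof. exact: tr_diag_mx. Qed.

Lemma mul_wdiagE p r (A : 'M[R]_(p, Q)) (B : 'M[R]_(r, Q)) i j :
  (A *m wdiag *m B^T) i j = \sum_q wt q * (A i q * B j q).
Proof.
rewrite mxE; apply: eq_bigr => q _; rewrite mul_mx_diag !mxE mulrAC.
by rewrite mulrC.
Qed.

Lemma gram_unit p (A : 'M[R]_(p, Q)) : (forall v : 'rV_p, v *m A = 0 -> v = 0) ->
  A *m wdiag *m A^T \in unitmx.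
Proof.
move=> Ainj; rewrite -row_free_unit; apply: inj_row_free => v vA.
apply: Ainj; apply/rowP => q; rewrite [RHS]mxE.
have /psumr_eq0P : \sum_q wt q * ((v *m A) 0 q * (v *m A) 0 q) = 0.
  rewrite -mul_wdiagE trmx_mul !mulmxA -(mulmxA v A) -(mulmxA v) vA mul0mx.
  by rewrite mxE.
move=> /(_ _ q isT)/eqP; rewrite mulf_eq0 gt_eqF//= mulf_eq0 orbb => h.
apply/eqP; apply: h => i _; apply: mulr_ge0; first exact: ltW.
by rewrite -expr2; exact: sqr_ge0.
Qed.

End WeightedGram.

Lemma mulmx_tr_scalarC (R : realType) m n (A : 'M[R]_(m, n)) (c : R) : m = n -> c != 0 ->
  A *m A^T = c%:M -> A^T *m A = c%:M.
Proof.
move=> e; subst n => c0 AA.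
have : A *m (c^-1 *: A^T) = 1%:M by rewrite -scalemxAr AA scale_scalar_mx mulVf.
move=> /mulmx1C; rewrite -scalemxAl => h.
by rewrite -[LHS]scale1r -(mulfV c0) -scalerA h scale_scalar_mx mulr1.
Qed.

Section Hadamard.
Context {R : realType} (K : nat).
Variables (iota : 'I_(2 ^ K) -> {ffun 'I_K -> bool}) (eff : 'I_(2 ^ K).-1 -> {set 'I_K}).
Hypothesis iota_bij : bijective iota.
Hypothesis eff_inj : injective eff.
Hypothesis eff_neq0 : forall f, eff f != finset.set0.
Local Notation Q := (2 ^ K)%N.
Local Notation F := (2 ^ K).-1.
Local Notation b := (@bvec R K iota eff).

Definition hmx : 'M[R]_(F, Q) := \matrix_(f, q) b q f 0.

Let sgn (x : bool) : R := if x then 1 else -1.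

Let sum_iota (g : 'I_K -> bool -> R) :
  \sum_q \prod_k g k (iota q k) = \prod_k (g k true + g k false).
Proof.
have -> : \prod_k (g k true + g k false) = \prod_k \sum_(x : bool) g k x.
  by apply: eq_bigr => k _; rewrite big_bool.
rewrite bigA_distr_bigA/=.
by rewrite [RHS](reindex iota)//; case: iota_bij => i iK Ki; exists i => x _.
Qed.

Let bE q f : b q f 0 = \prod_k (if k \in eff f then sgn (iota q k) else 1).
Proof. by rewrite mxE big_mkcond. Qed.

Lemma sum_bvec : \sum_q b q = 0.
Proof.
apply/colP => f; rewrite summxE [RHS]mxE.
under eq_bigr do rewrite bE.
rewrite (sum_iota (fun k x => if k \in eff f then sgn x else 1)).
have /set0Pn[k kf] := eff_neq0 f.
by rewrite (bigD1 k)//= kf /sgn addrN mul0r.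
Qed.

Lemma hmx1 : hmx *m const_mx 1 = 0 :> 'cV_F.
Proof.
rewrite -sum_bvec; apply/colP => f; rewrite mxE summxE.
by apply: eq_bigr => q _; rewrite !mxE mulr1.
Qed.

Lemma hmx_tr : hmx *m hmx^T = Q%:R%:M.
Proof.
apply/matrixP => f g; rewrite !mxE.
transitivity (\sum_q \prod_k ((if k \in eff f then sgn (iota q k) else 1) *
                              (if k \in eff g then sgn (iota q k) else 1))).
  by apply: eq_bigr => q _; rewrite !mxE -!/(b _ _ _) big_split/= -!big_mkcond.
rewrite (sum_iota (fun k x => (if k \in eff f then sgn x else 1) * (if k \in eff g then sgn x else 1))).
case: eqP => [<-|/eqP fg].
  rewrite (eq_bigr (fun=> 2)).
    by rewrite prodr_const card_ord mulr1n natrX.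
  by move=> k _; case: ifP => _; rewrite /sgn ?mulrNN !mulr1.
have : eff f != eff g by apply: contra fg => /eqP/eff_inj ->.
rewrite finset.eqEsubset negb_and => /orP[|] /fintype.subsetPn[k kin knot];
  by rewrite mulr0n (bigD1 k)//= kin (negbTE knot) /sgn ?mulr1 ?mul1r addrN mul0r.
Qed.

Let Q_neq0 : Q%:R != 0 :> R. Proof. by rewrite pnatr_eq0 expn_eq0. Qed.

Lemma hmx_inj p (v : 'M[R]_(p, F)) : v *m hmx = 0 -> v = 0.
Proof.
move=> vh; have : v *m (hmx *m hmx^T) = 0 by rewrite mulmxA vh mul0mx.
rewrite hmx_tr mul_mx_scalar => /eqP; rewrite scaler_eq0 (negbTE Q_neq0).
by move/eqP.
Qed.

Lemma tr_hmx : hmx^T *m hmx = Q%:R%:M - const_mx 1.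
Proof.
pose A : 'M[R]_(1 + F, Q) := col_mx (const_mx 1) hmx.
have AA : A *m A^T = Q%:R%:M.
  rewrite tr_col_mx mul_col_row hmx_tr.
  have -> : hmx *m (const_mx 1)^T = 0 :> 'cV_F by rewrite trmx_const hmx1.
  have -> : (const_mx 1 : 'rV[R]_Q) *m hmx^T = 0 by rewrite -[const_mx 1]trmxK -trmx_mul trmx_const hmx1 trmx0.
  rewrite [RHS]scalar_mx_block; congr block_mx.
  by apply/matrixP => i j; rewrite !ord1 !mxE (eq_bigr (fun=> 1)) ?sumr_const ?card_ord// => q _; rewrite !mxE mulr1.
have e : (1 + F)%N = Q by rewrite add1n prednK// expn_gt0.
have := mulmx_tr_scalarC e Q_neq0 AA.
rewrite tr_col_mx mul_row_col => <-.
rewrite (_ : (const_mx 1)^T *m _ = const_mx 1); first by rewrite [const_mx 1 + _]addrC addrK.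
by apply/matrixP => i j; rewrite !mxE big_ord1 !mxE mulr1.
Qed.

Section Tiers.
Variables (H : nat) (tier : 'I_F -> 'I_H) (wt : 'I_Q -> R).
Hypothesis wt_gt0 : forall q, 0 < wt q.
Local Notation FT := (Ftier tier).
Local Notation FB := (Fbefore tier).

Definition Bw : 'M[R]_F := \sum_q wt q *: (b q *m (b q)^T).

Definition cw (h : 'I_H) (q : 'I_Q) : 'cV[R]_#|FT h| :=
  subv (FT h) (b q) - subm (FT h) (FB h) Bw *m invmx (subm (FB h) (FB h) Bw)
      *m subv (FB h) (b q).

Definition Kw (h : 'I_H) : 'M[R]_#|FT h| := \sum_q wt q *: (cw h q *m (cw h q)^T).

Local Notation W := (wdiag wt).
Let S I := @selmx R F I.
Let coef h := subm (FT h) (FB h) Bw *m invmx (subm (FB h) (FB h) Bw).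
Let C h : 'M[R]_(#|FT h|, Q) := (S (FT h) - coef h *m S (FB h)) *m hmx.

Let BwE : Bw = hmx *m W *m hmx^T.
Proof.
apply/matrixP => f g; rewrite mul_wdiagE summxE; apply: eq_bigr => q _.
by rewrite !mxE big_ord1 !mxE.
Qed.

Let col_hmx q : b q = col q hmx.
Proof. by apply/colP => f; rewrite !mxE. Qed.

Let CE h q : cw h q = col q (C h).
Proof.
by rewrite /cw /C /coef !subvE col_hmx !colE !mulmxBl !mulmxA.
Qed.

Let KE h : Kw h = C h *m W *m (C h)^T.
Proof.
apply/matrixP => i j; rewrite mul_wdiagE summxE; apply: eq_bigr => q _.
by rewrite mxE CE mxE big_ord1 !mxE.
Qed.

Lemma subm_Bw_unit I : subm I I Bw \in unitmx.
Proof.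
rewrite submE BwE -/(S I) !mulmxA.
have -> : S I *m hmx *m W *m hmx^T *m (S I)^T = (S I *m hmx) *m W *m (S I *m hmx)^T.
  by rewrite trmx_mul !mulmxA.
apply: gram_unit => // v; rewrite mulmxA => /hmx_inj vS.
by rewrite -[v]mulmx1 -(selmx_id I) mulmxA vS mul0mx.
Qed.

Let disj h f : f \in FB h -> f \notin FT h.
Proof.
rewrite !inE => lt; by apply: contraL lt => /eqP ->; rewrite ltnn.
Qed.

Lemma Kw_unit h : Kw h \in unitmx.
Proof.
rewrite KE; apply: gram_unit => // v; rewrite mulmxA => /hmx_inj vS.
have := congr1 (fun A => A *m (S (FT h))^T) vS.
rewrite mul0mx mulmxBr mulmxBl mulmxA -(mulmxA v) selmx_id mulmx1.
rewrite -(mulmxA (v *m coef h)) selmx_disjoint ?mulmx0 ?subr0//.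
exact: disj.
Qed.

Lemma sum_cw h : \sum_q cw h q = 0.
Proof.
transitivity (C h *m const_mx 1 : 'cV_#|FT h|).
  apply/colP => j; rewrite summxE mxE; apply: eq_bigr => q _.
  by rewrite CE !mxE mulr1.
by rewrite -mulmxA hmx1 mulmx0.
Qed.

Let C1 h : C h *m const_mx 1 = 0 :> 'cV_#|FT h|.
Proof. by rewrite -mulmxA hmx1 mulmx0. Qed.

Let C_before h : C h *m W *m hmx^T *m (S (FB h))^T = 0.
Proof.
have -> : C h *m W *m hmx^T *m (S (FB h))^T = S (FT h) *m Bw *m (S (FB h))^T
    - coef h *m (S (FB h) *m Bw *m (S (FB h))^T).
  by rewrite /C BwE !mulmxBl !mulmxA.
by rewrite -!submE /coef mulmxKV ?subm_Bw_unit// subrr.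
Qed.

Let C_lt h (I : {set 'I_F}) : I \subset FB h -> C h *m W *m hmx^T *m (S I)^T = 0.
Proof.
move=> IB; rewrite /S -(selmx_sub IB) !trmx_mul trmxK !mulmxA.
by rewrite C_before !mul0mx.
Qed.

Let orth_lt (h l : 'I_H) : (l < h)%N -> C h *m W *m (C l)^T = 0.
Proof.
move=> lh; rewrite /C trmx_mul mulmxA.
have -> : (S (FT l) - coef l *m S (FB l))^T = (S (FT l))^T - (S (FB l))^T *m (coef l)^T.
  by rewrite linearB/= trmx_mul.
rewrite mulmxBr mulmxA -/(C h) !C_lt ?mul0mx ?subrr//.
- by apply/fintype.subsetP => f; rewrite !inE => /ltn_trans; apply.
- by apply/fintype.subsetP => f; rewrite !inE => /eqP ->.
Qed.

Let orth (h l : 'I_H) : h != l -> C h *m W *m (C l)^T = 0.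
Proof.
rewrite neq_ltn => /orP[lt|lt]; last exact: orth_lt.
by have := congr1 trmx (orth_lt lt); rewrite trmx0 (trmx_mul (C l *m W)) (trmx_mul (C l)) trmxK wdiag_tr mulmxA.
Qed.

Lemma cw_orth (h l : 'I_H) : h != l -> \sum_q wt q *: (cw h q *m (cw l q)^T) = 0.
Proof.
move=> hl; transitivity (C h *m W *m (C l)^T); last exact: orth.
apply/matrixP => i j.
rewrite mul_wdiagE summxE; apply: eq_bigr => q _.
by rewrite mxE !CE mxE big_ord1 !mxE.
Qed.

(* Together with the constant direction, the orthogonalised contrasts of all
   tiers form an orthogonal basis of R^Q, which is what makes the tier-wise
   explained variances add up. *)
Lemma tier_complete : \sum_q (wt q)^-1 = 1 -> forall q r,
  \sum_h wt q * wt r * ((cw h q)^T *m invmx (Kw h) *m cw h r) 0 0 =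
  wt q *+ (q == r) - 1.
Proof.
move=> wt1 q r.
pose E : 'M[R]_Q := W - const_mx 1 - \sum_h W *m (C h)^T *m invmx (Kw h) *m C h *m W.
suff E0 : E = 0.
  have WMW (M : 'M[R]_(Q, Q)) : (W *m M *m W) q r = wt q * wt r * M q r.
    by rewrite mul_mx_diag mul_diag_mx !mxE mulrAC.
  have := congr1 (fun A : 'M[R]_(Q, Q) => A q r) E0; rewrite [RHS]mxE => /eqP.
  rewrite [X in X == _]mxE [X in _ + X == _]mxE subr_eq0 => /eqP.
  rewrite (_ : (W - const_mx 1) q r = wt q *+ (q == r) - 1) => [->|]; last by rewrite !mxE.
  rewrite summxE; apply: eq_bigr => h _.
  have -> : W *m (C h)^T *m invmx (Kw h) *m C h *m W = W *m ((C h)^T *m invmx (Kw h) *m C h) *m W.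
    by rewrite !mulmxA.
  by rewrite WMW !CE -col_formE.
have E1 : E *m (\col_q (wt q)^-1) = 0.
  rewrite /E !mulmxBl mulmx_suml.
  have W1 : W *m (\col_q (wt q)^-1) = const_mx 1.
    by apply/colP => i; rewrite mul_diag_mx !mxE mulfV ?gt_eqF.
  have J1 : const_mx 1 *m (\col_q (wt q)^-1) = const_mx 1 :> 'cV_Q.
    apply/colP => i; transitivity (\sum_q (wt q)^-1); last by rewrite wt1 mxE.
    by rewrite mxE; apply: eq_bigr => j _; rewrite !mxE mul1r.
  rewrite W1 J1 subrr sub0r big1 ?oppr0// => h _.
  by rewrite -(mulmxA _ W) W1 -(mulmxA _ (C h)) C1 mulmx0.
have EC l : E *m (C l)^T = 0.
  rewrite /E !mulmxBl mulmx_suml.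
  have -> : (const_mx 1 : 'M[R]_(Q, Q)) *m (C l)^T = 0.
    apply/matrixP => i j.
    transitivity ((C l *m const_mx 1 : 'cV_#|FT l|) j 0); last by rewrite C1 !mxE.
    by rewrite !mxE; apply: eq_bigr => k _; rewrite !mxE mulrC.
  rewrite subr0 (bigD1 l)//= big1 => [|h hl]; last first.
    by rewrite -(mulmxA _ W) -(mulmxA _ (C h)) (mulmxA (C h)) orth// mulmx0.
  rewrite addr0 -(mulmxA _ W (C l)^T) -(mulmxA _ (C l)) (mulmxA (C l)) -KE.
  by rewrite -(mulmxA _ (invmx (Kw l))) mulVmx ?Kw_unit// mulmx1 subrr.
have EB f : forall i, (E *m hmx^T) i f = 0.
  have [n] := ubnP (tier f); elim: n => // n IH in f *; rewrite ltnS => tn.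
  pose h := tier f.
  have EFB : E *m hmx^T *m (S (FB h))^T = 0.
    apply: mul_selmx_tr0 => i g; rewrite inE => gh; apply: IH.
    exact: leq_trans gh tn.
  have EFT : E *m hmx^T *m (S (FT h))^T = 0.
    have := EC h; rewrite /C trmx_mul linearB/= trmx_mul mulmxA mulmxBr.
    by rewrite (mulmxA _ (S (FB h))^T) EFB mul0mx subr0.
  by move=> i; apply: (mul_selmx_tr0E EFT); rewrite inE.
have EB0 : E *m hmx^T = 0 by apply/matrixP => i f; rewrite EB mxE.
have := congr1 (fun A => A *m hmx) EB0; rewrite mul0mx -mulmxA tr_hmx mulmxBr.
rewrite mul_mx_scalar => /eqP; rewrite subr_eq0 => /eqP QE.
clearbody E; pose e i : R := Q%:R^-1 * \sum_j E i j.
have Ee i j : E i j = e i.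
  have := congr1 (fun A : 'M[R]_(Q, Q) => A i j) QE; rewrite !mxE => h.
  rewrite /e (_ : \sum_j0 _ = Q%:R * E i j) ?mulKf// h.
  by apply: eq_bigr => k _; rewrite !mxE mulr1.
apply/matrixP => i j; rewrite [RHS]mxE Ee.
have := congr1 (fun A : 'M[R]_(Q, 1) => A i 0) E1; rewrite !mxE => <-.
rewrite -[LHS]mulr1 -wt1 mulr_sumr; apply: eq_bigr => k _.
by rewrite Ee mxE.
Qed.

End Tiers.
End Hadamard.

Section Vectorisation.
Context {R : realType} (m L : nat).
Implicit Types U V : 'M[R]_(m, L).

Definition vmx U : 'cV[R]_(m * L) := \col_k U (mxtens_unindex k).1 (mxtens_unindex k).2.
Definition umx (u : 'cV[R]_(m * L)) : 'M[R]_(m, L) := \matrix_(i, j) u (mxtens_index (i, j)) 0.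

Lemma umxK u : vmx (umx u) = u.
Proof. by apply/colP => k; rewrite !mxE -surjective_pairing mxtens_unindexK. Qed.

Lemma vmxE U i j : vmx U (mxtens_index (i, j)) 0 = U i j.
Proof. by rewrite mxE mxtens_indexK. Qed.

Lemma sum_mxtens (f : 'I_(m * L) -> R) :
  \sum_k f k = \sum_i \sum_j f (mxtens_index (i, j)).
Proof.
rewrite pair_bigA/= (reindex (@mxtens_index m L)); last first.
  by exists (@mxtens_unindex m L) => k _; [exact: mxtens_indexK|exact: mxtens_unindexK].
by apply: eq_bigr => -[].
Qed.

Lemma vmxD U V : vmx (U + V) = vmx U + vmx V.
Proof. by apply/colP => k; rewrite !mxE. Qed.

Lemma vmxZ (c : R) U : vmx (c *: U) = c *: vmx U.
Proof. by apply/colP => k; rewrite !mxE. Qed.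

Lemma tensmx_vmx p r (A : 'M[R]_(p, m)) (B : 'M[R]_(r, L)) U :
  (A *t B) *m vmx U = \col_k (A *m U *m B^T) (mxtens_unindex k).1 (mxtens_unindex k).2.
Proof.
apply/colP => k; rewrite !mxE sum_mxtens exchange_big/=; apply: eq_bigr => j _.
rewrite !mxE mulr_suml; apply: eq_bigr => i _.
by rewrite vmxE !mxE mxtens_indexK/= mulrAC.
Qed.

Lemma vmx_dot U V : ((vmx U)^T *m vmx V) 0 0 = \tr (U^T *m V).
Proof.
rewrite mxE sum_mxtens exchange_big/=; apply: eq_bigr => j _; rewrite !mxE.
by apply: eq_bigr => i _; rewrite [X in X * _]mxE !vmxE mxE.
Qed.

Lemma vmx_tens (c : 'cV[R]_m) (z : 'cV[R]_L) : vmx (c *m z^T) = c *t z.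
Proof. by apply/colP => k; rewrite !mxE big_ord1 !mxE !ord1. Qed.

End Vectorisation.

Lemma tensmx11 (R : realType) m p : (1%:M : 'M[R]_m) *t (1%:M : 'M[R]_p) = 1%:M.
Proof.
apply/matrixP => i j; rewrite !mxE -natrM mulnb; congr ((nat_of_bool _)%:R).
rewrite -(inj_eq (can_inj (@mxtens_unindexK m p))).
by rewrite [in RHS](surjective_pairing (mxtens_unindex i)) [in RHS](surjective_pairing (mxtens_unindex j)) xpair_eqE.
Qed.

Lemma mx11_mulC (R : realType) m (u v : 'rV[R]_m) (S : 'M[R]_m) : S^T = S ->
  (u *m S *m v^T) 0 0 = (v *m S *m u^T) 0 0.
Proof.
move=> symS; have <- : (u *m S *m v^T)^T = v *m S *m u^T.
  by rewrite !trmx_mul trmxK symS mulmxA.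
by rewrite [RHS]mxE.
Qed.

Section VarianceSplit.
Context {R : realType} (K : nat).
Variables (iota : 'I_(2 ^ K) -> {ffun 'I_K -> bool}) (eff : 'I_(2 ^ K).-1 -> {set 'I_K}).
Local Notation Q := (2 ^ K)%N.
Local Notation F := (2 ^ K).-1.
Local Notation b := (@bvec R K iota eff).
Local Notation c2 := (@c2 R K).
Variables (H : nat) (tier : 'I_F -> 'I_H) (wt : 'I_Q -> R) (L : nat).
Variables (Sy : 'I_Q -> 'I_Q -> R) (Sx : 'M[R]_L) (Sc : 'I_Q -> 'rV[R]_L).
Local Notation FT := (Ftier tier).
Local Notation cw := (@cw R K iota eff H tier wt).
Local Notation Kw := (@Kw R K iota eff H tier wt).

Definition ycoef (v : 'cV[R]_F) q : R := c2 * (v^T *m b q) 0 0.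
Definition xcoef (U : forall h, 'M[R]_(#|FT h|, L)) q : 'rV[R]_L :=
  c2 *: \sum_h (cw h q)^T *m U h.
Definition gker q r : R := wt q *+ (q == r) - 1.
Definition Sres q r : R := Sy q r - (Sc q *m invmx Sx *m (Sc r)^T) 0 0.
Definition Vres : 'M[R]_F :=
  c2 ^+ 2 *: \sum_q \sum_r (gker q r * Sres q r) *: (b q *m (b r)^T).
Definition Wtw (h : 'I_H) : 'M[R]_(F, #|FT h| * L) :=
  castmx (muln1 F, erefl)
    (c2 ^+ 2 *: \sum_q wt q *: ((b q *m (cw h q)^T) *t Sc q)).
Definition Wxw (h : 'I_H) : 'M[R]_(#|FT h| * L, #|FT h| * L) :=
  c2 ^+ 2 *: \sum_q wt q *: ((cw h q *m (cw h q)^T) *t Sx).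

Definition pairvar v U q r : R :=
  ycoef v q * ycoef v r * Sy q r + ycoef v q * (Sc q *m (xcoef U r)^T) 0 0
  + ycoef v r * (Sc r *m (xcoef U q)^T) 0 0 + (xcoef U q *m Sx *m (xcoef U r)^T) 0 0.
Definition totvar v U : R := \sum_q \sum_r gker q r * pairvar v U q r.
Definition projv v U h : 'cV[R]_(#|FT h| * L) :=
  (Wtw h)^T *m v + Wxw h *m vmx (U h).

Hypothesis iota_bij : bijective iota.
Hypothesis eff_inj : injective eff.
Hypothesis eff_neq0 : forall f, eff f != finset.set0.
Hypothesis wt_gt0 : forall q, 0 < wt q.
Hypothesis symSx : Sx^T = Sx.
Hypothesis Sx_unit : Sx \in unitmx.

Lemma c2_neq0 : c2 != 0.
Proof. by rewrite invr_neq0// pnatr_eq0 expn_eq0. Qed.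

Lemma WxwE h : Wxw h = c2 ^+ 2 *: (Kw h *t Sx).
Proof.
congr (_ *: _); apply/matrixP => i j; rewrite [RHS]mxE !summxE mulr_suml.
by apply: eq_bigr => q _; rewrite !mxE mulrA.
Qed.

Lemma Wxw_unit h : Wxw h \in unitmx.
Proof.
rewrite WxwE unitmxZ ?unitfE ?expf_eq0 ?c2_neq0//.
have/mulmx1_unit[//] : (Kw h *t Sx) *m (invmx (Kw h) *t invmx Sx) = 1%:M.
by rewrite tensmx_mul !mulmxV ?Kw_unit// tensmx11.
Qed.

Lemma Wtw_trmul v h :
  (Wtw h)^T *m v = vmx (c2 *: \sum_q (wt q * ycoef v q) *: (cw h q *m Sc q)).
Proof.
apply/colP => k.
have -> : vmx (c2 *: \sum_q (wt q * ycoef v q) *: (cw h q *m Sc q)) k 0 =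
    c2 * \sum_q (wt q * ycoef v q) * (cw h q (mxtens_unindex k).1 0 * Sc q 0 (mxtens_unindex k).2).
  rewrite !mxE summxE; congr (_ * _); apply: eq_bigr => q _.
  by rewrite mxE; congr (_ * _); rewrite mxE big_ord1.
rewrite mxE.
have E f : (Wtw h)^T k f = c2 ^+ 2 * \sum_q wt q *
    (b q f 0 * cw h q (mxtens_unindex k).1 0 * Sc q 0 (mxtens_unindex k).2).
  rewrite mxE castmxE/= cast_ord_id mxE summxE; congr (_ * _).
  apply: eq_bigr => q _; rewrite 2!mxE; congr (_ * _).
  rewrite !ord1; congr (_ * _).
  have -> : (mxtens_unindex (cast_ord (esym (muln1 F)) f)).1 = f.
    by apply: val_inj; rewrite /= divn1.
  by rewrite mxE big_ord1 [X in _ * X]mxE.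
under eq_bigr do rewrite E.
transitivity (c2 * \sum_q wt q * (c2 * \sum_f v f 0 * b q f 0) *
   (cw h q (mxtens_unindex k).1 0 * Sc q 0 (mxtens_unindex k).2)); last first.
  congr (_ * _); apply: eq_bigr => q _; congr (_ * _ * _).
  rewrite /ycoef; congr (_ * _); rewrite [RHS]mxE; apply: eq_bigr => f _.
  by rewrite [X in _ = X * _]mxE.
rewrite mulr_sumr; under eq_bigr do rewrite -mulrA mulr_suml mulr_sumr.
rewrite exchange_big/=; apply: eq_bigr => q _.
rewrite -mulrA (mulrCA (wt q)) !mulr_sumr; rewrite mulr_suml !mulr_sumr.
by apply: eq_bigr => f _; ring.
Qed.

Let gam v U q : 'rV[R]_L := ycoef v q *: (Sc q *m invmx Sx) + xcoef U q.

Let gamS v U q : gam v U q *m Sx = ycoef v q *: Sc q + xcoef U q *m Sx.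
Proof. by rewrite mulmxDl -scalemxAl mulmxKV. Qed.

Let sum_cw_xcoef U h : \sum_q wt q *: (cw h q *m xcoef U q) = c2 *: (Kw h *m U h).
Proof.
transitivity (c2 *: \sum_l (\sum_q wt q *: (cw h q *m (cw l q)^T)) *m U l).
  rewrite scaler_sumr; under [RHS]eq_bigr do rewrite mulmx_suml scaler_sumr.
  rewrite exchange_big/=; apply: eq_bigr => q _.
  rewrite /xcoef -scalemxAr scalerA mulrC -scalerA mulmx_sumr !scaler_sumr.
  by apply: eq_bigr => l _; rewrite -scalemxAl mulmxA.
congr (_ *: _); rewrite (bigD1 h)//= [X in _ + X]big1 ?addr0// => l lh.
by rewrite cw_orth ?mul0mx// eq_sym.
Qed.

Let projvE v U h : projv v U h = vmx (c2 *: \sum_q wt q *: (cw h q *m (gam v U q *m Sx))).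
Proof.
rewrite /projv Wtw_trmul WxwE -scalemxAl tensmx_vmx -/(vmx _) -vmxZ -vmxD symSx.
congr vmx; rewrite expr2 -scalerA -scalerDr; congr (_ *: _).
rewrite scalemxAl -sum_cw_xcoef mulmx_suml -big_split/=; apply: eq_bigr => q _.
rewrite gamS mulmxDr scalerDr; congr (_ + _).
  by rewrite -scalemxAr scalerA.
by rewrite -scalemxAl mulmxA.
Qed.

Let quad_projv v U h : ((projv v U h)^T *m invmx (Wxw h) *m projv v U h) 0 0 =
  \sum_q \sum_r wt q * wt r * ((cw h q)^T *m invmx (Kw h) *m cw h r) 0 0 *
     (gam v U q *m Sx *m (gam v U r)^T) 0 0.
Proof.
pose M := \sum_q wt q *: (cw h q *m (gam v U q *m Sx)).
pose N := \sum_q wt q *: (cw h q *m gam v U q).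
have MN : M = N *m Sx.
  by rewrite mulmx_suml; apply: eq_bigr => q _; rewrite -scalemxAl mulmxA.
have yz : projv v U h = Wxw h *m vmx (c2^-1 *: (invmx (Kw h) *m N)).
  rewrite projvE -/M WxwE -scalemxAl tensmx_vmx -/(vmx _) -vmxZ symSx.
  congr vmx; rewrite -scalemxAr -scalemxAl scalerA expr2 -mulrA mulfV ?c2_neq0// mulr1.
  by rewrite mulmxA mulmxV ?Kw_unit// mul1mx MN.
rewrite -mulmxA {2}yz mulKmx ?Wxw_unit// projvE -/M vmx_dot.
rewrite [(c2 *: _)^T]linearZ/= -scalemxAl -scalemxAr scalerA mulfV ?c2_neq0// scale1r.
rewrite /M linear_sum/= mulmx_suml linear_sum/=; apply: eq_bigr => q _.
rewrite /N !mulmx_sumr linear_sum/=; apply: eq_bigr => r _.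
rewrite linearZ/= -!scalemxAr -scalemxAl linearZ/= linearZ/= -!mulrA mulrCA.
congr (_ * (_ * _)); rewrite trmx_mul.
have -> : (gam v U q *m Sx)^T *m (cw h q)^T *m (invmx (Kw h) *m (cw h r *m gam v U r)) =
   (gam v U q *m Sx)^T *m (((cw h q)^T *m invmx (Kw h) *m cw h r) *m gam v U r).
  by rewrite !mulmxA.
rewrite [(cw h q)^T *m _ *m _]mx11_scalar mul_scalar_mx -scalemxAr linearZ/=; congr (_ * _).
  by rewrite [RHS]mxE.
rewrite mxtrace_mulC /mxtrace big_ord1 trmx_mul symSx mulmxA.
exact: mx11_mulC.
Qed.

Let pairvarE v U q r : pairvar v U q r =
  ycoef v q * ycoef v r * Sres q r + (gam v U q *m Sx *m (gam v U r)^T) 0 0.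
Proof.
have e1 : (gam v U q *m Sx *m (gam v U r)^T) 0 0 =
    ycoef v q * (ycoef v r * (Sc q *m invmx Sx *m (Sc r)^T) 0 0)
    + ycoef v q * (Sc q *m (xcoef U r)^T) 0 0
    + (ycoef v r * (Sc r *m (xcoef U q)^T) 0 0 + (xcoef U q *m Sx *m (xcoef U r)^T) 0 0).
  rewrite gamS /gam; move: (xcoef U q) (xcoef U r) => X1 X2.
  rewrite mulmxDl linearD/= linearZ/= trmx_mul trmx_inv symSx !mulmxDr.
  rewrite -!scalemxAl -!scalemxAr.
  rewrite [LHS]mxE [X in X + _ = _]mxE [X in _ + X = _]mxE; congr (_ + _ + (_ + _)).
  - by rewrite mxE [X in _ * X]mxE mulmxA.
  - by rewrite mxE.
  - rewrite mxE mulmxA mulmxK//; congr (_ * _).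
    have := mx11_mulC X1 (Sc r) (trmx1 R L).
    by rewrite !mulmx1.
by rewrite e1 /pairvar /Sres; ring.
Qed.

Lemma Vres_quad v : (v^T *m Vres *m v) 0 0 =
  \sum_q \sum_r gker q r * (ycoef v q * ycoef v r * Sres q r).
Proof.
rewrite /Vres -scalemxAr -scalemxAl mxE mulmx_sumr mulmx_suml summxE mulr_sumr.
apply: eq_bigr => q _; rewrite mulmx_sumr mulmx_suml summxE mulr_sumr.
apply: eq_bigr => r _; rewrite -scalemxAr -scalemxAl mxE.
have -> : (v^T *m (b q *m (b r)^T) *m v) 0 0 = (v^T *m b q) 0 0 * (v^T *m b r) 0 0.
  have -> : v^T *m (b q *m (b r)^T) *m v = (v^T *m b q) *m ((b r)^T *m v) by rewrite !mulmxA.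
  rewrite mxE big_ord1; congr (_ * _).
  by rewrite -[(b r)^T *m v]trmxK trmx_mul trmxK mxE.
by rewrite /ycoef; ring.
Qed.

(* The covariate part of the variance is diagonalised by the tiers, because
   [gker] is the reproducing kernel of the orthogonalised contrasts. *)
Lemma totvar_split v U : \sum_q (wt q)^-1 = 1 ->
  totvar v U = (v^T *m Vres *m v) 0 0 +
    \sum_h ((projv v U h)^T *m invmx (Wxw h) *m projv v U h) 0 0.
Proof.
move=> wt1; rewrite Vres_quad.
under [X in _ + X]eq_bigr do rewrite quad_projv.
rewrite [X in _ + X]exchange_big/= -big_split/=; apply: eq_bigr => q _.
rewrite [X in _ + X]exchange_big/= -big_split/=; apply: eq_bigr => r _.
rewrite -mulr_suml tier_complete// -/(gker q r).
by rewrite pairvarE mulrDr.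
Qed.

End VarianceSplit.

Section MatrixLimits.
Context {R : realType}.

Definition mcvg m n (A_ : nat -> 'M[R]_(m, n)) (A : 'M[R]_(m, n)) :=
  forall i j, A_ k i j @[k --> \oo] --> A i j.

Lemma cvg_eqP (u w : nat -> R) (l l' : R) : (forall k, w k = u k) -> l' = l ->
  u k @[k --> \oo] --> l -> w k @[k --> \oo] --> l'.
Proof. by move=> uw -> ul; rewrite (_ : w = u)//; apply/funext. Qed.

Lemma mcvg_cst m n (A : 'M[R]_(m, n)) : mcvg (fun=> A) A.
Proof. by move=> i j; exact: cvg_cst. Qed.

Lemma mcvgZ m n c_ (c : R) A_ (A : 'M[R]_(m, n)) : c_ k @[k --> \oo] --> c ->
  mcvg A_ A -> mcvg (fun k => c_ k *: A_ k) (c *: A).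
Proof.
move=> cc cA i j.
apply: (@cvg_eqP (fun k => c_ k * A_ k i j) _ (c * A i j)).
- by move=> k; rewrite mxE.
- by rewrite mxE.
- by apply: cvgM; [exact: cc|exact: cA].
Qed.

Lemma mcvgB m n A_ A B_ (B : 'M[R]_(m, n)) : mcvg A_ A -> mcvg B_ B ->
  mcvg (fun k => A_ k - B_ k) (A - B).
Proof.
move=> cA cB i j.
apply: (@cvg_eqP (fun k => A_ k i j - B_ k i j) _ (A i j - B i j)).
- by move=> k; rewrite !mxE.
- by rewrite !mxE.
- by apply: cvgB; [exact: cA|exact: cB].
Qed.

Lemma mcvg_sum m n (I : finType) (A_ : I -> nat -> 'M[R]_(m, n)) A :
  (forall i, mcvg (A_ i) (A i)) -> mcvg (fun k => \sum_i A_ i k) (\sum_i A i).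
Proof.
move=> cA i j.
apply: (@cvg_eqP (fun k => \sum_l A_ l k i j) _ (\sum_l A l i j)).
- by move=> k; rewrite summxE.
- by rewrite summxE.
- by apply: cvg_bigsum => l _; exact: cA.
Qed.

Lemma mcvg_mul m n p A_ (A : 'M[R]_(m, n)) B_ (B : 'M[R]_(n, p)) :
  mcvg A_ A -> mcvg B_ B -> mcvg (fun k => A_ k *m B_ k) (A *m B).
Proof.
move=> cA cB i j.
apply: (@cvg_eqP (fun k => \sum_l A_ k i l * B_ k l j) _ (\sum_l A i l * B l j)).
- by move=> k; rewrite mxE.
- by rewrite mxE.
- by apply: cvg_bigsum => l _; apply: cvgM; [exact: cA|exact: cB].
Qed.

Lemma mcvg_tr m n A_ (A : 'M[R]_(m, n)) : mcvg A_ A -> mcvg (fun k => (A_ k)^T) A^T.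
Proof.
move=> cA i j; apply: (@cvg_eqP (fun k => A_ k j i) _ (A j i)).
- by move=> k; rewrite mxE.
- by rewrite mxE.
- exact: cA.
Qed.

Lemma mcvg_tens m n p q A_ (A : 'M[R]_(m, n)) B_ (B : 'M[R]_(p, q)) :
  mcvg A_ A -> mcvg B_ B -> mcvg (fun k => A_ k *t B_ k) (A *t B).
Proof.
move=> cA cB i j.
pose i' := mxtens_unindex i; pose j' := mxtens_unindex j.
apply: (@cvg_eqP (fun k => A_ k i'.1 j'.1 * B_ k i'.2 j'.2) _ (A i'.1 j'.1 * B i'.2 j'.2)).
- by move=> k; rewrite mxE.
- by rewrite mxE.
- by apply: cvgM; [exact: cA|exact: cB].
Qed.

Lemma mcvg_cast m n m' n' (e : (m = m') * (n = n')) A_ (A : 'M[R]_(m, n)) :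
  mcvg A_ A -> mcvg (fun k => castmx e (A_ k)) (castmx e A).
Proof. by case: e => e1 e2; subst m' n' => cA i j; exact: cA. Qed.

Lemma mcvg_det n A_ (A : 'M[R]_n) : mcvg A_ A -> \det (A_ k) @[k --> \oo] --> \det A.
Proof.
move=> cA; apply: cvg_bigsum => s _; apply: cvgM; first exact: cvg_cst.
by apply: cvg_bigprod => i _; exact: cA.
Qed.

Lemma mcvg_inv n A_ (A : 'M[R]_n) : mcvg A_ A -> (forall k, A_ k \in unitmx) ->
  A \in unitmx -> mcvg (fun k => invmx (A_ k)) (invmx A).
Proof.
move=> cA uA_ uA i j.
apply: (@cvg_eqP (fun k => (\det (A_ k))^-1 * cofactor (A_ k) j i) _ ((\det A)^-1 * cofactor A j i)).
- by move=> k; rewrite /invmx uA_ !mxE.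
- by rewrite /invmx uA !mxE.
apply: cvgM.
  by apply: cvgV; [move: uA; rewrite unitmxE unitfE|exact: mcvg_det].
apply: cvgM; first exact: cvg_cst.
apply: mcvg_det => a b.
apply: (@cvg_eqP (fun k => A_ k (lift j a) (lift i b)) _ (A (lift j a) (lift i b))).
- by move=> k; rewrite !mxE.
- by rewrite !mxE.
- exact: cA.
Qed.

Lemma mcvg_subm m (I J : {set 'I_m}) A_ (A : 'M[R]_m) : mcvg A_ A ->
  mcvg (fun k => subm I J (A_ k)) (subm I J A).
Proof.
move=> cA i j.
apply: (@cvg_eqP (fun k => A_ k (enum_val i) (enum_val j)) _ (A (enum_val i) (enum_val j))).
- by move=> k; rewrite mxE.
- by rewrite mxE.
- exact: cA.
Qed.

End MatrixLimits.

Section VarianceLimits.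
Context {R : realType} (K : nat).
Variables (iota : 'I_(2 ^ K) -> {ffun 'I_K -> bool}) (eff : 'I_(2 ^ K).-1 -> {set 'I_K}).
Local Notation Q := (2 ^ K)%N.
Local Notation F := (2 ^ K).-1.
Local Notation b := (@bvec R K iota eff).
Local Notation c2 := (@c2 R K).
Variables (H : nat) (tier : 'I_F -> 'I_H) (L : nat).
Local Notation FT := (Ftier tier).
Local Notation cw := (@cw R K iota eff H tier).
Local Notation Wtw := (@Wtw R K iota eff H tier).
Local Notation Wxw := (@Wxw R K iota eff H tier).
Local Notation Vres := (@Vres R K iota eff).
Local Notation totvar := (@totvar R K iota eff H tier).
Local Notation xcoef := (@xcoef R K iota eff H tier).

Hypothesis iota_bij : bijective iota.
Hypothesis eff_inj : injective eff.
Hypothesis eff_neq0 : forall f, eff f != finset.set0.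

Variables (wt_ : nat -> 'I_Q -> R) (wt : 'I_Q -> R).
Hypothesis wt_gt0_ : forall k q, 0 < wt_ k q.
Hypothesis wt_gt0 : forall q, 0 < wt q.
Hypothesis wt_cvg : forall q, wt_ k q @[k --> \oo] --> wt q.

Variables (Sy_ : nat -> 'I_Q -> 'I_Q -> R) (Sy : 'I_Q -> 'I_Q -> R).
Variables (Sx_ : nat -> 'M[R]_L) (Sx : 'M[R]_L).
Variables (Sc_ : nat -> 'I_Q -> 'rV[R]_L) (Sc : 'I_Q -> 'rV[R]_L).
Hypothesis Sy_cvg : forall q r, Sy_ k q r @[k --> \oo] --> Sy q r.
Hypothesis Sx_cvg : mcvg Sx_ Sx.
Hypothesis Sc_cvg : forall q, mcvg (Sc_^~ q) (Sc q).
Hypothesis Sx_unit_ : forall k, Sx_ k \in unitmx.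
Hypothesis Sx_unit : Sx \in unitmx.

Lemma cw_cvg h q : mcvg (fun k => cw (wt_ k) h q) (cw wt h q).
Proof.
have cB : mcvg (fun k => Bw iota eff (wt_ k)) (Bw iota eff wt).
  by apply: mcvg_sum => r; apply: mcvgZ => //; exact: mcvg_cst.
apply: mcvgB; first exact: mcvg_cst.
apply: mcvg_mul; last exact: mcvg_cst.
apply: mcvg_mul; first exact: mcvg_subm.
apply: mcvg_inv; first exact: mcvg_subm.
- by move=> k; exact: subm_Bw_unit.
- exact: subm_Bw_unit.
Qed.

Lemma Wtw_cvg h : mcvg (fun k => Wtw (wt_ k) (Sc_ k) h) (Wtw wt Sc h).
Proof.
apply: mcvg_cast; apply: mcvgZ; first exact: cvg_cst.
apply: mcvg_sum => q; apply: mcvgZ => //; apply: mcvg_tens => //.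
by apply: mcvg_mul; [exact: mcvg_cst|apply: mcvg_tr; exact: cw_cvg].
Qed.

Lemma Wxw_cvg h : mcvg (fun k => Wxw (wt_ k) (Sx_ k) h) (Wxw wt Sx h).
Proof.
apply: mcvgZ; first exact: cvg_cst.
apply: mcvg_sum => q; apply: mcvgZ => //; apply: mcvg_tens => //.
by apply: mcvg_mul; [|apply: mcvg_tr]; exact: cw_cvg.
Qed.

Lemma gker_cvg q r : gker (wt_ k) q r @[k --> \oo] --> gker wt q r.
Proof.
rewrite /gker; apply: cvgB; last exact: cvg_cst.
by case: (q == r) => /=; [exact: wt_cvg|exact: cvg_cst].
Qed.

Lemma Vres_cvg : mcvg (fun k => Vres (wt_ k) (Sy_ k) (Sx_ k) (Sc_ k)) (Vres wt Sy Sx Sc).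
Proof.
apply: mcvgZ; first exact: cvg_cst.
apply: mcvg_sum => q; apply: mcvg_sum => r; apply: mcvgZ; last exact: mcvg_cst.
apply: cvgM; first exact: gker_cvg.
apply: cvgB => //.
have /(_ 0 0) // : mcvg (fun k => Sc_ k q *m invmx (Sx_ k) *m (Sc_ k r)^T) (Sc q *m invmx Sx *m (Sc r)^T).
by apply: mcvg_mul; [apply: mcvg_mul => //; exact: mcvg_inv|exact: mcvg_tr].
Qed.

Lemma xcoef_cvg U q : mcvg (fun k => xcoef (wt_ k) U q) (xcoef wt U q : 'rV[R]_L).
Proof.
apply: mcvgZ; first exact: cvg_cst.
apply: mcvg_sum => h; apply: mcvg_mul; last exact: mcvg_cst.
by apply: mcvg_tr; exact: cw_cvg.
Qed.

Lemma totvar_cvg v U :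
  totvar (wt_ k) (Sy_ k) (Sx_ k) (Sc_ k) v U @[k --> \oo] --> totvar wt Sy Sx Sc v U.
Proof.
apply: cvg_bigsum => q _; apply: cvg_bigsum => r _.
apply: cvgM; first exact: gker_cvg.
have cc q' r' : (Sc_ k q' *m (xcoef (wt_ k) U r')^T) 0 0 @[k --> \oo] --> (Sc q' *m (xcoef wt U r')^T) 0 0.
  have : mcvg (fun k => Sc_ k q' *m (xcoef (wt_ k) U r')^T) (Sc q' *m (xcoef wt U r')^T).
    by apply: mcvg_mul => //; apply: mcvg_tr; exact: xcoef_cvg.
  exact.
apply: cvgD; first apply: cvgD; first apply: cvgD.
- by apply: cvgM => //; exact: cvg_cst.
- by apply: cvgM; [exact: cvg_cst|exact: cc].
- by apply: cvgM; [exact: cvg_cst|exact: cc].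
have : mcvg (fun k => xcoef (wt_ k) U q *m Sx_ k *m (xcoef (wt_ k) U r)^T)
    (xcoef wt U q *m Sx *m (xcoef wt U r)^T).
  apply: mcvg_mul; last by apply: mcvg_tr; exact: xcoef_cvg.
  by apply: mcvg_mul => //; exact: xcoef_cvg.
exact.
Qed.

End VarianceLimits.

(** * Finite-population algebra *)

Section FinitePopulation.
Context {R : realType} (n L : nat).
Implicit Types (u v : 'I_n -> R) (x : 'I_n -> 'cV[R]_L).

Definition smean u : R := (fpmean (sc u)) 0 0.

Lemma smeanE u : smean u = n%:R^-1 * \sum_i u i.
Proof. by rewrite /smean mxE summxE; congr (_ * _); apply: eq_bigr => i _; rewrite mxE. Qed.

Lemma sum_centred u : (0 < n)%N -> \sum_i (u i - smean u) = 0.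
Proof.
move=> n0; rewrite big_split/= sumr_const card_ord -mulr_natl smeanE mulrN mulrA.
by rewrite mulfV ?pnatr_eq0 -?lt0n// mul1r subrr.
Qed.

Lemma sum_fpmean p q (w : 'I_n -> 'M[R]_(p, q)) : (0 < n)%N -> \sum_i (w i - fpmean w) = 0.
Proof.
move=> n0; rewrite big_split/= sumr_const card_ord -scaler_nat scalerN scalerA.
by rewrite mulfV ?pnatr_eq0 -?lt0n// scale1r subrr.
Qed.

Lemma sc_centred u i : sc u i - fpmean (sc u) = (u i - smean u)%:M.
Proof.
apply/matrixP => a b; rewrite !ord1 [RHS]mxE mulr1n [LHS]mxE [X in _ + X]mxE.
by congr (_ - _); rewrite mxE.
Qed.

Lemma fpcov_sc u v : (fpcov (sc u) (sc v)) 0 0 =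
  n.-1%:R^-1 * \sum_i (u i - smean u) * (v i - smean v).
Proof.
rewrite mxE summxE; congr (_ * _); apply: eq_bigr => i _.
by rewrite !sc_centred tr_scalar_mx mul_scalar_mx mxE mxE eqxx mulr1n.
Qed.

Lemma fpcov_scx u x : fpcov (sc u) x =
  n.-1%:R^-1 *: \sum_i (u i - smean u) *: (x i - fpmean x)^T.
Proof.
by congr (_ *: _); apply: eq_bigr => i _; rewrite sc_centred mul_scalar_mx.
Qed.

Lemma fpcov_tr x : (fpcov x x)^T = fpcov x x.
Proof.
rewrite /fpcov linearZ/= linear_sum/=; congr (_ *: _); apply: eq_bigr => i _.
by rewrite trmx_mul trmxK.
Qed.

Lemma quad_dyad (z : 'cV[R]_L) (d d' : 'rV[R]_L) :
  (d *m (z *m z^T) *m d'^T) 0 0 = (d *m z) 0 0 * (d' *m z) 0 0.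
Proof.
have -> : d *m (z *m z^T) *m d'^T = (d *m z) *m (d' *m z)^T by rewrite trmx_mul !mulmxA.
by rewrite mxE big_ord1; congr (_ * _); rewrite mxE.
Qed.

Lemma fpcov_psd x (d : 'rV[R]_L) : 0 <= (d *m fpcov x x *m d^T) 0 0.
Proof.
rewrite /fpcov -scalemxAr -scalemxAl mxE mulr_ge0// mulmx_sumr mulmx_suml summxE.
by apply: sumr_ge0 => i _; rewrite quad_dyad -expr2 sqr_ge0.
Qed.

Lemma fpcov_lin u v x (a b : R) (d e : 'rV[R]_L) : 
  n.-1%:R^-1 * \sum_i (a * (u i - smean u) + (d *m (x i - fpmean x)) 0 0) *
                      (b * (v i - smean v) + (e *m (x i - fpmean x)) 0 0) =
  a * b * (fpcov (sc u) (sc v)) 0 0 + a * (fpcov (sc u) x *m e^T) 0 0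
  + b * (fpcov (sc v) x *m d^T) 0 0 + (d *m fpcov x x *m e^T) 0 0.
Proof.
have scx w (f : 'rV[R]_L) : (fpcov (sc w) x *m f^T) 0 0 =
    n.-1%:R^-1 * \sum_i (w i - smean w) * (f *m (x i - fpmean x)) 0 0.
  rewrite fpcov_scx -scalemxAl mxE mulmx_suml summxE; congr (_ * _).
  by apply: eq_bigr => i _; rewrite -scalemxAl mxE -trmx_mul; congr (_ * _); rewrite mxE.
rewrite !scx fpcov_sc /fpcov -scalemxAr -scalemxAl mxE mulmx_sumr mulmx_suml summxE.
rewrite (mulrCA _ n.-1%:R^-1) (mulrCA a n.-1%:R^-1) (mulrCA b n.-1%:R^-1) -!mulrDr.
congr (_ * _); rewrite !mulr_sumr -!big_split/=; apply: eq_bigr => i _.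
by rewrite quad_dyad; ring.
Qed.

End FinitePopulation.

Lemma resid_form (R : realType) L (S : 'M[R]_L) (a b : 'rV[R]_L) :
  S^T = S -> S \in unitmx ->
  (a *m (- (b *m invmx S))^T) 0 0 + (b *m (- (a *m invmx S))^T) 0 0
  + (- (a *m invmx S) *m S *m (- (b *m invmx S))^T) 0 0 = - (a *m invmx S *m b^T) 0 0.
Proof.
move=> symS unitS; have symI : (invmx S)^T = invmx S by rewrite trmx_inv symS.
have trE (c : 'rV[R]_L) : (- (c *m invmx S))^T = - (invmx S *m c^T).
  by rewrite linearN/= trmx_mul symI.
have mN (A : 'M[R]_1) : (- A) 0 0 = - A 0 0 by rewrite mxE.
rewrite !trE !mulmxN !mulNmx opprK !mN !mulmxA mulmxKV// (mx11_mulC b a symI).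
by ring.
Qed.

Section FiniteFactorial.
Context {R : realType} (K : nat).
Variables (iota : 'I_(2 ^ K) -> {ffun 'I_K -> bool}) (eff : 'I_(2 ^ K).-1 -> {set 'I_K}).
Local Notation Q := (2 ^ K)%N.
Local Notation F := (2 ^ K).-1.
Local Notation b := (@bvec R K iota eff).
Local Notation c2 := (@c2 R K).
Variables (H : nat) (tier : 'I_F -> 'I_H) (L n : nat).
Variables (Y : 'I_n -> 'I_Q -> R) (x : 'I_n -> 'cV[R]_L) (nq : 'I_Q -> nat).
Local Notation FT := (Ftier tier).

Hypothesis iota_bij : bijective iota.
Hypothesis eff_inj : injective eff.
Hypothesis eff_neq0 : forall f, eff f != finset.set0.
Hypothesis n_gt0 : (0 < n)%N.
Hypothesis n1_gt0 : (0 < n.-1)%N.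
Hypothesis nq_gt0 : forall q, (0 < nq q)%N.
Hypothesis sum_nq : (\sum_q nq q)%N = n.
Hypothesis Sxx_unit : Sxx x \in unitmx.

Definition invprop q : R := n%:R / (nq q)%:R.

Let nR : n%:R != 0 :> R. Proof. by rewrite pnatr_eq0 -lt0n. Qed.
Let n1R : n.-1%:R != 0 :> R. Proof. by rewrite pnatr_eq0 -lt0n. Qed.
Let nqR q : (nq q)%:R != 0 :> R. Proof. by rewrite pnatr_eq0 -lt0n. Qed.

Lemma invprop_gt0 q : 0 < invprop q.
Proof. by rewrite divr_gt0 ?ltr0n. Qed.

Lemma invpropV q : (nq q)%:R^-1 = n%:R^-1 * invprop q.
Proof. by rewrite /invprop mulrA mulVf// mul1r. Qed.

Lemma sum_invprop : \sum_q (invprop q)^-1 = 1.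
Proof.
under eq_bigr do rewrite invf_div; rewrite -mulr_suml -natr_sum sum_nq.
by rewrite mulfV.
Qed.

Local Notation cwn := (@cw R K iota eff H tier invprop).
Local Notation Wtwn := (@Wtw R K iota eff H tier invprop L (Sqx Y x)).
Local Notation Wxwn := (@Wxw R K iota eff H tier invprop L (Sxx x)).
Local Notation Vresn := (@Vres R K iota eff invprop L (Sqk Y) (Sxx x) (Sqx Y x)).
Local Notation Sresn := (@Sres R K L (Sqk Y) (Sxx x) (Sqx Y x)).

Let Btilde_scale : Btilde iota eff nq = (c2 ^+ 2 * n%:R^-1) *: Bw iota eff invprop.
Proof.
rewrite /Btilde -scalerA; congr (_ *: _); rewrite scaler_sumr; apply: eq_bigr => q _.
by rewrite invpropV scalerA.
Qed.

Let subm_scale I J (c : R) (A : 'M[R]_F) : subm I J (c *: A) = c *: subm I J A.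
Proof. by apply/matrixP => i j; rewrite !mxE. Qed.

Lemma cvec_cw h q : cvec iota eff tier nq h q = cwn h q.
Proof.
have c0 : c2 ^+ 2 * n%:R^-1 != 0.
  by rewrite mulf_neq0 ?invr_neq0// expf_neq0// c2_neq0.
rewrite /cvec Btilde_scale !subm_scale invmxZ; last first.
  rewrite unitmxZ ?unitfE//; apply: subm_Bw_unit => //; exact: invprop_gt0.
by rewrite -scalemxAl -scalemxAr scalerA mulfV// scale1r.
Qed.

Lemma W_xx_scale h : W_xx iota eff tier x nq h = n%:R^-1 *: Wxwn h.
Proof.
rewrite /W_xx /Wxw scalerA (mulrC n%:R^-1) -(scalerA (c2 ^+ 2)); congr (_ *: _); rewrite scaler_sumr.
by apply: eq_bigr => q _; rewrite invpropV scalerA cvec_cw.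
Qed.

Lemma castmxZ (e : (F * 1 = F)%N) m (c : R) (A : 'M[R]_(F * 1, m)) :
  castmx (e, erefl) (c *: A) = c *: castmx (e, erefl) A.
Proof. by apply/matrixP => i j; rewrite !(castmxE, mxE). Qed.

Lemma W_tx_scale h : W_tx iota eff tier Y x nq h = n%:R^-1 *: Wtwn h.
Proof.
rewrite /W_tx /Wtw -castmxZ; congr castmx.
rewrite scalerA (mulrC n%:R^-1) -(scalerA (c2 ^+ 2)); congr (_ *: _); rewrite scaler_sumr.
by apply: eq_bigr => q _; rewrite invpropV scalerA cvec_cw.
Qed.

Let Wxw_unit h : Wxwn h \in unitmx.
Proof. by apply: Wxw_unit => //; exact: invprop_gt0. Qed.

Let invW_xx h : invmx (W_xx iota eff tier x nq h) = n%:R *: invmx (Wxwn h).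
Proof.
by rewrite W_xx_scale invmxZ ?invrK// unitmxZ ?unitfE ?invr_eq0.
Qed.

Let mulmxZ3 m p (c d : R) (A : 'M[R]_(m, p)) (B : 'M[R]_p) (C : 'M[R]_(p, m)) :
  (c *: A) *m (d *: B) *m (c *: C) = (c * d * c) *: (A *m B *m C).
Proof.
by rewrite -scalemxAr -scalemxAr -!scalemxAl !scalerA; congr (_ *: _); ring.
Qed.

Let quadZ p (r c : R) (B : 'M[R]_p) (th : 'cV[R]_p) : r ^+ 2 = c ->
  ((r *: th)^T *m B *m (r *: th)) 0 0 = (th^T *m (c *: B) *m th) 0 0.
Proof.
move=> <-; rewrite [(_ *: _)^T]linearZ/= -[B]scale1r mulmxZ3 mulr1 -expr2 !scale1r.
by rewrite -scalemxAr -scalemxAl.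
Qed.

Lemma W_par_scale h :
  n%:R *: W_par iota eff tier Y x nq h = Wtwn h *m invmx (Wxwn h) *m (Wtwn h)^T.
Proof.
have trZ (A : 'M[R]_(F, #|FT h| * L)) : (n%:R^-1 *: A)^T = n%:R^-1 *: A^T by rewrite linearZ.
rewrite /W_par invW_xx W_tx_scale trZ.
rewrite (@mulmxZ3 _ _ n%:R^-1 n%:R (Wtwn h) (invmx (Wxwn h)) (Wtwn h)^T).
rewrite (scalerA n%:R).
by rewrite mulrA mulrA mulfV// mul1r mulfV// scale1r.
Qed.

Lemma Mstat_scale Z h : let th := Num.sqrt n%:R *: theta_x iota eff tier x nq Z h in
  Mstat iota eff tier x nq Z h = (th^T *m invmx (Wxwn h) *m th) 0 0.
Proof.
rewrite /Mstat invW_xx.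
exact: (esym (@quadZ _ (Num.sqrt n%:R) n%:R (invmx (Wxwn h))
  (theta_x iota eff tier x nq Z h) (sqr_sqrtr (ler0n R n)))).
Qed.

Let YbarE q : Ybar Y q = smean (Y^~ q). Proof. by []. Qed.

Let yperpE i q : Yperp Y x i q =
  1 * (Y i q - smean (Y^~ q)) + (- (Sqx Y x q *m invmx (Sxx x)) *m (x i - fpmean x)) 0 0.
Proof. by rewrite /Yperp mul1r mulNmx [X in _ = _ + X]mxE. Qed.

Let sum_lin a (d : 'rV[R]_L) q :
  \sum_i (a * (Y i q - smean (Y^~ q)) + (d *m (x i - fpmean x)) 0 0) = 0.
Proof.
rewrite big_split/= -mulr_sumr sum_centred// mulr0 add0r -summxE -mulmx_sumr.
by rewrite sum_fpmean// mulmx0 mxE.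
Qed.

Lemma sum_Yperp q : \sum_i Yperp Y x i q = 0.
Proof. by under eq_bigr do rewrite yperpE; exact: sum_lin. Qed.

Lemma cov_Yperp q r : n.-1%:R^-1 * \sum_i Yperp Y x i q * Yperp Y x i r = Sresn q r.
Proof.
under eq_bigr do rewrite !yperpE.
rewrite fpcov_lin !mul1r -/(Sxx x) -/(Sqx Y x q) -/(Sqx Y x r) -/(Sqk Y q r) /Sres.
rewrite -!addrA; congr (_ + _); rewrite addrA; apply: resid_form => //.
exact: fpcov_tr.
Qed.

Lemma Vperp_scale : n%:R *: Vperp iota eff Y x nq = Vresn.
Proof.
have Sp q : Sperp Y x q = Sresn q q.
  rewrite /Sperp fpcov_sc -cov_Yperp; congr (_ * _); apply: eq_bigr => i _.
  by rewrite smeanE sum_Yperp mulr0 subr0.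
have tm : fpmean (tauperp iota eff Y x) = 0.
  rewrite /fpmean /tauperp -scaler_sumr exchange_big/= big1 ?scaler0// => q _.
  by rewrite -scaler_suml sum_Yperp scale0r.
have Stt : Sperp_tt iota eff Y x = c2 ^+ 2 *: \sum_q \sum_r Sresn q r *: (b q *m (b r)^T).
  rewrite /Sperp_tt /fpcov tm.
  transitivity (n.-1%:R^-1 *: \sum_i (c2 ^+ 2 *: \sum_q \sum_r (Yperp Y x i q * Yperp Y x i r) *: (b q *m (b r)^T))).
    congr (_ *: _); apply: eq_bigr => i _; rewrite subr0 /tauperp linearZ/= -scalemxAl -scalemxAr.
    rewrite scalerA -expr2; congr (_ *: _); rewrite linear_sum/= mulmx_suml.
    apply: eq_bigr => q _; rewrite mulmx_sumr; apply: eq_bigr => r _.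
    by rewrite linearZ/= -scalemxAl -scalemxAr scalerA.
  rewrite -scaler_sumr scalerA mulrC -scalerA; congr (_ *: _).
  rewrite exchange_big/= scaler_sumr; apply: eq_bigr => q _.
  rewrite exchange_big/= scaler_sumr; apply: eq_bigr => r _.
  by rewrite -scaler_suml scalerA cov_Yperp.
have sc (A B : 'M[R]_F) : n%:R *: (c2 ^+ 2 *: A - n%:R^-1 *: (c2 ^+ 2 *: B)) =
    c2 ^+ 2 *: (n%:R *: A - B).
  by apply/matrixP => i j; rewrite !mxE; field.
rewrite /Vperp Stt sc.
congr (_ *: _); rewrite scaler_sumr -sumrB; apply: eq_bigr => q _.
transitivity (\sum_r ((invprop q *+ (q == r)) * Sresn q r) *: (b q *m (b r)^T) - \sum_r Sresn q r *: (b q *m (b r)^T)).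
  congr (_ - _); rewrite (bigD1 q)//= eqxx mulr1n big1 ?addr0.
    by rewrite scalerA mulrA Sp /invprop.
  by move=> r rq; rewrite [q == r]eq_sym (negbTE rq) mulr0n mul0r scale0r.
rewrite -sumrB; apply: eq_bigr => r _.
by rewrite -scalerBl /gker mulrBl mul1r.
Qed.

Section LinearStatistic.
Variables (v : 'cV[R]_F) (U : forall h, 'M[R]_(#|FT h|, L)).
Local Notation ycf := (@ycoef R K iota eff v).
Local Notation xcf := (@xcoef R K iota eff H tier invprop L U).
Local Notation totv := (@totvar R K iota eff H tier invprop L (Sqk Y) (Sxx x) (Sqx Y x) v U).
Local Notation pairv := (@pairvar R K iota eff H tier invprop L (Sqk Y) (Sxx x) (Sqx Y x) v U).

Definition lin i q : R := ycf q * (Y i q - smean (Y^~ q)) + (xcf q *m (x i - fpmean x)) 0 0.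
Definition amat i q : R := Num.sqrt n%:R * ((nq q)%:R^-1 * lin i q - n%:R^-1 * \sum_r lin i r).

Lemma cov_lin q r : n.-1%:R^-1 * \sum_i lin i q * lin i r = pairv q r.
Proof. by rewrite fpcov_lin. Qed.

Let nq_sumR : \sum_q (nq q)%:R = n%:R :> R.
Proof. by rewrite -natr_sum sum_nq. Qed.

Lemma amat_row0 i : \sum_q (nq q)%:R * amat i q = 0.
Proof.
transitivity (Num.sqrt n%:R * (\sum_q lin i q - (\sum_q (nq q)%:R) * (n%:R^-1 * \sum_r lin i r))).
  rewrite mulr_suml -sumrB mulr_sumr; apply: eq_bigr => q _.
  by rewrite /amat; move: (\sum_r _) (lin i q) => s l; field; rewrite ?nR ?nqR.
by rewrite nq_sumR mulrA mulfV// mul1r subrr mulr0.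
Qed.

Lemma amat_col0 q : \sum_i amat i q = 0.
Proof.
rewrite /amat -mulr_sumr sumrB -!mulr_sumr sum_lin mulr0 exchange_big/=.
by rewrite big1 ?mulr0 ?subr0 ?mulr0// => r _; exact: sum_lin.
Qed.

Lemma msq_amat : msq nq amat = (n.-1%:R / n%:R) * totv.
Proof.
have totE : n.-1%:R * totv = \sum_i \sum_q \sum_r gker invprop q r * (lin i q * lin i r).
  rewrite /totvar mulr_sumr exchange_big/=; apply: eq_bigr => q _.
  rewrite mulr_sumr exchange_big/=; apply: eq_bigr => r _.
  by rewrite -mulr_sumr -cov_lin mulrCA (mulrA n.-1%:R) mulfV// mul1r.
rewrite /msq mulrAC (mulrC _ n%:R^-1) totE; congr (_ * _); apply: eq_bigr => i _.
set S := \sum_r lin i r.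
have -> : \sum_q \sum_r gker invprop q r * (lin i q * lin i r) = \sum_q invprop q * lin i q ^+ 2 - S ^+ 2.
  have -> : S ^+ 2 = \sum_q \sum_r lin i q * lin i r.
    by rewrite expr2 mulr_suml; apply: eq_bigr => q _; rewrite mulr_sumr.
  rewrite -sumrB; apply: eq_bigr => q _.
  transitivity (\sum_r (invprop q *+ (q == r)) * (lin i q * lin i r) - \sum_r lin i q * lin i r).
    by rewrite -sumrB; apply: eq_bigr => r _; rewrite /gker mulrBl mul1r.
  congr (_ - _); rewrite (bigD1 q)//= eqxx mulr1n big1 ?addr0//.
  by move=> r rq; rewrite eq_sym (negbTE rq) mulr0n mul0r.
have E q : (nq q)%:R * amat i q ^+ 2 =
    invprop q * lin i q ^+ 2 - 2 * S * lin i q + n%:R^-1 * S ^+ 2 * (nq q)%:R.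
  rewrite /amat exprMn sqr_sqrtr// -/S /invprop; field.
  by rewrite nR nqR.
under eq_bigr do rewrite E.
rewrite big_split/= sumrB -mulr_sumr -mulr_sumr -/S nq_sumR; field.
exact: nR.
Qed.

Lemma lstat_amat Z : has_sizes nq Z -> lstat amat Z =
  Num.sqrt n%:R * ((v^T *m (tauhat iota eff Y nq Z - tau iota eff Y)) 0 0
    + \sum_h ((vmx (U h))^T *m theta_x iota eff tier x nq Z h) 0 0).
Proof.
move=> sZ.
have cardZ q : #|[pred i | Z i == q]| = nq q by apply/eqP; move/forallP : sZ; exact.
have tauE : (v^T *m (tauhat iota eff Y nq Z - tau iota eff Y)) 0 0 =
    \sum_q (nq q)%:R^-1 * \sum_(i | Z i == q) ycf q * (Y i q - smean (Y^~ q)).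
  rewrite /tauhat /tau -scalerBr -sumrB -scalemxAr mxE mulmx_sumr summxE mulr_sumr.
  apply: eq_bigr => q _; rewrite -scalerBl -scalemxAr mxE -mulr_sumr /Yhat.
  rewrite sumrB sumr_const cardZ YbarE /ycoef -[_ *+ nq q]mulr_natl.
  by move: (smean _) (\sum_(i | _) _) ((v^T *m b q) 0 0) => y s l; field; exact: nqR.
have thE : \sum_h ((vmx (U h))^T *m theta_x iota eff tier x nq Z h) 0 0 =
    \sum_q (nq q)%:R^-1 * \sum_(i | Z i == q) (xcf q *m (x i - fpmean x)) 0 0.
  transitivity (\sum_q (xcf q *m xhat x nq Z q) 0 0).
    under [RHS]eq_bigr do rewrite /xcoef -scalemxAl mxE mulmx_suml summxE mulr_sumr.
    rewrite exchange_big/=; apply: eq_bigr => h _.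
    rewrite /theta_x -scalemxAr mxE mulmx_sumr summxE mulr_sumr.
    apply: eq_bigr => q _; congr (_ * _).
    rewrite -vmx_tens vmx_dot mulmxA mxtrace_mulC /mxtrace big_ord1 cvec_cw.
    have -> : (xhat x nq Z q)^T *m ((U h)^T *m cwn h q) = ((cwn h q)^T *m U h *m xhat x nq Z q)^T.
      by rewrite !trmx_mul trmxK.
    by rewrite mxE.
  have x0 : \sum_q xcf q = 0.
    rewrite /xcoef -scaler_sumr exchange_big/= big1 ?scaler0// => h _.
    by rewrite -mulmx_suml -linear_sum/= sum_cw// linear0 mul0mx.
  transitivity (\sum_q (xcf q *m (xhat x nq Z q - fpmean x)) 0 0).
    transitivity (\sum_q (xcf q *m xhat x nq Z q) 0 0 - ((\sum_q xcf q) *m fpmean x) 0 0).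
      by rewrite x0 mul0mx [X in _ - X]mxE subr0.
    rewrite mulmx_suml summxE -sumrB; apply: eq_bigr => q _.
    by rewrite mulmxBr [RHS]mxE [X in _ = _ + X]mxE.
  apply: eq_bigr => q _.
  have -> : xhat x nq Z q - fpmean x = (nq q)%:R^-1 *: \sum_(i | Z i == q) (x i - fpmean x).
    rewrite sumrB sumr_const cardZ scalerBr -[fpmean x *+ nq q]scaler_nat [X in _ = _ - X]scalerA mulVf// scale1r.
    by [].
  by rewrite -scalemxAr mxE mulmx_sumr summxE.
rewrite tauE thE -big_split/=.
transitivity (Num.sqrt n%:R * \sum_i (nq (Z i))%:R^-1 * lin i (Z i)).
  rewrite /lstat /amat -mulr_sumr sumrB -[X in _ - X]mulr_sumr.
  rewrite [X in _ - _ * X]exchange_big/= [X in _ - _ * X]big1 ?mulr0 ?subr0//.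
  by move=> r _; exact: sum_lin.
congr (_ * _); rewrite (partition_big Z predT)//=; apply: eq_bigr => q _.
rewrite -mulrDr -big_split/= mulr_sumr; apply: eq_bigr => i /eqP ->.
by [].
Qed.

Definition amat_bd (mY : 'I_Q -> R) (mX : R) : R :=
  \sum_q (invprop q + 1) * (`|ycf q| * Num.sqrt (mY q) + (\sum_l `|xcf q 0 l|) * Num.sqrt mX).

Lemma amat_le (mY : 'I_Q -> R) (mX : R) :
  (forall i q, (Y i q - Ybar Y q) ^+ 2 / n%:R <= mY q) ->
  (forall i, (\sum_j ((x i - xbar x) j 0) ^+ 2) / n%:R <= mX) ->
  forall i q, `|amat i q| <= amat_bd mY mX.
Proof.
move=> YmY xmX i q.
have n0 : 0 < n%:R :> R by rewrite ltr0n.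
have root (y M : R) : y ^+ 2 / n%:R <= M -> `|y| <= Num.sqrt n%:R * Num.sqrt M.
  rewrite ler_pdivrMr// => yM.
  have M0 : 0 <= M by rewrite -(pmulr_lge0 _ n0); exact: le_trans (sqr_ge0 y) yM.
  by rewrite -sqrtr_sqr -sqrtrM ?(ltW n0)//; apply: ler_wsqrtr; rewrite mulrC.
pose lb q := `|ycf q| * Num.sqrt (mY q) + (\sum_l `|xcf q 0 l|) * Num.sqrt mX.
have lb0 q' : 0 <= lb q'.
  by rewrite addr_ge0// mulr_ge0 ?sqrtr_ge0//; apply: sumr_ge0.
have linle q' : `|lin i q'| <= Num.sqrt n%:R * lb q'.
  rewrite (le_trans (ler_normD _ _))// [leRHS]mulrDr lerD//.
    by rewrite normrM mulrCA ler_wpM2l// root// YmY.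
  rewrite mxE (le_trans (ler_norm_sum _ _ _))// mulrCA mulr_suml; apply: ler_sum => l _.
  rewrite normrM ler_wpM2l// root// (le_trans _ (xmX i))// ler_wpM2r ?invr_ge0 ?(ltW n0)//.
  rewrite (bigD1 l)//= lerDl; apply: sumr_ge0 => j _; exact: sqr_ge0.
have nn : Num.sqrt n%:R * Num.sqrt n%:R = n%:R :> R by rewrite -expr2 sqr_sqrtr// ltW.
have : `|amat i q| <= invprop q * lb q + \sum_r lb r.
  rewrite /amat normrM ger0_norm ?sqrtr_ge0//.
  have -> : invprop q * lb q + \sum_r lb r = Num.sqrt n%:R *
      ((nq q)%:R^-1 * (Num.sqrt n%:R * lb q) + n%:R^-1 * \sum_r Num.sqrt n%:R * lb r).
    rewrite -mulr_sumr; move: (lb q) (\sum_r lb r) => l s.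
    transitivity (Num.sqrt n%:R * Num.sqrt n%:R * ((nq q)%:R^-1 * l + n%:R^-1 * s)).
      by rewrite nn /invprop; field; rewrite ?nR ?nqR.
    by ring.
  rewrite ler_wpM2l ?sqrtr_ge0// (le_trans (ler_normB _ _))// lerD// normrM ger0_norm ?invr_ge0//.
    by rewrite ler_wpM2l ?invr_ge0.
  rewrite ler_wpM2l ?invr_ge0// (le_trans (ler_norm_sum _ _ _))//; exact: ler_sum.
move=> /le_trans; apply; rewrite /amat_bd.
under [X in _ <= X]eq_bigr => r _ do rewrite -/(lb r) (mulrDl _ _ (lb r)) mul1r.
rewrite [X in _ <= X]big_split/= lerD2r [X in _ <= X](bigD1 q)//= lerDl; apply: sumr_ge0 => r _.
by rewrite mulr_ge0// ltW// invprop_gt0.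
Qed.

End LinearStatistic.
End FiniteFactorial.

Section AssignmentExists.

Lemma ex_has_sizes n (Q : finType) (nq : Q -> nat) : (\sum_q nq q)%N = n ->
  exists Z : {ffun 'I_n -> Q}, has_sizes nq Z.
Proof.
pose s := flatten [seq nseq (nq q) q | q <- enum Q].
have szs : size s = (\sum_q nq q)%N.
  rewrite size_flatten /shape -map_comp sumnE big_map -[RHS]big_enum/=.
  by apply: eq_bigr => q _; rewrite size_nseq.
rewrite -szs => {szs} <-; exists [ffun i => tnth (in_tuple s) i].
apply/forallP => q; apply/eqP.
rewrite -sum1_card.
transitivity (\sum_(x <- s | x == q) 1)%N.
  by rewrite [RHS]big_tnth; apply: eq_bigl => i; rewrite inE ffunE.
rewrite sum1_count count_flatten -map_comp sumnE big_map big_enum/= (bigD1 q)//=.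
rewrite count_nseq/= eqxx mul1n big1 ?addn0// => r rq.
by rewrite count_nseq/= (negbTE rq).
Qed.

End AssignmentExists.

Section InjectionMatrices.
Context {R : realType} (m : nat).

Definition injmx p (f : 'I_p -> 'I_m) : 'M[R]_(m, p) := \matrix_(i, j) (i == f j)%:R.

Lemma tr_injmxE p (f : 'I_p -> 'I_m) r (A : 'M[R]_(m, r)) j c :
  ((injmx f)^T *m A) j c = A (f j) c.
Proof.
rewrite mxE (bigD1 (f j))//= !mxE eqxx mul1r big1 ?addr0// => i ij.
by rewrite !mxE (negbTE ij) mul0r.
Qed.

Lemma injmx_id p (f : 'I_p -> 'I_m) : injective f -> (injmx f)^T *m injmx f = 1%:M.
Proof.
by move=> fi; apply/matrixP => i j; rewrite tr_injmxE !mxE (inj_eq fi).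
Qed.

Lemma injmx_disj p r (f : 'I_p -> 'I_m) (g : 'I_r -> 'I_m) :
  (forall i j, f i != g j) -> (injmx f)^T *m injmx g = 0.
Proof.
by move=> fg; apply/matrixP => i j; rewrite tr_injmxE !mxE (negbTE (fg i j)).
Qed.

End InjectionMatrices.

Section Normsq.
Context {R : realType}.

Definition nsq p (u : 'cV[R]_p) : R := (u^T *m u) 0 0.

Lemma nsqE p (u : 'cV[R]_p) : nsq u = \sum_i u i 0 ^+ 2.
Proof. by rewrite /nsq mxE; apply: eq_bigr => i _; rewrite mxE expr2. Qed.

Lemma dotvE p (u v : 'cV[R]_p) : dotv u v = (u^T *m v) 0 0.
Proof. by rewrite mxE; apply: eq_bigr => i _; rewrite mxE. Qed.

Lemma nsq_ge0 p (u : 'cV[R]_p) : 0 <= nsq u.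
Proof. by rewrite nsqE; apply: sumr_ge0 => i _; exact: sqr_ge0. Qed.

Lemma nsq_mul p r (A : 'M[R]_(p, r)) (u : 'cV[R]_r) : nsq (A *m u) = (u^T *m (A^T *m A) *m u) 0 0.
Proof. by rewrite /nsq trmx_mul !mulmxA. Qed.

Lemma nsqZ p c (u : 'cV[R]_p) : nsq (c *: u) = c ^+ 2 * nsq u.
Proof. by rewrite !nsqE mulr_sumr; apply: eq_bigr => i _; rewrite mxE exprMn. Qed.

Lemma quad_form_le p (A : 'M[R]_p) (u : 'cV[R]_p) :
  `|(u^T *m A *m u) 0 0| <= (\sum_i \sum_j `|A i j|) * nsq u.
Proof.
have -> : (u^T *m A *m u) 0 0 = \sum_i \sum_j u i 0 * u j 0 * A i j.
  rewrite mxE exchange_big/=; apply: eq_bigr => j _; rewrite mxE mulr_suml.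
  by apply: eq_bigr => i _; rewrite mxE; ring.
rewrite (le_trans (ler_norm_sum _ _ _))// mulr_suml; apply: ler_sum => i _.
rewrite (le_trans (ler_norm_sum _ _ _))// mulr_suml; apply: ler_sum => j _.
rewrite normrM mulrC ler_wpM2l// normrM.
have ui k : `|u k 0| ^+ 2 <= nsq u.
  rewrite real_normK ?num_real// nsqE (bigD1 k)//= lerDl.
  by apply: sumr_ge0 => l _; exact: sqr_ge0.
have := ui i; have := ui j; have := sqr_ge0 (`|u i 0| - `|u j 0|).
by rewrite sqrrB; lra.
Qed.

End Normsq.

Section Embedding.
Context {R : realType} (K : nat).
Local Notation F := (2 ^ K).-1.
Variables (H : nat) (tier : 'I_F -> 'I_H) (L : nat).
Local Notation FT := (Ftier tier).
Local Notation T := (Tdim tier L).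
Local Notation dm h := (#|FT h| * L)%N.

Let blk_next (h l : 'I_H) : (h < l)%N -> (blk_off tier L h + dm h <= blk_off tier L l)%N.
Proof.
move=> hl; rewrite /blk_off -addnA leq_add2l addnC.
rewrite [X in (_ <= X)%N](bigD1 h)//= leq_add2l.
rewrite [X in (_ <= X)%N]big_mkcond/= [X in (X <= _)%N]big_mkcond/= leq_sum// => i _.
by case: ifP => // ih; rewrite (ltn_trans ih hl)/= neq_ltn ih.
Qed.

Let blk_lt (h : 'I_H) (j : 'I_(dm h)) : (blk_off tier L h + j < T)%N.
Proof.
apply: (@leq_trans (blk_off tier L h + dm h)); first by rewrite -addnS leq_add2l.
rewrite /blk_off /Tdim -addnA leq_add2l addnC [X in (_ <= X)%N](bigD1 h)//= leq_add2l.
rewrite [X in (_ <= X)%N]big_mkcond/= [X in (X <= _)%N]big_mkcond/= leq_sum// => i _.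
by case: ifP => // ih; rewrite neq_ltn ih.
Qed.

Definition epos : 'I_F -> 'I_T := lshift _.
Definition dpos (h : 'I_H) (j : 'I_(dm h)) : 'I_T := Ordinal (blk_lt j).

Let epos_inj : injective epos. Proof. exact: lshift_inj. Qed.

Let dpos_inj h : injective (@dpos h).
Proof. by move=> i j /(congr1 val) /= /addnI /val_inj. Qed.

Let dpos_disj h l (i : 'I_(dm h)) (j : 'I_(dm l)) : h != l -> dpos i != dpos j.
Proof.
move=> hl; apply/eqP => /(congr1 val) /= e.
have lt (h' l' : 'I_H) (i' : 'I_(dm h')) (j' : 'I_(dm l')) : (h' < l')%N ->
    (blk_off tier L h' + i' < blk_off tier L l' + j')%N.
  move=> hl'; apply: (@leq_trans (blk_off tier L h' + dm h')).
    by rewrite -addnS leq_add2l.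
  by apply: leq_trans (blk_next hl') _; exact: leq_addr.
move: hl; rewrite neq_ltn => /orP[] hl'.
  by have := lt _ _ i j hl'; rewrite e ltnn.
by have := lt _ _ j i hl'; rewrite e ltnn.
Qed.

Let epos_dpos i h (j : 'I_(dm h)) : epos i != dpos j.
Proof.
apply/eqP => /(congr1 val) /= e.
by have := ltn_ord i; rewrite e /blk_off -addnA ltnNge leq_addr.
Qed.

Definition Emx : 'M[R]_(T, F) := injmx epos.
Definition Dmx h : 'M[R]_(T, dm h) := injmx (@dpos h).

Lemma Emx_tcol t : Emx^T *m tcol t = eps_of t.
Proof. by apply/colP => i; rewrite tr_injmxE !mxE (tnth_nth 0). Qed.

Lemma Dmx_tcol t h : (Dmx h)^T *m tcol t = D_of t h.
Proof. by apply/colP => i; rewrite tr_injmxE !mxE (tnth_nth 0). Qed.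

Lemma EmxK : Emx^T *m Emx = 1%:M. Proof. exact: injmx_id. Qed.
Lemma DmxK h : (Dmx h)^T *m Dmx h = 1%:M. Proof. exact: injmx_id. Qed.

Lemma Emx_Dmx h : Emx^T *m Dmx h = 0. Proof. exact: injmx_disj. Qed.
Lemma Dmx_Emx h : (Dmx h)^T *m Emx = 0.
Proof. by apply: injmx_disj => i j; rewrite eq_sym. Qed.
Lemma Dmx_orth h l : h != l -> (Dmx h)^T *m Dmx l = 0.
Proof. by move=> hl; apply: injmx_disj => i j; exact: dpos_disj. Qed.

Definition glue (a : 'cV[R]_F) (d : forall h, 'cV[R]_(dm h)) : 'cV[R]_T :=
  Emx *m a + \sum_h Dmx h *m d h.

Lemma glue_E a d : Emx^T *m glue a d = a.
Proof.
rewrite mulmxDr mulmxA EmxK mul1mx mulmx_sumr big1 ?addr0// => h _.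
by rewrite mulmxA Emx_Dmx mul0mx.
Qed.

Lemma glue_D a d h : (Dmx h)^T *m glue a d = d h.
Proof.
rewrite mulmxDr mulmxA Dmx_Emx mul0mx add0r mulmx_sumr (bigD1 h)//= mulmxA DmxK mul1mx.
rewrite big1 ?addr0// => l lh; rewrite mulmxA Dmx_orth ?mul0mx// eq_sym.
by [].
Qed.

Lemma dot_glue (s : 'cV[R]_T) a d : (s^T *m glue a d) 0 0 =
  ((Emx^T *m s)^T *m a) 0 0 + \sum_h (((Dmx h)^T *m s)^T *m d h) 0 0.
Proof.
rewrite /glue mulmxDr mulmxA trmx_mul trmxK [LHS]mxE; congr (_ + _).
by rewrite mulmx_sumr summxE; apply: eq_bigr => h _; rewrite trmx_mul trmxK mulmxA.
Qed.

Lemma nsq_glue a d : nsq (glue a d) = nsq a + \sum_h nsq (d h).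
Proof.
rewrite {1}/nsq dot_glue glue_E; congr (_ + _); apply: eq_bigr => h _.
by rewrite glue_D.
Qed.

Definition blk (i : 'I_T) : option 'I_H := [pick h | [exists j : 'I_(dm h), i == dpos j]].

Lemma blk_dpos h j : blk (@dpos h j) = Some h.
Proof.
rewrite /blk; case: pickP => [l /existsP[j' /eqP e]|/(_ h)/existsP[]]; last by exists j.
by have [->//|hl] := eqVneq l h; have := dpos_disj j' j hl; rewrite e eqxx.
Qed.

Lemma bnorm_blk h x : bnorm blk (Some h) x = nsq ((Dmx h)^T *m x).
Proof.
transitivity (\sum_(j in predT) x (@dpos h j) 0 ^+ 2); last first.
  by rewrite nsqE; apply: eq_big => [j|j _]; rewrite ?inE// tr_injmxE.
rewrite -(big_imset (fun i => x i 0 ^+ 2) (h := @dpos h) (A := predT))/=; last first.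
  by move=> i j _ _; exact: dpos_inj.
apply: eq_bigl => i; apply/eqP/imsetP => [|[j _ ->]]; last exact: blk_dpos.
rewrite /blk; case: pickP => // l /existsP[j /eqP ij] [e].
by move: j ij; rewrite e => j ij; exists j.
Qed.

Lemma bnorm_blk_None x : bnorm blk None x = nsq x - \sum_h nsq ((Dmx h)^T *m x).
Proof.
rewrite [nsq x]nsqE (sum_bnorm blk) (bigD1 None)//=.
rewrite (reindex_omap (fun h : 'I_H => Some h) id)/=; last by case.
rewrite (_ : \sum_(h | _) _ = \sum_h nsq ((Dmx h)^T *m x)) ?addrK//.
by apply: eq_big => [h|h _]; rewrite ?eqxx// bnorm_blk.
Qed.

End Embedding.

Section PsdRoot.
Context {R : realType}.

Lemma quad_block m (a : 'M[R]_1) (b : 'cV[R]_m) (D : 'M[R]_m) (x : 'M[R]_1) (u : 'cV[R]_m) :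
  ((col_mx x u)^T *m block_mx a b^T b D *m col_mx x u) 0 0 =
  x 0 0 ^+ 2 * a 0 0 + 2 * x 0 0 * (b^T *m u) 0 0 + (u^T *m D *m u) 0 0.
Proof.
rewrite tr_col_mx mul_row_block mul_row_col !mulmxDl.
rewrite [LHS]mxE [X in X + _]mxE [X in _ + X]mxE.
have -> : (x^T *m a *m x) 0 0 = x 0 0 ^+ 2 * a 0 0.
  by rewrite !mxE !big_ord1 !mxE !big_ord1 !mxE; ring.
have -> : (u^T *m b *m x) 0 0 = x 0 0 * (b^T *m u) 0 0.
  rewrite mxE big_ord1 mulrC -[u^T *m b]trmxK trmx_mul trmxK.
  by congr (_ * _); rewrite mxE.
have -> : (x^T *m b^T *m u) 0 0 = x 0 0 * (b^T *m u) 0 0.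
  by rewrite -mulmxA mxE big_ord1 !mxE.
by ring.
Qed.

Lemma tr_mul_delta m (b : 'cV[R]_m) i : (b^T *m delta_mx i 0 : 'M[R]_1) 0 0 = b i 0.
Proof.
rewrite mxE (bigD1 i)//= !mxE !eqxx mulr1 big1 ?addr0// => j /negbTE ji.
by rewrite !mxE ji mulr0.
Qed.

Lemma quad_rank1 m (b u : 'cV[R]_m) :
  (u^T *m (b *m b^T) *m u) 0 0 = (b^T *m u) 0 0 ^+ 2.
Proof.
have -> : u^T *m (b *m b^T) *m u = (u^T *m b) *m (b^T *m u) by rewrite !mulmxA.
rewrite mxE big_ord1 expr2; congr (_ * _).
by rewrite -[u^T *m b]trmxK trmx_mul trmxK mxE.
Qed.

Lemma psd_root m (A : 'M[R]_m) : A^T = A ->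
  (forall v : 'cV[R]_m, 0 <= (v^T *m A *m v) 0 0) -> exists M : 'M[R]_m, M *m M^T = A.
Proof.
elim: m A => [|m IH] A symA psdA.
  by exists 0; apply/matrixP => -[].
rewrite -[m.+1]/(1 + m)%N in A symA psdA *.
pose a := ulsubmx A; pose b := dlsubmx A; pose D := drsubmx A.
have AE : A = block_mx a b^T b D.
  by rewrite -[LHS]submxK -/a -/b -/D trmx_dlsub symA.
have symD : D^T = D by rewrite trmx_drsub symA.
have quad (x : 'M[R]_1) (u : 'cV[R]_m) : 0 <= x 0 0 ^+ 2 * a 0 0 + 2 * x 0 0 * (b^T *m u) 0 0 + (u^T *m D *m u) 0 0.
  by rewrite -quad_block -AE.
have a0 : 0 <= a 0 0.
  have := quad 1%:M 0; rewrite trmx0 !mul0mx !mulmx0 !mxE/=; lra.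
have psd0 (u : 'cV[R]_m) : 0 <= (u^T *m D *m u) 0 0.
  by have := quad 0 u; rewrite mxE expr0n/= mulr0 !mul0r !add0r.
have aE : a = (a 0 0)%:M by apply/matrixP => i j; rewrite !ord1 [RHS]mxE eqxx.
have [az|az] := eqVneq (a 0 0) 0.
  have b0 : b = 0.
    apply/colP => i; rewrite [RHS]mxE; apply/eqP/negPn/negP => bi.
    pose d := (((delta_mx i 0)^T *m D *m delta_mx i 0) : 'M[R]_1) 0 0.
    pose y := - (d + 1) / (2 * b i 0).
    have yb : 2 * y * b i 0 = - (d + 1) by rewrite /y; field.
    have := quad (y%:M) (delta_mx i 0).
    have -> : (y%:M : 'M[R]_1) 0 0 = y by rewrite mxE eqxx.
    by rewrite tr_mul_delta -/d az mulr0 add0r yb; lra.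
  have [M' M'E] := IH D symD psd0; exists (block_mx 0 0 0 M').
  rewrite tr_block_mx mulmx_block !trmx0 !mul0mx !mulmx0 !addr0 !add0r M'E AE b0 trmx0.
  by rewrite aE az raddf0.
have apos : 0 < a 0 0 by rewrite lt0r az.
pose D' := D - (a 0 0)^-1 *: (b *m b^T).
have symD' : D'^T = D'.
  by rewrite linearB/= linearZ/= trmx_mul trmxK symD.
have psdD' (u : 'cV[R]_m) : 0 <= (u^T *m D' *m u) 0 0.
  pose s := (b^T *m u) 0 0.
  have := quad ((- (s / a 0 0))%:M) u; rewrite -/s mxE eqxx mulr1n.
  suff -> : (u^T *m D' *m u) 0 0 = (u^T *m D *m u) 0 0 - (a 0 0)^-1 * s ^+ 2.
    move=> /le_trans; apply; rewrite le_eqVlt; apply/orP; left; apply/eqP.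
    by field.
  rewrite mulmxBr mulmxBl -scalemxAr -scalemxAl [LHS]mxE; congr (_ + _).
  rewrite [LHS]mxE [X in - X]mxE; congr (- (_ * _)).
  exact: quad_rank1.
have [M' M'E] := IH D' symD' psdD'.
pose r := Num.sqrt (a 0 0).
have r0 : r != 0 by rewrite sqrtr_eq0 -ltNge.
have rr : r * r = a 0 0 by rewrite -expr2 sqr_sqrtr.
exists (block_mx r%:M 0 (r^-1 *: b) M').
rewrite tr_block_mx mulmx_block !trmx0 !mul0mx !mulmx0 !addr0 M'E AE.
rewrite tr_scalar_mx -scalar_mxM rr -aE.
congr block_mx.
- by rewrite mul_scalar_mx linearZ/= scalerA mulfV// scale1r.
- by rewrite mul_mx_scalar scalerA mulfV// scale1r.
- rewrite linearZ/= -scalemxAl -scalemxAr scalerA -invfM rr /D'.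
  by rewrite addrC subrK.
Qed.

End PsdRoot.

(** * Conditioning on the acceptance event *)

Section ConditionalLimit.
Context {R : realType} (m : nat) (B : finType) (beta : 'I_m -> B).
Variables (P : pred B) (a : B -> R).
Hypothesis a_gt0 : forall b, P b -> 0 < a b.
Local Notation bn := (@bnorm R m B beta).
Local Notation bb := (@bball R m B beta P a).

Lemma bball_gt0 : 0 < gaussE (fun t : m.-tuple R => bb (tcol t)).
Proof.
pose c : R := (1 + \sum_(b | P b) (a b)^-1)^-1.
have s0 : 0 <= \sum_(b | P b) (a b)^-1.
  by apply: sumr_ge0 => b Pb; rewrite invr_ge0 (ltW (a_gt0 Pb)).
have c0 : 0 < c by rewrite invr_gt0; lra.
have ca b : P b -> c <= a b.
  move=> Pb; rewrite -[a b]invrK lef_pV2 ?posrE ?invr_gt0 ?a_gt0//; last by lra.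
  rewrite (bigD1 b)//= addrCA lerDl; apply: addr_ge0 => //.
  by apply: sumr_ge0 => d /andP[Pd _]; rewrite invr_ge0 (ltW (a_gt0 Pd)).
pose e : R := Num.sqrt (c / m.+1%:R).
have e0 : 0 < e by rewrite sqrtr_gt0 divr_gt0.
have e2 : e ^+ 2 = c / m.+1%:R by rewrite sqr_sqrtr// divr_ge0// ltW.
have normE (y : R) : (`|y| <= e)%R = (y ^+ 2 <= e ^+ 2).
  by rewrite -[y ^+ 2]real_normK ?num_real// ler_pXn2r ?nnegrE// ltW.
apply: (lt_le_trans (gaussE_box_gt0 m e0)).
have boxE : (fun t : m.-tuple R => \prod_i (`|tnth t i| <= e)%R%:R) =
    (fun t => bball id predT (fun=> e ^+ 2) (tcol t)).
  apply/funext => t; apply: eq_bigr => i _; congr ((nat_of_bool _)%:R).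
  by rewrite normE /bnorm big_pred1_eq mxE.
rewrite boxE; apply: ler_gaussE; [exact: bmeas_bball|exact: bmeas_bball|move=> t].
rewrite {1}/bball; have [/forallP h|] := boolP [forall i : 'I_m, bnorm id i (tcol t) <= e ^+ 2]; last first.
  rewrite negb_forall => /existsP[i hi]; rewrite (bigD1 i)//= (negbTE hi) mul0r.
  by have /andP[] := bball01 beta P a (tcol t).
rewrite big1 => [|i _]; last by rewrite h.
rewrite /bball big1// => b Pb; rewrite (_ : bn b _ <= a b)%R//.
apply: le_trans (ca b Pb).
have ub : bn b (tcol t) <= \sum_(i < m) e ^+ 2.
  rewrite /bnorm big_mkcond/=; apply: ler_sum => i _; case: ifP => _; last exact: sqr_ge0.
  by have := h i; rewrite /bnorm big_pred1_eq.
rewrite (le_trans ub)// sumr_const card_ord e2 -[_ *+ m]mulr_natl mulrCA ler_piMr ?(ltW c0)//.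
by rewrite ler_pdivrMr ?ltr0n// mul1r ler_nat.
Qed.

Hypothesis blk_neq0 : forall b, P b -> exists i, beta i == b.

Let sph b (x : 'cV[R]_m) : R := (bn b x == a b)%:R.

Let bmeas_sph b : bmeas (fun t : m.-tuple R => sph b (tcol t)).
Proof.
split; last by exists 1 => t; rewrite ger0_norm ?ler0n// lern1 leq_b1.
apply: (measurable_fun_cvg (h := fun k (t : m.-tuple R) => step k (`|bn b (tcol t) - a b| - 0))).
  move=> k.
  have [//] : bmeas (fun t : m.-tuple R => step k (`|bn b (tcol t) - a b| - 0)).
  apply: (bmeas_tcol (f := fun x => step k (`|bn b x - a b| - 0))); split; last first.
    by exists 1 => x; rewrite ger0_norm ?step_ge0 ?step_le1.
  apply: (continuous_compf (f := fun x => `|bn b x - a b| - 0)); last exact: step_continuous.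
  apply: continuous_addf; last exact: continuous_cstf.
  apply: (continuous_compf (f := fun x => bn b x - a b)); last exact: norm_continuous.
  by apply: continuous_addf; [exact: bnorm_continuous|exact: continuous_cstf].
move=> t _; rewrite /sph -subr_eq0 -normr_le0; exact: step_cvg_ind.
Qed.

Let gauss_sph b : P b -> gaussE (fun t : m.-tuple R => sph b (tcol t)) = 0.
Proof.
move=> Pb; rewrite -[RHS](@gaussE_sphere R m (fun i => beta i == b) (a b) (blk_neq0 Pb)).
congr gaussE; apply/funext => t; congr ((nat_of_bool (_ == _))%:R).
rewrite /bnorm big_mkcond/=; apply: eq_bigr => i _.
by case: (beta i == b); rewrite ?mul1r ?mul0r// mxE.
Qed.

Let ej j : R := j.+1%:R^-1.
Let up j x : R := \prod_(b | P b) step j (bn b x - a b * (1 + ej j)).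
Let lo j x : R := \prod_(b | P b) (1 - step j (a b * (1 - ej j) - bn b x)).

Let ej_gt0 j : 0 < ej j. Proof. by rewrite invr_gt0. Qed.

Let ej_cvg : ej j @[j --> \oo] --> 0.
Proof. exact: cvg_harmonic. Qed.

Let bcont_stepf j (f : 'cV[R]_m -> R) : continuous f -> bcont (fun x => step j (f x)).
Proof.
move=> cf; split; last by exists 1 => x; rewrite ger0_norm ?step_ge0 ?step_le1.
exact: (continuous_compf cf (@step_continuous R j)).
Qed.

Let bcont_up j : bcont (up j).
Proof.
apply: bcont_prod => b _; apply: (@bcont_stepf j (fun x => bn b x - a b * (1 + ej j))).
by apply: continuous_addf; [exact: bnorm_continuous|exact: continuous_cstf].
Qed.

Let bcont_lo j : bcont (lo j).
Proof.
apply: bcont_prod => b _; apply: bcontD; first exact: bcont_cst.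
apply: bcontN; apply: (@bcont_stepf j (fun x => a b * (1 - ej j) - bn b x)).
apply: continuous_addf; first exact: continuous_cstf.
have -> : (fun x => - bn b x) = (fun x => -1 * bn b x) by apply/funext => x; rewrite mulN1r.
by apply: continuous_mulf; [exact: continuous_cstf|exact: bnorm_continuous].
Qed.

Let lo_ge0 j x : 0 <= lo j x.
Proof. by apply: prodr_ge0 => b _; rewrite subr_ge0 step_le1. Qed.

Let up_le1 j x : up j x <= 1.
Proof. by apply: prodr_ile1 => b _; rewrite step_ge0 step_le1. Qed.

Let lo_le1 j x : lo j x <= 1.
Proof. by apply: prodr_ile1 => b _; rewrite subr_ge0 step_le1/= lerBlDr lerDl step_ge0. Qed.

Let up_ge0 j x : 0 <= up j x.
Proof. by apply: prodr_ge0 => b _; exact: step_ge0. Qed.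

Let lo_bball j x : lo j x <= bb x.
Proof.
apply: ler_prod => b Pb; rewrite subr_ge0 step_le1/=.
have [_|lt] := leP (bn b x) (a b); first by rewrite lerBlDr lerDl step_ge0.
rewrite step1 ?subrr// subr_le0 (le_trans _ (ltW lt))//.
by rewrite ler_piMr ?(ltW (a_gt0 Pb))// lerBlDr lerDl ltW.
Qed.

Let bball_up j x : bb x <= up j x.
Proof.
apply: ler_prod => b Pb; rewrite ler0n/=.
have [le|_] := leP (bn b x) (a b); last exact: step_ge0.
rewrite step1// subr_le0 (le_trans le)// ler_peMr ?(ltW (a_gt0 Pb))//.
by rewrite lerDl ltW.
Qed.

Let up_cvg x : (forall b, P b -> bn b x != a b) -> up j x @[j --> \oo] --> bb x.
Proof.
move=> nx; apply: cvg_bigprod => b Pb.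
have [le|lt] := leP (bn b x) (a b).
  rewrite (_ : (fun j => _) = fun=> (1 : R)); first exact: cvg_cst.
  apply/funext => j; rewrite step1// subr_le0 (le_trans le)// ler_peMr ?(ltW (a_gt0 Pb))//.
  by rewrite lerDl ltW.
apply: (@step_cvg0 _ _ ((bn b x - a b) / 2)); first by lra.
have : a b * (1 + ej j) @[j --> \oo] --> a b.
  rewrite -[X in _ --> X]mulr1 -{2}[1]addr0.
  by apply: cvgM; [exact: cvg_cst|apply: cvgD; [exact: cvg_cst|exact: ej_cvg]].
have d0 : 0 < (bn b x - a b) / 2 by lra.
move=> /cvgrPdist_le/(_ _ d0); apply: filterS => j.
by rewrite ler_norml => /andP[? ?]; lra.
Qed.

Let lo_cvg x : (forall b, P b -> bn b x != a b) -> lo j x @[j --> \oo] --> bb x.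
Proof.
move=> nx; apply: cvg_bigprod => b Pb.
have [le|lt] := leP (bn b x) (a b); last first.
  rewrite (_ : (fun j => _) = fun=> (0 : R)); first exact: cvg_cst.
  apply/funext => j; rewrite step1 ?subrr// subr_le0 (le_trans _ (ltW lt))//.
  by rewrite ler_piMr ?(ltW (a_gt0 Pb))// lerBlDr lerDl ltW.
have lt : bn b x < a b by rewrite lt_neqAle nx.
rewrite -[X in _ --> X]subr0; apply: cvgB; first exact: cvg_cst.
apply: (@step_cvg0 _ _ ((a b - bn b x) / 2)); first by lra.
have : a b * (1 - ej j) @[j --> \oo] --> a b.
  rewrite -[X in _ --> X]mulr1 -{2}[1]subr0.
  by apply: cvgM; [exact: cvg_cst|apply: cvgB; [exact: cvg_cst|exact: ej_cvg]].
have d0 : 0 < (a b - bn b x) / 2 by lra.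
move=> /cvgrPdist_le/(_ _ d0); apply: filterS => j.
by rewrite ler_norml => /andP[? ?]; lra.
Qed.

Let gap j x : R := up j x - lo j x.

Let bcont_gap j : bcont (gap j).
Proof. by apply: bcontD; [exact: bcont_up|apply: bcontN; exact: bcont_lo]. Qed.

Let gap_ge0 j x : 0 <= gap j x.
Proof. by rewrite subr_ge0 (le_trans (lo_bball j x))// bball_up. Qed.

Let gap_le1 j x : gap j x <= 1.
Proof. by rewrite lerBlDr (le_trans (up_le1 j x))// lerDl lo_ge0. Qed.

Let offs (x : 'cV[R]_m) : R := \prod_(b | P b) (1 - sph b x).

Let bmeas_offs : bmeas (fun t : m.-tuple R => offs (tcol t)).
Proof.
apply: bmeas_prod => b _; apply: bmeasD; first exact: bmeas_cst.
rewrite (_ : (fun t => _) = (fun t : m.-tuple R => -1 * sph b (tcol t))).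
  by apply: bmeasM; [exact: bmeas_cst|exact: bmeas_sph].
by apply/funext => t; rewrite mulN1r.
Qed.

Let offs01 x : 0 <= offs x <= 1.
Proof.
apply/andP; split; [apply: prodr_ge0 => b _|apply: prodr_ile1 => b _].
  by rewrite subr_ge0 /sph lern1 leq_b1.
by rewrite subr_ge0 /sph lern1 leq_b1/= lerBlDr lerDl ler0n.
Qed.

Let gauss_gap_cvg : gaussE (fun t : m.-tuple R => gap j (tcol t)) @[j --> \oo] --> 0.
Proof.
have g0 : gaussE (fun t : m.-tuple R => gap j (tcol t) * offs (tcol t)) @[j --> \oo] --> 0.
  rewrite -[X in _ --> X](gaussE_cst m 0); apply: (@gaussE_cvg _ _ _ _ 1).
  - move=> j; have [] // : bmeas (fun t : m.-tuple R => gap j (tcol t) * offs (tcol t)).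
    by apply: bmeasM => //; exact: bmeas_tcol.
  - move=> j t; have /andP[? ?] := offs01 (tcol t).
    by rewrite ger0_norm ?mulr_ge0// mulr_ile1.
  - move=> t; have [/existsP[b /andP[Pb sb]]|] := boolP [exists b, P b && (bn b (tcol t) == a b)].
      rewrite (_ : (fun j => _) = fun=> (0 : R)); first exact: cvg_cst.
      by apply/funext => j; rewrite /offs (bigD1 b)//= /sph sb subrr mul0r mulr0.
    rewrite negb_exists => /forallP nb.
    have nx b : P b -> bn b (tcol t) != a b by move=> Pb; have := nb b; rewrite Pb.
    rewrite -[X in _ --> X](mul0r (offs (tcol t))); apply: cvgM; last exact: cvg_cst.
    rewrite -[X in _ --> X](subrr (bb (tcol t))).
    by apply: cvgB; [exact: up_cvg|exact: lo_cvg].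
have ub j : gaussE (fun t : m.-tuple R => gap j (tcol t)) <=
            gaussE (fun t : m.-tuple R => gap j (tcol t) * offs (tcol t)).
  have bs_s0 (r : seq B) : bmeas (fun t : m.-tuple R => \sum_(b <- r | P b) sph b (tcol t)) /\
      gaussE (fun t : m.-tuple R => \sum_(b <- r | P b) sph b (tcol t)) = 0.
    elim: r => [|b r [br gr]].
      rewrite (_ : (fun t => _) = fun=> 0); last by apply/funext => t; rewrite big_nil.
      by split; [exact: bmeas_cst|rewrite gaussE_cst].
    have [Pb|nPb] := boolP (P b); last first.
      rewrite (_ : (fun t => _) = fun t : m.-tuple R => \sum_(b <- r | P b) sph b (tcol t))//.
      by apply/funext => t; rewrite big_cons (negbTE nPb).
    rewrite (_ : (fun t => _) = fun t : m.-tuple R => sph b (tcol t) + \sum_(b <- r | P b) sph b (tcol t)).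
      by split; [exact: bmeasD|rewrite gaussED// gauss_sph// gr addr0].
    by apply/funext => t; rewrite big_cons Pb.
  have [bs s0] := bs_s0 (index_enum B).
  have bg : bmeas (fun t : m.-tuple R => gap j (tcol t) * offs (tcol t)).
    by apply: bmeasM => //; exact: bmeas_tcol.
  rewrite -[leRHS]addr0 -s0 -gaussED//; apply: ler_gaussE.
  - exact: bmeas_tcol.
  - exact: bmeasD.
  move=> t; have [/existsP[b /andP[Pb sb]]|] := boolP [exists b, P b && (bn b (tcol t) == a b)].
    have sE : sph b (tcol t) = 1 by rewrite /sph sb.
    rewrite (le_trans (gap_le1 j _))// (bigD1 b)//= sE addrCA lerDl addr_ge0//.
      by rewrite mulr_ge0//; have /andP[] := offs01 (tcol t).
    by apply: sumr_ge0 => d _; rewrite ler0n.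
  rewrite negb_exists => /forallP nb.
  rewrite /offs big1 => [|b Pb]; last first.
    by have := nb b; rewrite Pb/= /sph => /negbTE ->; rewrite subr0.
  by rewrite mulr1 lerDl; apply: sumr_ge0 => d _; rewrite ler0n.
apply: (squeeze_cvgr _ (cvg_cst 0) g0).
near=> j; rewrite ub andbT.
rewrite -[leLHS](gaussE_cst m 0); apply: ler_gaussE; [exact: bmeas_cst|exact: bmeas_tcol|].
by move=> t; exact: gap_ge0.
Unshelve. all: by end_near. Qed.

Variables (Q : finType) (N : nat -> nat) (nq : nat -> Q -> nat).
Variables (X : forall k, {ffun 'I_(N k) -> Q} -> 'cV[R]_m).
Variables (acc : forall k, {ffun 'I_(N k) -> Q} -> bool) (A : 'M[R]_m).
Hypothesis A_bnorm : forall b x, P b -> bn b (A *m x) = bn b x.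
Hypothesis X_cvg : forall G, bcont G ->
  avg (nq k) (fun Z : {ffun 'I_(N k) -> Q} => G (X Z)) @[k --> \oo] --> gaussE (fun t : m.-tuple R => G (A *m tcol t)).
Hypothesis acc_ball : forall e : R, 0 < e -> \forall k \near \oo, forall Z : {ffun 'I_(N k) -> Q},
  (acc Z -> forall b, P b -> bn b (X Z) <= a b * (1 + e)) /\
  (~~ @acc k Z -> exists2 b, P b & a b * (1 - e) <= bn b (X Z)).

(* The acceptance region is squeezed between two continuous functions of the
   limiting coordinates, which differ by little since spheres are null sets. *)
Theorem avg_accepted_cvg G : bcont G ->
  avg (nq k) (fun Z : {ffun 'I_(N k) -> Q} => G (X Z) * (acc Z)%:R) @[k --> \oo] -->
  gaussE (fun t : m.-tuple R => G (A *m tcol t) * bb (tcol t)).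
Proof.
move=> cG; have [_ [M0 GM0]] := cG.
pose M := `|M0| + 1.
have M_gt0 : 0 < M by rewrite ltr_pwDr.
have GM x : `|G x| <= M by rewrite (le_trans (GM0 x))// /M (le_trans (ler_norm M0))// lerDl.
have upA j x : up j (A *m x) = up j x by apply: eq_bigr => b Pb; rewrite A_bnorm.
have loA j x : lo j (A *m x) = lo j x by apply: eq_bigr => b Pb; rewrite A_bnorm.
apply/cvgrPdist_le => e e0.
pose d := e / (4 * M).
have d0 : 0 < d by rewrite divr_gt0// mulr_gt0.
have [j gj] : exists j, gaussE (fun t : m.-tuple R => gap j (tcol t)) <= d.
  have := gauss_gap_cvg; move=> /cvgrPdist_le/(_ d d0) [j _ /(_ j (leqnn j))].
  by rewrite sub0r normrN => h; exists j; apply: le_trans (ler_norm _) h.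
have cGu : bcont (fun x => G x * up j x) by exact: bcontM.
have c1 := X_cvg cGu; have c2 := X_cvg (bcont_gap j).
have gA : gaussE (fun t : m.-tuple R => gap j (A *m tcol t)) = gaussE (fun t : m.-tuple R => gap j (tcol t)).
  by congr gaussE; apply/funext => t; rewrite /gap upA loA.
have e4 : 0 < e / 4 by rewrite divr_gt0.
move/cvgrPdist_le/(_ _ e4) : c1 => n1; move/cvgrPdist_le/(_ _ d0) : c2; rewrite gA => n2.
have n3 := acc_ball (ej_gt0 j).
set lim := gaussE (fun t => G (A *m tcol t) * bb (tcol t)).
set lu := gaussE (fun t => G (A *m tcol t) * up j (A *m tcol t)) in n1.
have bA f : bcont f -> bmeas (fun t : m.-tuple R => f (A *m tcol t)).
  by move=> cf; apply: (bmeas_tcol (f := fun x => f (A *m x))); exact: bcont_mulmx.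
have bgap : bmeas (fun t : m.-tuple R => M * gap j (tcol t)).
  by apply: bmeasM; [exact: bmeas_cst|exact: bmeas_tcol].
have bl : bmeas (fun t : m.-tuple R => G (A *m tcol t) * bb (tcol t)).
  by apply: bmeasM; [exact: bA|exact: bmeas_bball].
have blu : bmeas (fun t : m.-tuple R => G (A *m tcol t) * up j (A *m tcol t)) := bA _ cGu.
have Md : M * d = e / 4 by rewrite /d; field; rewrite gt_eqF.
have gle : M * gaussE (fun t : m.-tuple R => gap j (tcol t)) <= e / 4.
  by rewrite -Md ler_pM2l.
have ptw (g y u l : R) : `|g| <= M -> l <= y -> y <= u -> g * y <= g * u + M * (u - l) /\ g * u <= g * y + M * (u - l).
  rewrite ler_norml => /andP[h1 h2] ly yu; split; nra.
have lim_lu : lim <= lu + e / 4 /\ lu <= lim + e / 4.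
  split; rewrite (le_trans _ (lerD (lexx _) gle))//.
    rewrite -(gaussEZ M (bmeas_tcol (bcont_gap j))) -gaussED//; apply: ler_gaussE => //.
      exact: bmeasD.
    by move=> t; rewrite upA; have [] := ptw _ _ _ _ (GM (A *m tcol t)) (lo_bball j (tcol t)) (bball_up j (tcol t)).
  rewrite -(gaussEZ M (bmeas_tcol (bcont_gap j))) -gaussED//; apply: ler_gaussE => //.
    exact: bmeasD.
  by move=> t; rewrite upA; have [] := ptw _ _ _ _ (GM (A *m tcol t)) (lo_bball j (tcol t)) (bball_up j (tcol t)).
near=> k.
have h1 : `|lu - avg (nq k) (fun Z : {ffun 'I_(N k) -> Q} => G (X Z) * up j (X Z))| <= e / 4 by near: k.
have h2 : `|gaussE (fun t => gap j (tcol t)) - avg (nq k) (fun Z : {ffun 'I_(N k) -> Q} => gap j (X Z))| <= d by near: k.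
have h3 : forall Z : {ffun 'I_(N k) -> Q}, (@acc k Z -> forall b, P b -> bn b (X Z) <= a b * (1 + ej j)) /\
  (~~ @acc k Z -> exists2 b, P b & a b * (1 - ej j) <= bn b (X Z)) by near: k.
have lo_acc Z : lo j (X Z) <= (@acc k Z)%:R.
  have [_ h] := h3 Z; case: (boolP (acc Z)) => [_|/h[b Pb le]]; first exact: lo_le1.
  by rewrite /lo (bigD1 b)//= step1 ?subr_le0// subrr mul0r.
have acc_up Z : (@acc k Z)%:R <= up j (X Z).
  have [h _] := h3 Z; case: (boolP (acc Z)) => [/h {}h|_]; last exact: up_ge0.
  by rewrite /up big1// => b Pb; rewrite step1// subr_le0 h.
have a1 : avg (nq k) (fun Z : {ffun 'I_(N k) -> Q} => G (X Z) * (acc Z)%:R) <=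
          avg (nq k) (fun Z : {ffun 'I_(N k) -> Q} => G (X Z) * up j (X Z)) + M * avg (nq k) (fun Z : {ffun 'I_(N k) -> Q} => gap j (X Z)).
  rewrite -avgZ -avgD; apply: ler_avg => Z _.
  by have [] := ptw _ _ _ _ (GM (X Z)) (lo_acc Z) (acc_up Z).
have a2 : avg (nq k) (fun Z : {ffun 'I_(N k) -> Q} => G (X Z) * up j (X Z)) <=
          avg (nq k) (fun Z : {ffun 'I_(N k) -> Q} => G (X Z) * (acc Z)%:R) + M * avg (nq k) (fun Z : {ffun 'I_(N k) -> Q} => gap j (X Z)).
  rewrite -avgZ -avgD; apply: ler_avg => Z _.
  by have [] := ptw _ _ _ _ (GM (X Z)) (lo_acc Z) (acc_up Z).
have a3 : M * avg (nq k) (fun Z : {ffun 'I_(N k) -> Q} => gap j (X Z)) <= e / 4 + e / 4.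
  rewrite -{1}Md -Md -mulrDr ler_pM2l//.
  by move: h2; rewrite ler_norml => /andP[? ?]; lra.
case: lim_lu => l1 l2; move: h1; rewrite !ler_norml => /andP[? ?].
by apply/andP; split; lra.
Unshelve. all: by end_near. Qed.

End ConditionalLimit.

(** * Joint limit under complete randomization *)

Section JointLimit.
Context {R : realType} (K : nat).
Variables (iota : 'I_(2 ^ K) -> {ffun 'I_K -> bool}) (eff : 'I_(2 ^ K).-1 -> {set 'I_K}).
Local Notation Q := (2 ^ K)%N.
Local Notation F := (2 ^ K).-1.
Variables (H : nat) (tier : 'I_F -> 'I_H) (L : nat) (N : nat -> nat).
Variables (Y : forall k : nat, 'I_(N k) -> 'I_Q -> R) (x : forall k : nat, 'I_(N k) -> 'cV[R]_L).
Variable nq : nat -> 'I_Q -> nat.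
Local Notation FT := (Ftier tier).
Local Notation T := (Tdim tier L).
Local Notation dm h := (#|FT h| * L)%N.

Hypothesis iota_bij : bijective iota.
Hypothesis eff_inj : injective eff.
Hypothesis eff_neq0 : forall f, eff f != finset.set0.
Hypothesis N_infty : forall M : nat, exists k0 : nat, forall k, (k0 <= k)%N -> (M <= N k)%N.
Hypothesis N1_gt0 : forall k, (0 < (N k).-1)%N.
Hypothesis nq_gt0 : forall k q, (0 < nq k q)%N.
Hypothesis sum_nq : forall k, (\sum_q nq k q)%N = N k.

Local Notation wn k := (@invprop R K (N k) (nq k)).
Variables (wt : 'I_Q -> R) (Sy : 'I_Q -> 'I_Q -> R) (Sx : 'M[R]_L) (Sc : 'I_Q -> 'rV[R]_L).
Hypothesis wt_gt0 : forall q, 0 < wt q.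
Hypothesis wt_cvg : forall q, wn k q @[k --> \oo] --> wt q.
Hypothesis Sy_cvg : forall q r, Sqk (@Y k) q r @[k --> \oo] --> Sy q r.
Hypothesis Sx_cvg : mcvg (fun k => Sxx (@x k)) Sx.
Hypothesis Sc_cvg : forall q, mcvg (fun k => Sqx (@Y k) (@x k) q) (Sc q).
Hypothesis Sxx_unit : forall k, Sxx (@x k) \in unitmx.
Hypothesis Sx_unit : Sx \in unitmx.
Hypothesis Y_lindeberg : forall q,
  (\big[Num.max/0]_i (@Y k i q - Ybar (@Y k) q) ^+ 2) / (N k)%:R @[k --> \oo] --> (0 : R).
Hypothesis x_lindeberg :
  (\big[Num.max/0]_i \sum_j ((@x k i - xbar (@x k)) j 0) ^+ 2) / (N k)%:R @[k --> \oo] --> (0 : R).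

Variables (Vt : 'M[R]_F) (Rt : forall h, 'M[R]_(dm h)).
Hypothesis VtE : Vt *m Vt^T = Vres iota eff wt Sy Sx Sc.
Hypothesis RtE : forall h, Rt h *m (Rt h)^T = Wxw iota eff tier wt Sx h.

Let N_gt0 k : (0 < N k)%N.
Proof. by have := N1_gt0 k; case: (N k). Qed.

Let wn_gt0 k q : 0 < wn k q.
Proof. exact: invprop_gt0. Qed.

Let wt1 : \sum_q (wt q)^-1 = 1.
Proof.
have : \sum_q (wn k q)^-1 @[k --> \oo] --> \sum_q (wt q)^-1.
  by apply: cvg_bigsum => q _; apply: cvgV; rewrite ?gt_eqF.
rewrite (_ : (fun k => _) = fun=> 1); last by apply/funext => k; exact: sum_invprop.
by move=> c; have := cvg_unique _ c (cvg_cst (1 : R)); apply.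
Qed.

Let symSx : Sx^T = Sx.
Proof.
apply/matrixP => i j; rewrite mxE.
have c1 := Sx_cvg (i := j) (j := i); have c2 := Sx_cvg (i := i) (j := j).
rewrite (_ : (fun k => Sxx (@x k) i j) = fun k => Sxx (@x k) j i) in c2; last first.
  apply/funext => k; have h : (Sxx (@x k))^T = Sxx (@x k) by exact: fpcov_tr.
  by rewrite -{1}h mxE.
by have := cvg_unique _ c1 c2; apply.
Qed.

Let Wxw_unit_lim h : Wxw iota eff tier wt Sx h \in unitmx.
Proof. exact: Wxw_unit. Qed.

Let Rt_unit h : Rt h \in unitmx.
Proof. by have := Wxw_unit_lim h; rewrite -RtE unitmx_mul => /andP[]. Qed.

Let Ct h : 'M[R]_(F, dm h) := Wtw iota eff tier wt Sc h *m (invmx (Rt h))^T.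

Definition jointX k (Z : {ffun 'I_(N k) -> 'I_Q}) : 'cV[R]_T :=
  glue (Num.sqrt (N k)%:R *: (tauhat iota eff (@Y k) (nq k) Z - tau iota eff (@Y k)))
    (fun h => invmx (Rt h) *m (Num.sqrt (N k)%:R *: theta_x iota eff tier (@x k) (nq k) Z h)).

Definition jointA : 'M[R]_T :=
  Emx tier L *m Vt *m (Emx tier L)^T
  + \sum_h (Emx tier L *m Ct h + Dmx tier L h) *m (Dmx tier L h)^T.

Lemma jointA_E : (Emx tier L)^T *m jointA =
  Vt *m (Emx tier L)^T + \sum_h Ct h *m (Dmx tier L h)^T.
Proof.
rewrite mulmxDr !mulmxA EmxK mul1mx mulmx_sumr; congr (_ + _); apply: eq_bigr => h _.
by rewrite mulmxA mulmxDr mulmxA EmxK mul1mx Emx_Dmx addr0.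
Qed.

Lemma jointA_D h : (Dmx tier L h)^T *m jointA = (Dmx tier L h)^T.
Proof.
rewrite mulmxDr !mulmxA Dmx_Emx !mul0mx add0r mulmx_sumr (bigD1 h)//=.
rewrite mulmxA mulmxDr mulmxA Dmx_Emx mul0mx add0r DmxK mul1mx big1 ?addr0// => l lh.
by rewrite mulmxA mulmxDr mulmxA Dmx_Emx mul0mx add0r Dmx_orth ?mul0mx// eq_sym.
Qed.

Let sv (s : 'cV[R]_T) : 'cV[R]_F := (Emx tier L)^T *m s.
Let sU (s : 'cV[R]_T) h : 'M[R]_(#|FT h|, L) :=
  umx ((invmx (Rt h))^T *m ((Dmx tier L h)^T *m s)).

Let jointA_tr s : jointA^T *m s =
  glue (Vt^T *m sv s) (fun h => (Ct h)^T *m sv s + (Dmx tier L h)^T *m s).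
Proof.
rewrite /jointA /glue linearD/= mulmxDl; congr (_ + _).
  by rewrite !trmx_mul trmxK !mulmxA.
rewrite linear_sum/= mulmx_suml; apply: eq_bigr => h _.
rewrite trmx_mul trmxK linearD/= trmx_mul -mulmxA; congr (_ *m _).
by rewrite mulmxDl mulmxA.
Qed.

Lemma jointA_nsq s : nsq (jointA^T *m s) = totvar iota eff wt Sy Sx Sc (sv s) (sU s).
Proof.
rewrite (totvar_split Sy Sc iota_bij eff_inj eff_neq0 wt_gt0 symSx Sx_unit _ _ wt1).
rewrite jointA_tr nsq_glue; congr (_ + _).
  by rewrite nsq_mul trmxK VtE.
apply: eq_bigr => h _.
have projE : projv iota eff wt Sx Sc (sv s) (sU s) h =
    Rt h *m ((Ct h)^T *m sv s + (Dmx tier L h)^T *m s).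
  rewrite /projv /sU umxK -RtE mulmxDr; congr (_ + _).
    by rewrite /Ct trmx_mul trmxK !mulmxA mulmxV// mul1mx.
  by rewrite !mulmxA -(mulmxA (Rt h)) -trmx_mul mulVmx// trmx1 mulmx1.
rewrite projE -RtE; move: (_ + _) => y.
have -> : invmx (Rt h *m (Rt h)^T) = (invmx (Rt h))^T *m invmx (Rt h).
  apply: (can_inj (mulKmx (_ : Rt h *m (Rt h)^T \in unitmx))).
    by rewrite unitmx_mul unitmx_tr Rt_unit.
  rewrite mulmxV ?unitmx_mul ?unitmx_tr ?Rt_unit//.
  by rewrite mulmxA -(mulmxA (Rt h)) -trmx_mul mulVmx// trmx1 mulmx1 mulmxV.
rewrite trmx_mul /nsq; congr (fun_of_matrix _ 0 0).
by rewrite !mulmxA -(mulmxA y^T) -trmx_mul mulVmx// trmx1 mulmx1 -(mulmxA _ (invmx _)) mulVmx// mulmx1.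
Qed.

Local Notation am k s := (amat iota eff (@Y k) (@x k) (nq k) (sv s) (sU s)).

Let ex_sizes k : exists Z : {ffun 'I_(N k) -> 'I_Q}, has_sizes (nq k) Z.
Proof. exact: ex_has_sizes. Qed.

Let dot_jointX k s (Z : {ffun 'I_(N k) -> 'I_Q}) : has_sizes (nq k) Z ->
  dotv s (jointX Z) = lstat (am k s) Z.
Proof.
move=> hZ; rewrite lstat_amat// dotvE dot_glue mulrDr; congr (_ + _).
  by rewrite -scalemxAr mxE.
rewrite mulr_sumr; apply: eq_bigr => h _.
have -> : vmx (sU s h) = (invmx (Rt h))^T *m ((Dmx tier L h)^T *m s) by exact: umxK.
by rewrite -scalemxAr -scalemxAr [LHS]mxE (trmx_mul (invmx (Rt h))^T) trmxK mulmxA.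
Qed.

Let msq_cvg s : msq (nq k) (am k s) @[k --> \oo] --> nsq (jointA^T *m s).
Proof.
rewrite jointA_nsq (_ : (fun k => _) = fun k => ((N k).-1%:R / (N k)%:R) *
  totvar iota eff (wn k) (Sqk (@Y k)) (Sxx (@x k)) (Sqx (@Y k) (@x k)) (sv s) (sU s)); last first.
  by apply/funext => k; exact: msq_amat.
rewrite -[X in _ --> X]mul1r; apply: cvgM; last first.
  exact: (totvar_cvg iota_bij eff_inj wn_gt0 wt_gt0 wt_cvg Sy_cvg Sx_cvg Sc_cvg).
rewrite (_ : (fun k => _) = fun k => 1 - (N k)%:R^-1); last first.
  apply/funext => k; rewrite -subn1 natrB// mulrBl mul1r mulfV// pnatr_eq0 -lt0n.
  exact: N_gt0.
rewrite -[X in _ --> X]subr0; apply: cvgB; first exact: cvg_cst.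
apply/cvgrPdist_le => e e0.
have [M hM] : exists M : nat, e^-1 <= M%:R by exists (Num.truncn e^-1).+1; rewrite ltW// truncnS_gt.
have [k0 hk0] := N_infty M; exists k0 => // k /= k0k.
rewrite sub0r normrN ger0_norm ?invr_ge0// -[e]invrK lef_pV2 ?posrE ?invr_gt0 ?ltr0n//.
by rewrite (le_trans hM)// ler_nat hk0.
Qed.

Local Notation mY k q := ((\big[Num.max/0]_i (@Y k i q - Ybar (@Y k) q) ^+ 2) / (N k)%:R).
Local Notation mX k := ((\big[Num.max/0]_i \sum_j ((@x k i - xbar (@x k)) j 0) ^+ 2) / (N k)%:R).

Let dl k s : R := amat_bd iota eff (N k) (nq k) (sv s) (sU s) (fun q => mY k q) (mX k) + k.+1%:R^-1.

Let amat_bd_ge0 k s : 0 <= amat_bd iota eff (N k) (nq k) (sv s) (sU s) (fun q => mY k q) (mX k).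
Proof.
apply: sumr_ge0 => q _; rewrite mulr_ge0//; first by have := wn_gt0 k q; lra.
by rewrite addr_ge0// mulr_ge0 ?sqrtr_ge0//; apply: sumr_ge0.
Qed.

Let am_le k s i q : `|am k s i q| <= dl k s.
Proof.
have n0 : 0 <= (N k)%:R^-1 :> R by rewrite invr_ge0.
rewrite (le_trans (amat_le _ _ _ _ _ _ (mY := fun q => mY k q) (mX := mX k) _ _ _ _))//.
- by move=> i' q'; rewrite ler_wpM2r//; exact: (le_bigmax 0 (fun i => (@Y k i q' - Ybar (@Y k) q') ^+ 2)).
- by move=> i'; rewrite ler_wpM2r//; exact: (le_bigmax 0 (fun i => \sum_j ((@x k i - xbar (@x k)) j 0) ^+ 2)).
- by rewrite /dl lerDl invr_ge0.
Qed.

Let dl_cvg s : dl k s @[k --> \oo] --> 0.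
Proof.
have sq0 (u : nat -> R) : u k @[k --> \oo] --> 0 -> Num.sqrt (u k) @[k --> \oo] --> 0.
  move=> u0; rewrite -[X in _ --> X](@sqrtr0 R).
  exact: (cvg_comp u Num.sqrt u0 (@sqrt_continuous R 0)).
rewrite -[X in _ --> X]addr0; apply: cvgD; last exact: cvg_harmonic.
rewrite [X in _ --> X](_ : 0 = \sum_q (wt q + 1) * (`|ycoef iota eff (sv s) q| * 0
    + (\sum_l `|xcoef iota eff wt (sU s) q 0 l|) * 0)); last first.
  by rewrite big1// => q _; rewrite !mulr0 addr0 mulr0.
apply: cvg_bigsum => q _; apply: cvgM.
  by apply: cvgD => //; exact: cvg_cst.
apply: cvgD; apply: cvgM.
- exact: cvg_cst.
- by apply: sq0; exact: Y_lindeberg.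
- apply: cvg_bigsum => l _; apply: cvg_norm.
  exact: (xcoef_cvg iota_bij eff_inj (wt_ := fun k => wn k) wn_gt0 wt_gt0 wt_cvg).
- exact: sq0.
Qed.

Let cos_cvg s c :
  avg (nq k) (fun Z : {ffun 'I_(N k) -> 'I_Q} => cosdot s c (jointX Z)) @[k --> \oo] -->
  gaussE (fun t : T.-tuple R => cosdot s c (jointA *m tcol t)).
Proof.
have -> : gaussE (fun t : T.-tuple R => cosdot s c (jointA *m tcol t)) =
    cos c * expR (- (nsq (jointA^T *m s) / 2)).
  rewrite nsqE -gaussE_cosdot; congr gaussE; apply/funext => t.
  by rewrite cosdot_mulmx.
rewrite (_ : (fun k => _) = fun k => avg (nq k) (fun Z : {ffun 'I_(N k) -> 'I_Q} => cos (lstat (am k s) Z + c))); last first.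
  by apply/funext => k; apply: eq_avg => Z hZ; rewrite /cosdot dot_jointX.
pose m k := msq (nq k) (am k s); pose g := nsq (jointA^T *m s).
have mg : m k @[k --> \oo] --> g by exact: msq_cvg.
have m2 : m k / 2 @[k --> \oo] --> g / 2 by apply: cvgM => //; exact: cvg_cst.
have main : cos c * expR (- (m k / 2)) @[k --> \oo] --> cos c * expR (- (g / 2)).
  apply: cvgM; first exact: cvg_cst.
  by apply: (cvg_comp (fun k => - (m k / 2)) expR _ (@continuous_expR R _)); exact: cvgN.
have err : expR (m k / 2) * stein_err 'I_Q (m k) (dl k s) @[k --> \oo] --> 0.
  rewrite -[X in _ --> X](mulr0 (expR (g / 2))); apply: cvgM.
    exact: (cvg_comp (fun k => m k / 2) expR m2 (@continuous_expR R _)).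
  rewrite /stein_err.
  have d0 : dl k s @[k --> \oo] --> 0 by exact: dl_cvg.
  have d2 : dl k s ^+ 2 @[k --> \oo] --> 0.
    by rewrite -[X in _ --> X](mulr0 0); under eq_fun do rewrite expr2; exact: cvgM.
  rewrite [X in _ --> X](_ : 0 = 17 * 0 * g + 0 / 4 + 2 * 0 + 2 * #|'I_Q|%:R * 0); last by ring.
  apply: cvgD; first apply: cvgD; first apply: cvgD.
  - by apply: cvgM => //; apply: cvgM => //; exact: cvg_cst.
  - by apply: cvgM => //; exact: cvg_cst.
  - by apply: cvgM => //; exact: cvg_cst.
  - by apply: cvgM => //; exact: cvg_cst.
have bd k : `|avg (nq k) (fun Z : {ffun 'I_(N k) -> 'I_Q} => cos (lstat (am k s) Z + c)) - cos c * expR (- (m k / 2))|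
    <= expR (m k / 2) * stein_err 'I_Q (m k) (dl k s).
  have dl0 : 0 < dl k s by rewrite /dl ltr_wpDl.
  exact: (cos_clt_bound c (N_gt0 k) (ex_sizes k)
    (amat_row0 iota eff (@Y k) (@x k) (N_gt0 k) (nq_gt0 k) (sum_nq k) (sv s) (sU s))
    (amat_col0 iota eff (@Y k) (@x k) (nq k) (N_gt0 k) (sv s) (sU s)) dl0 (@am_le k s)).
have tri (l u v w e : R) : `|l - u| <= e / 2 -> `|0 - w| <= e / 2 -> `|v - u| <= w -> `|l - v| <= e.
  rewrite sub0r normrN !ler_norml => /andP[? ?] /andP[? ?] /andP[? ?].
  by apply/andP; split; lra.
apply/cvgrPdist_le => e e0; have e2 : 0 < e / 2 by rewrite divr_gt0.
move/cvgrPdist_le/(_ _ e2) : main => n1; move/cvgrPdist_le/(_ _ e2) : err => n2.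
near=> k.
have h1 : `|cos c * expR (- (g / 2)) - cos c * expR (- (m k / 2))| <= e / 2 by near: k.
have h2 : `|0 - expR (m k / 2) * stein_err 'I_Q (m k) (dl k s)| <= e / 2 by near: k.
exact: tri h1 h2 (bd k).
Unshelve. all: by end_near. Qed.

Let escape_anti p (M M' : R) (v : 'cV[R]_p) : 0 < M -> M <= M' -> escape M' v <= escape M v.
Proof.
move=> M0 MM'; have M'0 := lt_le_trans M0 MM'.
apply: ler_sum => j _; rewrite ler_wpM2l ?sqr_ge0//.
have dp (y : R) : 0 < y -> y ^+ 2 + v j 0 ^+ 2 \is Num.pos.
  by move=> y0; rewrite posrE ltr_wpDr ?sqr_ge0// exprn_gt0.
by rewrite lef_pV2 ?dp// lerD2r ler_pXn2r ?nnegrE// ltW.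
Qed.

(* Every linear functional of [jointX] is a linear statistic of the assignment,
   so [cos_clt_bound] gives the convergence of characteristic functions. *)
Theorem joint_clt G : bcont G ->
  avg (nq k) (fun Z : {ffun 'I_(N k) -> 'I_Q} => G (jointX Z)) @[k --> \oo] -->
  gaussE (fun t : T.-tuple R => G (jointA *m tcol t)).
Proof.
pose E_ k (f : 'cV[R]_T -> R) := avg (nq k) (fun Z : {ffun 'I_(N k) -> 'I_Q} => f (jointX Z)).
pose E (f : 'cV[R]_T -> R) := gaussE (fun t : T.-tuple R => f (jointA *m tcol t)).
apply: (levy_continuity (E_ := E_) (E := E)); last exact: cos_cvg.
- move=> k; split=> [|f g _ _|c f _|f g _ _ fg].
  + exact: avg_cst.
  + exact: avgD.
  + exact: avgZ.
  + by apply: ler_avg => Z _; exact: fg.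
- have := @expectation_gauss R T T jointA (fun=> 1) (bmeas_cst _ 1) (fun=> ler01).
  rewrite gaussE_cst => /(_ ltr01).
  rewrite (_ : (fun f => _) = E)//; apply/funext => f; rewrite divr1 /E; congr gaussE.
  by apply/funext => t; rewrite mulr1.
move=> e e0.
pose B := \sum_j 4 * nsq (jointA^T *m delta_mx j 0) + 1.
have B0 : 0 < B by rewrite ltr_wpDl// sumr_ge0// => j _; rewrite mulr_ge0// nsq_ge0.
pose C := \sum_i \sum_j `|jointA i j|.
have C0 : 0 <= C by apply: sumr_ge0 => i _; apply: sumr_ge0.
have [M1 M10 hM1] := gauss_escape T T C0 e0.
pose M := M1 + Num.sqrt (B / e) .
have q0 : 0 < Num.sqrt (B / e) by rewrite sqrtr_gt0 divr_gt0.
have M0 : 0 < M by rewrite addr_gt0.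
exists M => //; split; last first.
  apply: (le_trans _ (hM1 jointA _)).
    apply: ler_gaussE.
    - by apply: (bmeas_tcol (f := fun y => escape M (jointA *m y))); apply: bcont_mulmx; exact: bcont_escape.
    - by apply: (bmeas_tcol (f := fun y => escape M1 (jointA *m y))); apply: bcont_mulmx; exact: bcont_escape.
    - by move=> t; apply: escape_anti => //; rewrite lerDl ltW.
  move=> i j; rewrite /C (bigD1 i)//= (bigD1 j)//= -addrA lerDl addr_ge0//; apply: sumr_ge0 => // *.
  exact: sumr_ge0.
have cB : \sum_j 4 * msq (nq k) (am k (delta_mx j 0)) @[k --> \oo] --> \sum_j 4 * nsq (jointA^T *m delta_mx j 0).
  by apply: cvg_bigsum => j _; apply: cvgM; [exact: cvg_cst|exact: msq_cvg].
move/cvgrPdist_le/(_ _ ltr01) : cB; apply: filterS => k hk.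
have sB : \sum_j 4 * msq (nq k) (am k (delta_mx j 0)) <= B.
  by rewrite /B; move: hk; rewrite ler_norml => /andP[? ?]; lra.
have M2 : (M ^+ 2)^-1 * B <= e.
  rewrite mulrC ler_pdivrMr ?exprn_gt0// mulrC -ler_pdivrMr//.
  rewrite -[leLHS]sqr_sqrtr ?divr_ge0 ?(ltW B0) ?(ltW e0)//.
  by rewrite ler_pXn2r ?nnegrE ?(ltW q0) ?(ltW M0)// /M lerDr ltW.
apply: le_trans M2.
apply: (@le_trans _ _ (avg (nq k) (fun Z : {ffun 'I_(N k) -> 'I_Q} => (M ^+ 2)^-1 * \sum_j jointX Z j 0 ^+ 2))).
  by apply: ler_avg => Z _; exact: escape_le.
rewrite avgZ ler_wpM2l ?invr_ge0 ?sqr_ge0// avg_sum (le_trans _ sB)//; apply: ler_sum => j _.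
have -> : avg (nq k) (fun Z : {ffun 'I_(N k) -> 'I_Q} => jointX Z j 0 ^+ 2) =
    avg (nq k) (fun Z : {ffun 'I_(N k) -> 'I_Q} => lstat (am k (delta_mx j 0)) Z ^+ 2).
  apply: eq_avg => Z hZ; rewrite -dot_jointX//; congr (_ ^+ 2).
  have dE i : (delta_mx j 0 : 'cV[R]_T) i 0 = (i == j)%:R by rewrite mxE eqxx andbT.
  rewrite /dotv (bigD1 j)//= dE eqxx mul1r big1 ?addr0// => i ij.
  by rewrite dE (negbTE ij) mul0r.
apply: avg_lstat_sqr_le0 => //; rewrite big1// => i _; exact: amat_row0.
Qed.

Variable a : 'I_H -> R.
Hypothesis a_gt0 : forall h, 0 < a h.

Definition blkP : pred (option 'I_H) := fun b => b != None.
Definition blka (b : option 'I_H) : R := if b is Some h then a h else 0.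

(* The Mahalanobis distance of tier [h] is the squared norm of the [h]-th block
   up to a relative error tending to zero. *)
Lemma accepted_ball (e : R) : 0 < e -> \forall k \near \oo, forall Z : {ffun 'I_(N k) -> 'I_Q},
  (accepted iota eff tier (@x k) (nq k) a Z ->
     forall b, blkP b -> bnorm (@blk K H tier L) b (jointX Z) <= blka b * (1 + e)) /\
  (~~ accepted iota eff tier (@x k) (nq k) a Z ->
     exists2 b, blkP b & blka b * (1 - e) <= bnorm (@blk K H tier L) b (jointX Z)).
Proof.
move=> e0.
pose Om k h : 'M[R]_(dm h) := (Rt h)^T *m invmx (Wxw iota eff tier (wn k) (Sxx (@x k)) h) *m Rt h - 1%:M.
pose eta k : R := \sum_h \sum_i \sum_j `|Om k h i j|.
have eta_cvg : eta k @[k --> \oo] --> 0.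
  rewrite [X in _ --> X](_ : 0 = \sum_h \sum_(i < dm h) \sum_(j < dm h) `|(0 : R)|); last first.
    by rewrite big1// => h _; rewrite big1// => i _; rewrite big1// => j _; rewrite normr0.
  apply: cvg_bigsum => h _; apply: cvg_bigsum => i _; apply: cvg_bigsum => j _; apply: cvg_norm.
  have : mcvg (fun k => Om k h) ((Rt h)^T *m invmx (Wxw iota eff tier wt Sx h) *m Rt h - 1%:M).
    apply: mcvgB; last exact: mcvg_cst.
    apply: mcvg_mul; last exact: mcvg_cst.
    apply: mcvg_mul; first exact: mcvg_cst.
    apply: mcvg_inv => //.
      exact: (Wxw_cvg iota_bij eff_inj (wt_ := fun k => wn k) wn_gt0 wt_gt0 wt_cvg (Sx_ := fun k => Sxx (@x k))).
    by move=> k; exact: Wxw_unit.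
  have -> : (Rt h)^T *m invmx (Wxw iota eff tier wt Sx h) *m Rt h - 1%:M = 0.
    apply/eqP; rewrite subr_eq0; apply/eqP; rewrite -RtE -mulmxA; apply: mulmx1C.
    rewrite -mulmxA mulVmx// unitmx_mul unitmx_tr Rt_unit//.
  by move=> /(_ i j); rewrite mxE.
pose d : R := Num.min (e / (1 + e)) (Num.min e (1/2)).
have d0 : 0 < d by rewrite !lt_min divr_gt0//= ?e0//; lra.
move/cvgrPdist_le/(_ _ d0) : eta_cvg; apply: filterS => k; rewrite sub0r normrN => hk Z.
have eta0 : 0 <= eta k by apply: sumr_ge0 => h _; apply: sumr_ge0 => i _; apply: sumr_ge0.
rewrite ger0_norm// in hk.
have Mh h : `|Mstat iota eff tier (@x k) (nq k) Z h - bnorm (@blk K H tier L) (Some h) (jointX Z)|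
    <= d * bnorm (@blk K H tier L) (Some h) (jointX Z).
  rewrite Mstat_scale//= bnorm_blk glue_D.
  move: (Num.sqrt _ *: _) => th; pose y := invmx (Rt h) *m th.
  have -> : th = Rt h *m y by rewrite mulKVmx.
  rewrite -/y mulKmx//.
  have -> : ((Rt h *m y)^T *m invmx (Wxw iota eff tier (wn k) (Sxx (@x k)) h) *m (Rt h *m y)) 0 0 - nsq y =
      (y^T *m Om k h *m y) 0 0.
    rewrite /Om mulmxBr mulmxBl mulmx1 [RHS]mxE [X in _ = _ + X]mxE; congr (_ - _).
    by rewrite trmx_mul !mulmxA.
  rewrite (le_trans (quad_form_le _ _))// ler_wpM2r ?nsq_ge0// (le_trans _ hk)//.
  rewrite /eta [leRHS](bigD1 h)//= lerDl; apply: sumr_ge0 => l _; apply: sumr_ge0 => i _.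
  exact: sumr_ge0.
have [d1 d2 d3] : [/\ d <= e / (1 + e), d <= e & d <= 1 / 2].
  by split; rewrite /d !ge_min lexx ?orbT.
have d1' : d * (1 + e) <= e by rewrite -ler_pdivlMr//; lra.
split=> [/forallP acc [h|//] _|].
  have := acc h; have := Mh h; rewrite ler_norml /blka => /andP[h1 h2] h3.
  have b0 := bnorm_ge0 (@blk K H tier L) (Some h) (jointX Z).
  move: (bnorm _ _ _) b0 h1 h2 => y b0 h1 h2.
  have h4 : y * (1 - d) <= a h by lra.
  have h5 : 1 <= (1 - d) * (1 + e) by lra.
  have : y * 1 <= y * ((1 - d) * (1 + e)) by rewrite ler_wpM2l.
  have : y * (1 - d) * (1 + e) <= a h * (1 + e) by rewrite ler_wpM2r//; lra.
  lra.
rewrite negb_forall => /existsP[h]; rewrite -ltNge => acc; exists (Some h) => //.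
have := Mh h; rewrite ler_norml /blka => /andP[h1 h2].
have b0 := bnorm_ge0 (@blk K H tier L) (Some h) (jointX Z).
move: (bnorm _ _ _) b0 h1 h2 => y b0 h1 h2.
have ah := a_gt0 h.
have h4 : a h <= y * (1 + d) by lra.
have [e1|e1] := leP 1 e; first by rewrite (le_trans _ b0)// mulr_ge0_le0 ?(ltW ah)//; lra.
have : a h * (1 - e) <= y * (1 + d) * (1 - e) by rewrite ler_wpM2r//; lra.
have : y * ((1 + d) * (1 - e)) <= y * 1 by rewrite ler_wpM2l//; nra.
lra.
Qed.

End JointLimit.

Section ConditionalLaw.
Context {R : realType}.

Lemma density_Rintegral (d : measure_display) (T : measurableType d) (P Nu : probability T R)
    (h f : T -> R) : bmeas h -> bmeas f ->
  (forall E, measurable E -> Nu E = (\int[P]_(t in E) (h t)%:E)%E) ->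
  \int[Nu]_t f t = \int[P]_t (h t * f t).
Proof.
move=> bh bf NuE; have [mh _] := bh; have [mf _] := bf.
have mhE : measurable_fun setT (EFin \o h) by exact/measurable_EFinP.
have dom : Nu `<< P.
  apply/null_content_dominatesP => A mA PA0; rewrite NuE//.
  by apply: null_set_integral => //; exact: measurable_funTS.
have intf : Nu.-integrable setT (EFin \o f) by exact: bmeas_integrable.
rewrite /Rintegral; congr fine.
rewrite -(Radon_Nikodym_change_of_variables dom)//=.
under [RHS]eq_integral do rewrite EFinM muleC.
apply: ae_eq_integral => //.
- by apply: emeasurable_funM => //; exact/measurable_EFinP.
- by apply: emeasurable_funM => //; exact/measurable_EFinP.
apply: ae_eqe_mul2l; rewrite Radon_NikodymE.
case: cid => h' [/= _ inth hE]; apply: integral_ae_eq => //.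
by move=> E _ mE; rewrite -hE// NuE.
Qed.

Lemma mnormalizeE (d : measure_display) (T : measurableType d)
    (mu : {measure set T -> \bar R}) (P : probability T R) (c : R) E :
  mu setT = c%:E -> 0 < c -> mnormalize mu P E = (mu E * (c^-1)%:E)%E.
Proof. by move=> muT c0; rewrite /mnormalize muT eqe gt_eqF. Qed.

Lemma bball_natE m (B : finType) (beta : 'I_m -> B) (P : pred B) (a : B -> R) x :
  bball beta P a x = [forall b, P b ==> (bnorm beta b x <= a b)%R]%:R.
Proof.
have [/forallP h|] := boolP [forall b, P b ==> (bnorm beta b x <= a b)%R]; last first.
  rewrite negb_forall => /existsP[b]; rewrite negb_imply => /andP[Pb hb].
  by rewrite /bball (bigD1 b)//= (negbTE hb) mul0r.
by rewrite /bball big1// => b Pb; have := h b; rewrite Pb/= => ->.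
Qed.

Lemma gauss_cond_law m p (B : finType) (beta : 'I_m -> B) (P : pred B) (a : B -> R)
    (A : 'M[R]_(p, m)) : 0 < gaussE (fun t : m.-tuple R => bball beta P a (tcol t)) ->
  exists mu : probability (p.-tuple R) R, forall g : 'cV[R]_p -> R, bcont g ->
    \int[mu]_t g (tcol t) = gaussE (fun t => g (A *m tcol t) * bball beta P a (tcol t)) /
                            gaussE (fun t : m.-tuple R => bball beta P a (tcol t)).
Proof.
pose ib (t : m.-tuple R) : R := bball beta P a (tcol t).
rewrite -/ib => c_gt0; set c := gaussE ib in c_gt0 *.
have bib : bmeas ib by exact: bmeas_bball.
have [mib _] := bib.
pose D : set (m.-tuple R) := ib @^-1` [set 1].
have mD : measurable D by rewrite -[D]setTI; exact: mib.
have ibE : ib = \1_D.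
  apply/funext => t; rewrite indicE.
  have : ib t = _ := bball_natE beta P a (tcol t).
  case: [forall b, _] => ibt; rewrite ibt; first by rewrite mem_set.
  rewrite memNset// => ibt1; move: ibt; rewrite [ib t]ibt1 => /eqP.
  by rewrite oner_eq0.
have PD : gaussP m D = c%:E.
  rewrite /c gaussEE// /Rintegral ibE.
  under eq_integral do rewrite -/(EFin _).
  by rewrite integral_indic// setIT fineK// fin_num_measure.
pose Nu : probability (m.-tuple R) R := mnormalize (mrestr (gaussP m) mD) (gaussP m).
have NuE E : measurable E -> Nu E = (\int[gaussP m]_(t in E) (c^-1 * ib t)%:E)%E.
  move=> mE; have ev : mrestr (gaussP m) mD setT = c%:E by rewrite /mrestr setTI.
  have -> : Nu E = (mrestr (gaussP m) mD E * (c^-1)%:E)%E by exact: mnormalizeE.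
  rewrite /mrestr ibE.
  under eq_integral do rewrite EFinM.
  rewrite ge0_integralZl//=.
  - by rewrite integral_indic// muleC setIC.
  - by apply/measurable_EFinP; exact: measurable_indic.
  - by rewrite lee_fin invr_ge0 ltW.
pose f (t : m.-tuple R) : p.-tuple R := [tuple (A *m tcol t) i 0 | i < p].
have mf : measurable_fun setT f.
  apply/measurable_fun_tnthP => i.
  rewrite (_ : _ \o f = fun t : m.-tuple R => \sum_j A i j * tcol t j 0); last first.
    by apply/funext => t; rewrite /= tnth_mktuple mxE.
  by apply: measurable_sum => j; apply: measurable_funM => //; exact: measurable_tcol.
pose X : {mfun m.-tuple R >-> p.-tuple R} := mfun_Sub (mem_set mf).
exists (distribution Nu X) => g cg.
have fE t : tcol (f t) = A *m tcol t by apply/colP => i; rewrite mxE tnth_mktuple.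
have bg := bmeas_tcol cg; have [mg _] := bg.
have bgA : bmeas (fun t : m.-tuple R => g (A *m tcol t)).
  by apply: (bmeas_tcol (f := fun x => g (A *m x))); exact: bcont_mulmx.
have bgX : bmeas (fun t : m.-tuple R => g (tcol (f t))).
  by rewrite (_ : (fun t => _) = fun t : m.-tuple R => g (A *m tcol t))//; apply/funext => t; rewrite fE.
transitivity (\int[Nu]_t g (tcol (f t))).
  rewrite /Rintegral integral_distribution//; first exact/measurable_EFinP.
  exact: (bmeas_integrable Nu bgX).
rewrite (density_Rintegral _ bgX NuE); last by apply: bmeasM => //; exact: bmeas_cst.
rewrite -gaussEE; last by apply: bmeasM => //; apply: bmeasM => //; exact: bmeas_cst.
rewrite mulrC -gaussEZ; last exact: bmeasM.
by congr gaussE; apply/funext => t; rewrite fE -mulrA (mulrC (ib t)).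
Qed.

End ConditionalLaw.

Section Assembly.
Context {R : realType} (K : nat).
Variables (iota : 'I_(2 ^ K) -> {ffun 'I_K -> bool}) (eff : 'I_(2 ^ K).-1 -> {set 'I_K}).
Local Notation Q := (2 ^ K)%N.
Local Notation F := (2 ^ K).-1.
Variables (H : nat) (tier : 'I_F -> 'I_H) (L : nat).
Local Notation FT := (Ftier tier).
Local Notation T := (Tdim tier L).
Local Notation dm h := (#|FT h| * L)%N.

Lemma Wxw_tr (wt : 'I_Q -> R) (Sx : 'M[R]_L) h : Sx^T = Sx ->
  (Wxw iota eff tier wt Sx h)^T = Wxw iota eff tier wt Sx h.
Proof.
move=> symS; rewrite /Wxw linearZ/= linear_sum/=; congr (_ *: _); apply: eq_bigr => q _.
by rewrite linearZ/= trmx_tens symS trmx_mul trmxK.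
Qed.

Lemma Wxw_psd (wt : 'I_Q -> R) (Sx : 'M[R]_L) h : (forall q, 0 < wt q) -> Sx^T = Sx ->
  (forall d : 'rV[R]_L, 0 <= (d *m Sx *m d^T) 0 0) ->
  forall u : 'cV[R]_(dm h), 0 <= (u^T *m Wxw iota eff tier wt Sx h *m u) 0 0.
Proof.
move=> wt0 symS psdS u; rewrite -(umxK u); move: (umx u) => U.
rewrite /Wxw -scalemxAr -scalemxAl mxE mulr_ge0 ?sqr_ge0// mulmx_sumr mulmx_suml summxE.
apply: sumr_ge0 => q _; rewrite -scalemxAr -scalemxAl mxE mulr_ge0 ?(ltW (wt0 q))//.
rewrite -mulmxA tensmx_vmx -/(vmx _) vmx_dot symS.
move: (cw _ _ _ _ _ _) => c.
have -> : U^T *m (c *m c^T *m U *m Sx) = (c^T *m U)^T *m (c^T *m U *m Sx).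
  by rewrite trmx_mul trmxK !mulmxA.
by rewrite mxtrace_mulC /mxtrace big_ord1; exact: psdS.
Qed.

Lemma bnorm_glue_Some h (u : 'cV[R]_F) (d : forall h, 'cV[R]_(dm h)) :
  bnorm (@blk K H tier L) (Some h) (glue u d) = nsq (d h).
Proof. by rewrite bnorm_blk glue_D. Qed.

Lemma bnorm_glue_None (u : 'cV[R]_F) (d : forall h, 'cV[R]_(dm h)) :
  bnorm (@blk K H tier L) None (glue u d) = nsq u.
Proof.
rewrite bnorm_blk_None nsq_glue; under [X in _ - X]eq_bigr do rewrite glue_D.
by rewrite addrK.
Qed.

Lemma inballE (a : 'I_H -> R) (t : T.-tuple R) :
  inball a t = bball (@blk K H tier L) (@blkP H) (blka a) (tcol t).
Proof.
rewrite /bball (reindex_omap (fun h : 'I_H => Some h) id)/=; last by case.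
apply: eq_big => [h|h _]; first by rewrite eqxx.
by rewrite bnorm_blk Dmx_tcol /= -/(nsq (D_of t h)); case: (_ <= _).
Qed.

Lemma lhsE_avg n (Y : 'I_n -> 'I_Q -> R) (x : 'I_n -> 'cV[R]_L) (nq : 'I_Q -> nat)
    (a : 'I_H -> R) (g : 'cV[R]_F -> R) : (\sum_q nq q)%N = n ->
  lhsE iota eff tier Y x nq a g =
  avg nq (fun Z => g (Num.sqrt n%:R *: (tauhat iota eff Y nq Z - tau iota eff Y)) *
                   (accepted iota eff tier x nq a Z)%:R) /
  avg nq (fun Z => (accepted iota eff tier x nq a Z)%:R).
Proof.
move=> sum_nq; have [Z0 hZ0] := ex_has_sizes sum_nq.
have admE (Z : {ffun 'I_n -> 'I_Q}) : admissible nq Z = has_sizes nq Z.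
  apply: eq_forallb => q; congr (_ == _); apply: eq_card => i.
  by apply/idP/idP; rewrite !inE.
have c0 : #|has_sizes nq : pred {ffun 'I_n -> 'I_Q}|%:R != 0 :> R.
  by rewrite pnatr_eq0 -lt0n; apply/card_gt0P; exists Z0.
have sumE (f : {ffun 'I_n -> 'I_Q} -> R) : \sum_(Z | has_sizes nq Z) f Z * (accepted iota eff tier x nq a Z)%:R =
    \sum_(Z | admissible nq Z && accepted iota eff tier x nq a Z) f Z.
  rewrite [RHS](eq_bigl (fun Z => has_sizes nq Z && accepted iota eff tier x nq a Z)); last first.
    by move=> Z; rewrite admE.
  rewrite [RHS]big_mkcondr; apply: eq_bigr => Z _.
  by case: (accepted _ _ _ _ _ _ _); rewrite ?mulr1 ?mulr0.
rewrite /avg -mulf_div mulfV ?invr_neq0// mul1r sumE /lhsE; congr (_ / _).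
have -> : \sum_(Z | has_sizes nq Z) (accepted iota eff tier x nq a Z)%:R =
    \sum_(Z | has_sizes nq Z) 1 * (accepted iota eff tier x nq a Z)%:R :> R.
  by apply: eq_bigr => Z _; rewrite mul1r.
rewrite (sumE (fun=> 1)) sumr_const; congr (_ *+ _).
apply: eq_card => Z; apply/idP/idP; rewrite !inE//.
Qed.

End Assembly.

Lemma cvg_ge0 (R : realType) (u : nat -> R) (l : R) : (forall k, 0 <= u k) ->
  u k @[k --> \oo] --> l -> 0 <= l.
Proof.
move=> u0 ul; rewrite leNgt; apply/negP => l0.
have e0 : 0 < - l / 2 by lra.
move/cvgrPdist_le/(_ _ e0) : ul => [k _ /(_ k (leqnn k))]; have := u0 k.
by rewrite ler_norml => ? /andP[? ?]; lra.
Qed.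

Lemma mcvg_quad (R : realType) m (A_ : nat -> 'M[R]_m) A (v : 'cV[R]_m) : mcvg A_ A ->
  (v^T *m A_ k *m v) 0 0 @[k --> \oo] --> (v^T *m A *m v) 0 0.
Proof.
move=> cA; have : mcvg (fun k => v^T *m A_ k *m v) (v^T *m A *m v).
  by apply: mcvg_mul; [apply: mcvg_mul => //; exact: mcvg_cst|exact: mcvg_cst].
exact.
Qed.

Lemma mcvg_sym (R : realType) m (A_ : nat -> 'M[R]_m) A : (forall k, (A_ k)^T = A_ k) ->
  mcvg A_ A -> A^T = A.
Proof.
move=> sA cA; apply/matrixP => i j; rewrite mxE.
have c1 := cA j i; have c2 := cA i j.
rewrite (_ : (fun k => A_ k i j) = fun k => A_ k j i) in c2; last first.
  by apply/funext => k; rewrite -{1}sA mxE.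
by have := cvg_unique _ c1 c2; apply.
Qed.

Theorem theorem7 (R : realType) (K : nat)
  (iota : 'I_(2 ^ K) -> {ffun 'I_K -> bool})
  (eff : 'I_(2 ^ K).-1 -> {set 'I_K})
  (H : nat) (tier : 'I_(2 ^ K).-1 -> 'I_H) (a : 'I_H -> R)
  (L : nat) (N : nat -> nat)
  (Y : forall k : nat, 'I_(N k) -> 'I_(2 ^ K) -> R)
  (x : forall k : nat, 'I_(N k) -> 'cV[R]_L)
  (nq : nat -> 'I_(2 ^ K) -> nat)
  (Vr : nat -> 'M[R]_((2 ^ K).-1))
  (Wr : forall (k : nat) (h : 'I_H), 'M[R]_((2 ^ K).-1, #|Ftier tier h| * L)) :
  (0 < K)%N -> (0 < L)%N ->
  bijective iota ->
  injective eff -> (forall f, eff f != finset.set0) ->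
  (forall h : 'I_H, exists f, tier f = h) ->
  (forall h, 0 < a h) ->
  (* the population size n = N k tends to infinity *)
  (forall M : nat, exists k0 : nat, forall k, (k0 <= k)%N -> (M <= N k)%N) ->
  (* CRFE group sizes *)
  (forall k q, (0 < nq k q)%N) ->
  (forall k, (\sum_q nq k q)%N = N k) ->
  (* regularity condition (i) *)
  (forall q, exists p : R, 0 < p /\
     ((nq k q)%:R / (N k)%:R : R) @[k --> \oo] --> p) ->
  (* regularity condition (ii) *)
  (forall q q', exists l : R, Sqk (Y k) q q' @[k --> \oo] --> l) ->
  (forall k, Sxx (x k) \in unitmx) ->
  (exists Sinf : 'M[R]_L, Sinf \in unitmx /\ Sxx (x k) @[k --> \oo] --> Sinf) ->
  (forall q, exists l : 'rV[R]_L, Sqx (Y k) (x k) q @[k --> \oo] --> l) ->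
  (* regularity condition (iii) *)
  (forall q, (\big[Num.max/0]_i (Y k i q - Ybar (Y k) q) ^+ 2) / (N k)%:R
               @[k --> \oo] --> 0) ->
  (\big[Num.max/0]_i \sum_j ((x k i - xbar (x k)) j 0) ^+ 2) / (N k)%:R
     @[k --> \oo] --> 0 ->
  (* Vr k = (V^perp_tautau)^{1/2}, the symmetric PSD square root *)
  (forall k, (Vr k)^T = Vr k) ->
  (forall k (v : 'cV[R]_((2 ^ K).-1)), 0 <= (v^T *m Vr k *m v) 0 0) ->
  (forall k, Vr k *m (Vr k)^T = Vperp iota eff (Y k) (x k) (nq k)) ->
  (* Wr k h = (W^par_tautau[h])^{1/2}_{L F_h}, any such root *)
  (forall k h, Wr k h *m (Wr k h)^T = W_par iota eff tier (Y k) (x k) (nq k) h) ->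
  (* both sqrt(n)(tauhat - tau) | T_F and sqrt(n) * (the limiting representation)
     converge weakly to the same law mu on R^F *)
  exists mu : probability ((2 ^ K).-1.-tuple R) R,
    forall g : 'cV[R]_((2 ^ K).-1) -> R,
      continuous g -> (exists M : R, forall v, `|g v| <= M) ->
      lhsE iota eff tier (Y k) (x k) (nq k) a g @[k --> \oo]
         --> \int[mu]_t g (tcol t)
      /\ rhsE (N k) (Vr k) (Wr k) a g @[k --> \oo]
         --> \int[mu]_t g (tcol t).
Proof.
move=> K_gt0 L_gt0 iota_bij eff_inj eff_neq0 tier_onto a_gt0 N_infty nq_gt0 sum_nq.
move=> /choice[p pP] Sqk_cvg Sxx_unit [Sx [Sx_unit /mx_cvgP Sx_cvg]] /choice[Sc ScP].
move=> Y_lind x_lind _ _ VrE WrE.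
pose F := (2 ^ K).-1.
have N1_gt0 k : (0 < (N k).-1)%N.
  have : (\sum_(q < 2 ^ K) 1 <= \sum_q nq k q)%N by apply: leq_sum => q _.
  rewrite sum_nq sum1_card card_ord => le; rewrite -ltnS prednK.
    by apply: leq_trans le; rewrite -{1}(expn1 2) leq_exp2l.
  by apply: leq_trans le; rewrite expn_gt0.
have N_gt0 k : (0 < N k)%N by have := N1_gt0 k; case: (N k).
pose wt q := (p q)^-1.
have wt_gt0 q : 0 < wt q by rewrite invr_gt0; have [] := pP q.
have wn_gt0 k q : 0 < invprop (N k) (nq k) q :> R by exact: invprop_gt0.
have wt_cvg q : invprop (N k) (nq k) q @[k --> \oo] --> wt q.
  have [p0 pc] := pP q.
  rewrite (_ : (fun k => _) = fun k => ((nq k q)%:R / (N k)%:R)^-1); last first.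
    by apply/funext => k; rewrite invf_div.
  by apply: cvgV => //; rewrite gt_eqF.
have [Sy' Sy'P] := choice (fun qr : 'I_(2 ^ K) * 'I_(2 ^ K) => Sqk_cvg qr.1 qr.2).
pose Sy q r := Sy' (q, r).
have Sy_cvg q r : Sqk (Y k) q r @[k --> \oo] --> Sy q r by exact: (Sy'P (q, r)).
have Sxm : mcvg (fun k => Sxx (x k)) Sx by [].
have Sc_cvg q : mcvg (fun k => Sqx (Y k) (x k) q) (Sc q) by have /mx_cvgP := ScP q.
have symSx : Sx^T = Sx by apply: (mcvg_sym _ Sxm) => k; exact: fpcov_tr.
have psdSx (d : 'rV[R]_L) : 0 <= (d *m Sx *m d^T) 0 0.
  have := @mcvg_quad R L _ _ d^T Sxm; rewrite trmxK; apply: cvg_ge0 => k.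
  exact: fpcov_psd.
have Vn k : Vres iota eff (invprop (N k) (nq k)) (Sqk (Y k)) (Sxx (x k)) (Sqx (Y k) (x k)) =
    (N k)%:R *: (Vr k *m (Vr k)^T) by rewrite VrE Vperp_scale.
have Vc := Vres_cvg (iota := iota) (eff := eff) wt_cvg Sy_cvg Sxm Sc_cvg Sxx_unit Sx_unit.
have Vm : mcvg (fun k => (N k)%:R *: (Vr k *m (Vr k)^T)) (Vres iota eff wt Sy Sx Sc).
  by rewrite (_ : (fun k => _) = fun k => Vres iota eff (invprop (N k) (nq k)) (Sqk (Y k)) (Sxx (x k)) (Sqx (Y k) (x k)))//; apply/funext => k; rewrite Vn.
have quadE m n (c : R) (A : 'M[R]_(m, n)) (v : 'cV[R]_m) : (v^T *m (c *: (A *m A^T)) *m v) 0 0 = c * nsq (A^T *m v).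
  by rewrite -scalemxAr -scalemxAl mxE nsq_mul trmxK.
have [Vt VtE] : exists M : 'M[R]_F, M *m M^T = Vres iota eff wt Sy Sx Sc.
  apply: psd_root; first by apply: (mcvg_sym _ Vm) => k; rewrite linearZ/= trmx_mul trmxK.
  move=> v; have := mcvg_quad (v := v) Vm; apply: cvg_ge0 => k.
  by rewrite quadE mulr_ge0// nsq_ge0.
have Rt_ex h : exists M : 'M[R]_(#|Ftier tier h| * L), M *m M^T = Wxw iota eff tier wt Sx h.
  by apply: psd_root; [exact: Wxw_tr|exact: Wxw_psd].
pose Rt h := sval (cid (Rt_ex h)).
have RtE h : Rt h *m (Rt h)^T = Wxw iota eff tier wt Sx h by rewrite /Rt; case: cid.
have Wu h : Wxw iota eff tier wt Sx h \in unitmx by exact: Wxw_unit.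
have Rt_unit h : Rt h \in unitmx by have := Wu h; rewrite -RtE unitmx_mul => /andP[].
pose Ct h := Wtw iota eff tier wt Sc h *m (invmx (Rt h))^T.
pose E := Emx (R := R) tier L; pose D := Dmx (R := R) tier L.
pose J := jointA iota eff wt Sc Vt Rt.
pose A := E^T *m J.
have blk_ex b : blkP b -> exists i, blk (L := L) (tier := tier) i == b.
  case: b => // h _; have [f fh] := tier_onto h.
  have c0 : (0 < #|Ftier tier h| * L)%N.
    by rewrite muln_gt0 L_gt0 andbT; apply/card_gt0P; exists f; rewrite inE fh.
  by exists (dpos (Ordinal c0)); rewrite blk_dpos.
have blka_gt0 b : blkP b -> 0 < blka a b by case: b => [h _|//]; exact: a_gt0.
have bb_gt0 := bball_gt0 (@blk K H tier L) blka_gt0.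
have [mu muE] := gauss_cond_law A bb_gt0.
exists mu => g cg gM.
have bg : bcont g by [].
rewrite muE//; split.
  have Jb b y : blkP b -> bnorm (@blk K H tier L) b (J *m y) = bnorm (@blk K H tier L) b y.
    by case: b => // h _; rewrite !bnorm_blk mulmxA jointA_D.
  have clt := joint_clt iota_bij eff_inj eff_neq0 N_infty N1_gt0 nq_gt0 sum_nq wt_gt0 wt_cvg
    Sy_cvg Sxm Sc_cvg Sx_unit Y_lind x_lind VtE RtE.
  have ball := accepted_ball Y iota_bij eff_inj N1_gt0 nq_gt0 wt_gt0 wt_cvg Sxm Sxx_unit
    Sx_unit RtE a_gt0.
  have lim G := avg_accepted_cvg blka_gt0 blk_ex Jb clt ball (G := G).
  rewrite (_ : (fun k => _) = fun k =>
    avg (nq k) (fun Z : {ffun 'I_(N k) -> 'I_(2 ^ K)} =>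
      g (E^T *m jointX iota eff Y x nq Rt Z) * (accepted iota eff tier (x k) (nq k) a Z)%:R) /
    avg (nq k) (fun Z : {ffun 'I_(N k) -> 'I_(2 ^ K)} =>
      1 * (accepted iota eff tier (x k) (nq k) a Z)%:R)); last first.
    apply/funext => k; rewrite lhsE_avg//; congr (_ / _).
      by congr avg; apply/funext => Z; rewrite glue_E.
    by congr avg; apply/funext => Z; rewrite mul1r.
  apply: cvgM.
    have := lim (fun y => g (E^T *m y)) (bcont_mulmx E^T bg).
    rewrite [X in _ --> X -> _](_ : _ = gaussE (fun t => g (A *m tcol t) *
      bball (@blk K H tier L) (@blkP H) (blka a) (tcol t)))//.
    by congr gaussE; apply/funext => t; rewrite mulmxA.
  apply: cvgV; first by rewrite gt_eqF.
  have := lim (fun=> 1) (bcont_cst _ 1).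
  rewrite [X in _ --> X -> _](_ : _ = gaussE (fun t =>
    bball (@blk K H tier L) (@blkP H) (blka a) (tcol t)))//.
  by congr gaussE; apply/funext => t; rewrite mul1r.
pose A_ k : 'M[R]_(F, Tdim tier L) := Num.sqrt (N k)%:R *: (Vr k *m E^T + \sum_h Wr k h *m (D h)^T).
rewrite (_ : (fun k => _) = fun k => gaussE (fun t => g (A_ k *m tcol t) *
      bball (@blk K H tier L) (@blkP H) (blka a) (tcol t)) /
    gaussE (fun t => bball (@blk K H tier L) (@blkP H) (blka a) (tcol t))); last first.
  apply/funext => k; rewrite /rhsE; congr (_ / _); congr gaussE; apply/funext => t; last first.
    exact: inballE.
  rewrite inballE; congr (g _ * _); rewrite /A_ -scalemxAl; congr (_ *: _).
  rewrite mulmxDl -mulmxA Emx_tcol mulmx_suml; congr (_ + _).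
  by apply: eq_bigr => h _; rewrite -mulmxA Dmx_tcol.
apply: gauss_image_cvg => // v b.
have A_tr k : (A_ k)^T *m v = glue (Num.sqrt (N k)%:R *: ((Vr k)^T *m v))
    (fun h => Num.sqrt (N k)%:R *: ((Wr k h)^T *m v)).
  rewrite /A_ /glue linearZ/= -scalemxAl linearD/= mulmxDl scalerDr; congr (_ + _).
    by rewrite trmx_mul trmxK -scalemxAr mulmxA.
  rewrite linear_sum/= mulmx_suml scaler_sumr; apply: eq_bigr => h _.
  by rewrite trmx_mul trmxK -scalemxAr mulmxA.
have Atr : A^T *m v = glue (Vt^T *m v) (fun h => (Ct h)^T *m v).
  rewrite /A /J jointA_E /glue linearD/= mulmxDl; congr (_ + _).
    by rewrite trmx_mul trmxK mulmxA.
  by rewrite linear_sum/= mulmx_suml; apply: eq_bigr => h _; rewrite trmx_mul trmxK mulmxA.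
have nsqN k m (u : 'cV[R]_m) : nsq (Num.sqrt (N k)%:R *: u) = (N k)%:R * nsq u.
  by rewrite nsqZ sqr_sqrtr.
rewrite Atr; under eq_fun do rewrite A_tr.
case: b => [h|].
  rewrite bnorm_glue_Some; under eq_fun do rewrite bnorm_glue_Some nsqN -quadE WrE.
  have -> : nsq ((Ct h)^T *m v) = (v^T *m (Wtw iota eff tier wt Sc h *m
      invmx (Wxw iota eff tier wt Sx h) *m (Wtw iota eff tier wt Sc h)^T) *m v) 0 0.
    rewrite nsq_mul trmxK -RtE /Ct trmx_mul trmxK; congr (fun_of_matrix (_ *m _ *m _) 0 0).
    rewrite !mulmxA; congr (_ *m _); rewrite -mulmxA; congr (_ *m _).
    apply: (can_inj (mulKmx (_ : Rt h *m (Rt h)^T \in unitmx))).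
      by rewrite unitmx_mul unitmx_tr Rt_unit.
    rewrite mulmxV ?unitmx_mul ?unitmx_tr ?Rt_unit//.
    by rewrite mulmxA -(mulmxA (Rt h)) -trmx_mul mulVmx// trmx1 mulmx1 mulmxV.
  rewrite (_ : (fun k => _) = fun k => (v^T *m (Wtw iota eff tier (invprop (N k) (nq k)) (Sqx (Y k) (x k)) h *m
    invmx (Wxw iota eff tier (invprop (N k) (nq k)) (Sxx (x k)) h) *m
    (Wtw iota eff tier (invprop (N k) (nq k)) (Sqx (Y k) (x k)) h)^T) *m v) 0 0); last first.
    by apply/funext => k; rewrite W_par_scale.
  apply: mcvg_quad.
  have cW := Wtw_cvg (tier := tier) iota_bij eff_inj wn_gt0 wt_gt0 wt_cvg Sc_cvg (h := h).
  apply: mcvg_mul; last by apply: mcvg_tr.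
  apply: mcvg_mul => //; apply: mcvg_inv => //.
    exact: (Wxw_cvg iota_bij eff_inj wn_gt0 wt_gt0 wt_cvg Sxm).
  by move=> k; exact: Wxw_unit.
rewrite bnorm_glue_None; under eq_fun do rewrite bnorm_glue_None nsqN -quadE.
rewrite -[nsq _]mul1r -quadE scale1r VtE.
exact: mcvg_quad.
Qed.
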